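(* Let $\Omega\subset\mathbb{R}^N$ ($N\ge 2$) be a bounded domain with smooth boundary, let $1<p,q<N$, and let $f,g:\Omega\times\mathbb{R}^2\to\mathbb{R}$ be Carathéodory functions satisfying (H.1) and (H.2). Then every solution $(u,v)$ of the system $$-\Delta_p u=f(x,u,v)\ \text{in }\Omega,\qquad -\Delta_q v=g(x,u,v)\ \text{in }\Omega,\qquad u=v=0\ \text{on }\partial\Omega \tag{P}$$ is bounded, i.e. belongs to $L^\infty(\Omega)\times L^\infty(\Omega)$.
   Context: $\Delta_p u=\operatorname{div}(|\nabla u|^{p-2}\nabla u)$ is the $p$-Laplacian. $p^\star=\frac{Np}{N-p}$ and $q^\star=\frac{Nq}{N-q}$. Carathéodory means: $f(\cdot,s,t)$, $g(\cdot,s,t)$ are measurable for every $(s,t)\in\mathbb{R}^2$ and $f(x,\cdot,\cdot)$, $g(x,\cdot,\cdot)$ are continuous for a.e. $x\in\Omega$. A solution of (P) is a pair $(u,v)\in W_0^{1,p}(\Omega)\times W_0^{1,q}(\Omega)$ such that $\int_\Omega|\nabla u|^{p-2}\nabla u\cdot\nabla\varphi\,dx=\int_\Omega f(x,u,v)\varphi\,dx$ and $\int_\Omega|\nabla v|^{q-2}\nabla v\cdot\nabla\psi\,dx=\int_\Omega g(x,u,v)\psi\,dx$ for all $(\varphi,\psi)\in W_0^{1,p}(\Omega)\times W_0^{1,q}(\Omega)$ (provided the right-hand integrals exist). A constant $C$ with $1<C<\min\{\frac{p^\star}{p},\frac{q^\star}{q}\}$ is fixed, and $p_C'=\frac{Cp}{Cp-1}$,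 $q_C'=\frac{Cq}{Cq-1}$. (H.1): for every $(u,v)\in W_0^{1,p}(\Omega)\times W_0^{1,q}(\Omega)$, the function $x\mapsto f(x,u(x),v(x))$ belongs to $L^{p_C'}(\Omega)$ and $x\mapsto g(x,u(x),v(x))$ belongs to $L^{q_C'}(\Omega)$. (H.2): there is a positive function $k_{p,q}\in L^\infty(\Omega)$ such that $$\max\{|sf(x,s,t)|,|tg(x,s,t)|\}\le k_{p,q}(x)\,\min\{|s|^{\alpha+1}|t|^{\beta+1},\ |s|^{pC}+|t|^{qC}\}$$ for a.e. $x\in\Omega$ and all $s,t\in\mathbb{R}$, where $\alpha>-1$, $\beta>-1$ and $\frac{\alpha+1}{p}+\frac{\beta+1}{q}=1$. *)

(* Defs.v *)
(* Library: MathComp / MathComp-Analysis. *)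
From HB Require Import structures.
From mathcomp Require Import all_boot all_order all_algebra.
From mathcomp Require Import all_classical all_reals all_analysis.

Set Implicit Arguments.
Unset Strict Implicit.
Unset Printing Implicit Defensive.

Import Order.TTheory GRing.Theory Num.Theory.
Import numFieldNormedType.Exports.

Local Open Scope classical_set_scope.
Local Open Scope ring_scope.

Section LebesgueMeasure.
Context (R : realType) (N : nat).
Local Open Scope ereal_scope.

Definition box (ab : 'rV[R]_N * 'rV[R]_N) : set 'rV[R]_N :=
  [set x | forall i, (ab.1 0%R i < x 0%R i <= ab.2 0%R i)%R].

Definition box_vol (ab : 'rV[R]_N * 'rV[R]_N) : \bar R :=
  (\prod_i Num.max 0 (ab.2 0 i - ab.1 0 i))%R%:E.

(* The boxes B k, k \in P, form a countable cover; P may be finite or empty. *)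
Definition box_cover (A : set 'rV[R]_N)
    : set (set nat * (nat -> 'rV[R]_N * 'rV[R]_N)) :=
  [set PB | A `<=` \bigcup_(k in PB.1) box (PB.2 k)].

Definition leb_outer (A : set 'rV[R]_N) : \bar R :=
  ereal_inf [set \esum_(k in PB.1) box_vol (PB.2 k) | PB in box_cover A].

Lemma box_vol_ge0 ab : 0 <= box_vol ab.
Proof. by rewrite lee_fin; apply: prodr_ge0 => i _; rewrite le_max lexx. Qed.

Lemma leb_outer_ge0 A : 0 <= leb_outer A.
Proof.
apply: le_ereal_inf_tmp => _ [PB _ <-].
by apply: esum_ge0 => k _; exact: box_vol_ge0.
Qed.

Lemma leb_outer0 : leb_outer set0 = 0.
Proof.
apply/eqP; rewrite eq_le leb_outer_ge0 andbT.
apply: ereal_inf_lbound; exists (set0, fun=> (0%R, 0%R)) => //=.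
by rewrite esum_set0.
Qed.

Lemma le_leb_outer : {homo leb_outer : A B / A `<=` B >-> A <= B}.
Proof.
move=> A B AB; apply: ereal_inf_le_tmp => _ [PB cB <-].
by exists PB => //; exact: subset_trans cB.
Qed.

Lemma leb_outer_sigma_subadditive : sigma_subadditive leb_outer.
Proof.
move=> A; have [[i ioo]|] := pselect (exists i, leb_outer (A i) = +oo).
  rewrite (eseries_pinfty _ _ ioo) ?leey// => n _.
  by rewrite -ltNye (lt_le_trans _ (leb_outer_ge0 _)).
rewrite -forallNE => Aoo.
suff add2e (e : {posnum R}) :
    leb_outer (\bigcup_n A n) <= \sum_(i <oo) leb_outer (A i) + e%:num%:E.
  by apply/lee_addgt0Pr => _/posnumP[].
rewrite (le_trans _ (epsilon_trick _ _ _))//; last first.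
  by move=> n; exact: leb_outer_ge0.
pose Q n (PB : set nat * (nat -> 'rV[R]_N * 'rV[R]_N)) :=
  box_cover (A n) PB /\ \esum_(k in PB.1) box_vol (PB.2 k) <=
    leb_outer (A n) + (e%:num / (2 ^ n.+1)%:R)%:E.
have [G QG] : {G & forall n, Q n (G n)}.
  apply: (@choice _ _ Q) => n.
  have en1 : (0 < e%:num / (2 ^ n.+1)%:R)%R by [].
  have fA : leb_outer (A n) \is a fin_num.
    by rewrite ge0_fin_numE ?leb_outer_ge0// ltey; apply/eqP; exact: Aoo.
  have [_ [PB cB <-] /ltW h] := lb_ereal_inf_adherent en1 fA.
  by exists PB.
have /card_esym/ppcard_eqP[f] := card_nat2.
pose S := [set: nat] `*`` (fun i => (G i).1).
pose H (ij : nat * nat) := (G ij.1).2 ij.2.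
apply: (@le_trans _ _ (\esum_(k in f @^-1` S) box_vol (H (f k)))).
  apply: ereal_inf_lbound; exists (f @^-1` S, H \o f) => //=.
  move=> x [n _ Anx]; have [j Pj Bj] := (QG n).1 _ Anx.
  exists (f^-1%FUN (n, j)) => /=; first by rewrite invK ?inE.
  by rewrite invK ?inE.
have <- : \esum_(ij in S) box_vol (H ij) =
          \esum_(k in f @^-1` S) box_vol (H (f k)).
  apply: reindex_esum; split => [k //|k l _ _|ij Sij].
    by move=> /(congr1 f^-1%FUN); rewrite !funK ?inE.
  by exists (f^-1%FUN ij); rewrite /= invK ?inE.
rewrite /S -(esum_esum (a := fun i j => box_vol (H (i, j)))); last first.
  by move=> *; exact: box_vol_ge0.
have G0 n : 0 <= \esum_(j in (G n).1) box_vol (H (n, j)).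
  by apply: esum_ge0 => *; exact: box_vol_ge0.
rewrite -(nneseries_esumT G0); apply: lee_nneseries => n _ //.
exact: (QG n).2.
Qed.

HB.instance Definition _ := isOuterMeasure.Build R 'rV[R]_N leb_outer
  leb_outer0 leb_outer_ge0 le_leb_outer leb_outer_sigma_subadditive.

(* R^N with the (complete) sigma-algebra of Lebesgue measurable sets. *)
Definition lebT := caratheodory_type leb_outer.

HB.instance Definition _ := Measurable.on lebT.

Let leb_om : {outer_measure set 'rV[R]_N -> \bar R} := leb_outer.

Definition leb : set lebT -> \bar R := leb_outer.

HB.instance Definition _ := isMeasure.Build _ lebT R leb
  (@caratheodory_measure0 R _ leb_om) (@caratheodory_measure_ge0 R _ leb_om)
  (@caratheodory_measure_sigma_additive R _ leb_om).

End LebesgueMeasure.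

Arguments leb : clear implicits.

Section Smoothness.
Context (R : realType).

Definition partial (N : nat) (i : 'I_N) (f : 'rV[R]_N -> R) : 'rV[R]_N -> R :=
  fun x => 'D_(delta_mx 0 i) f x.

Fixpoint Ck (N k : nat) (f : 'rV[R]_N -> R) : Prop :=
  if k is k'.+1 then
    continuous f /\
    forall i, (forall x, derivable f x (delta_mx 0 i)) /\ Ck k' (partial i f)
  else continuous f.

Definition smooth (N : nat) (f : 'rV[R]_N -> R) : Prop := forall k, Ck k f.

(* Near each boundary point, after choosing a coordinate axis and its
   orientation, the set is the region strictly above the graph of a smooth
   function of the remaining coordinates. *)
Definition smooth_boundary (N : nat) (Omega : set 'rV[R]_N) : Prop :=
  forall x0, (closure Omega `&` closure (~` Omega)) x0 ->
  exists (i : 'I_N) (b : bool) (gamma : 'rV[R]_N.-1 -> R), smooth gamma /\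
    \forall x \near x0, Omega x <-> gamma (col' i x) < (-1) ^+ b * x 0 i.

Definition smooth_bounded_domain (N : nat) (Omega : set 'rV[R]_N) : Prop :=
  [/\ open Omega, connected Omega, Omega !=set0, bounded_set Omega
    & smooth_boundary Omega].

End Smoothness.

Section Sobolev.
Context (R : realType) (N : nat).
Implicit Types (Omega : set 'rV[R]_N) (u phi : 'rV[R]_N -> R)
  (Gu : 'rV[R]_N -> 'rV[R]_N).

(* Functions on Omega are represented by functions on R^N whose values outside
   Omega are irrelevant; p = +oo is allowed. *)
Definition LpOn Omega (p : \bar R) u : Prop :=
  (u \_ Omega : lebT R N -> R) \in Lfun (leb R N) p.

Definition normLp Omega (p : \bar R) u : \bar R :=
  'N[leb R N]_p[EFin \o (u \_ Omega : lebT R N -> R)]%E.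

Definition test_function Omega phi : Prop :=
  let K := closure [set x | phi x != 0] in
  [/\ smooth phi, compact K & K `<=` Omega].

Definition weak_partial Omega (i : 'I_N) u (w : 'rV[R]_N -> R) : Prop :=
  forall phi, test_function Omega phi ->
    \int[leb R N]_(x in Omega) (u x * partial i phi x) =
    - \int[leb R N]_(x in Omega) (w x * phi x).

(* u \in W^{1,p}(Omega) with weak gradient Gu *)
Definition sobolev Omega (p : R) u Gu : Prop :=
  [/\ LpOn Omega p%:E u,
      forall i, LpOn Omega p%:E (fun x => Gu x 0 i)
    & forall i, weak_partial Omega i u (fun x => Gu x 0 i)].

(* u \in W_0^{1,p}(Omega), the closure of C_c^oo(Omega) in W^{1,p}(Omega), with
   weak gradient Gu *)
Definition sobolev0 Omega (p : R) u Gu : Prop :=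
  sobolev Omega p u Gu /\
  exists phi : nat -> 'rV[R]_N -> R,
    [/\ forall n, test_function Omega (phi n),
        normLp Omega p%:E (fun x => u x - phi n x) @[n --> \oo] --> 0%E
      & forall i, normLp Omega p%:E (fun x => Gu x 0 i - partial i (phi n) x)
                    @[n --> \oo] --> 0%E].

Definition W01p Omega (p : R) u : Prop := exists Gu, sobolev0 Omega p u Gu.

Definition dot (a b : 'rV[R]_N) : R := \sum_i a 0 i * b 0 i.

(* The norm `|_| of 'rV[R]_N in the library is the sup norm. *)
Definition enorm (a : 'rV[R]_N) : R := Num.sqrt (dot a a).

End Sobolev.

Section System.
Context (R : realType) (N : nat).
Implicit Types (Omega : set 'rV[R]_N) (f g : 'rV[R]_N -> R -> R -> R)
  (u v : 'rV[R]_N -> R).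

Definition sobolev_exp (p : R) : R := N%:R * p / (N%:R - p).

Definition conj_exp (C p : R) : R := C * p / (C * p - 1).

Definition caratheodory Omega f : Prop :=
  (forall s t, measurable_fun (Omega : set (lebT R N))
                 (fun x : lebT R N => f x s t)) /\
  (\forall x \ae leb R N, Omega x ->
     continuous (fun st : R * R => f x st.1 st.2)).

Definition superposition_Lp Omega (p q C : R) f g : Prop :=
  forall u v, W01p Omega p u -> W01p Omega q v ->
    LpOn Omega (conj_exp C p)%:E (fun x => f x (u x) (v x)) /\
    LpOn Omega (conj_exp C q)%:E (fun x => g x (u x) (v x)).

Definition growth_bound Omega (p q C alpha beta : R) f g : Prop :=
  exists k : 'rV[R]_N -> R,
  [/\ forall x, Omega x -> 0 < k x,
      LpOn Omega +oo%E k
    & \forall x \ae leb R N, Omega x -> forall s t : R,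
        Num.max `|s * f x s t| `|t * g x s t| <=
        k x * Num.min (`|s| `^ (alpha + 1) * `|t| `^ (beta + 1))
                      (`|s| `^ (p * C) + `|t| `^ (q * C))].

(* int |Gu|^(p-2) Gu . Gphi; if Gu x = 0 the integrand is 0, also for p < 2 *)
Definition plaplacian_form Omega (p : R) (Gu Gphi : 'rV[R]_N -> 'rV[R]_N) : R :=
  \int[leb R N]_(x in Omega) (enorm (Gu x) `^ (p - 2) * dot (Gu x) (Gphi x)).

(* The equation is only required when its right-hand integral exists. *)
Definition weak_eq Omega (p : R) (Gu : 'rV[R]_N -> 'rV[R]_N)
    (h phi : 'rV[R]_N -> R) (Gphi : 'rV[R]_N -> 'rV[R]_N) : Prop :=
  (leb R N).-integrable Omega
    (fun x : lebT R N => (h x * phi x)%:E) ->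
  plaplacian_form Omega p Gu Gphi = \int[leb R N]_(x in Omega) (h x * phi x).

Definition solution Omega (p q : R) f g u v : Prop :=
  exists Gu Gv,
  [/\ sobolev0 Omega p u Gu, sobolev0 Omega q v Gv
    & forall phi psi Gphi Gpsi,
        sobolev0 Omega p phi Gphi -> sobolev0 Omega q psi Gpsi ->
        weak_eq Omega p Gu (fun x => f x (u x) (v x)) phi Gphi /\
        weak_eq Omega q Gv (fun x => g x (u x) (v x)) psi Gpsi].

End System.

(* Main.v *)
From HB Require Import structures.
Require Import Defs.
From mathcomp Require Import all_boot all_order all_algebra.
From mathcomp Require Import all_classical all_reals all_analysis.
From mathcomp Require Import measurable_realfun ess_sup_inf lra ring.
Set Implicit Arguments.
Unset Strict Implicit.
Unset Printing Implicit Defensive.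
Import Order.TTheory GRing.Theory Num.Theory.
Import numFieldNormedType.Exports.
Local Open Scope classical_set_scope.
Local Open Scope ring_scope.

(** The two equations are only used through the scalar density
    U = |u|^p + |v|^q. Since (alpha + 1)/p + (beta + 1)/q = 1, Young's
    inequality ([young_max]) turns the growth condition into
    |u f(x,u,v)|, |v g(x,u,v)| <= K U, and De Giorgi's method is run on the
    superlevel sets of max(|u| / M^(1/p), |v| / M^(1/q)) for a large M.

    Testing the first equation with (u - k)^+ bounds the integral of |Du|^p
    over {u > k} by that of K U over the same set ([energy], [level_incr]).
    Increments then take the place of a Sobolev inequality: the gradient of w
    = (u - k)^+ controls w(. + y) - w in L^p, and if {w > 0} has measure less
    than half of that of a cube of side r, then averaging over the shifts y in
    this cube gives int w^p <= C r^p int |Dw|^p ([faber_krahn]), because at a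
    given point x the value w(x + y) is zero for more than half of the y,
    where the increment is -w(x). The constant improves as {w > 0} gets
    smaller, which is the gain that the iteration needs.

    Put a = |u| / M^(1/p), b = |v| / M^(1/q), and let E(s) be the integral of
    a^p + b^q over {max(a, b) > s}. For s >= 1 this set has measure at most
    E(s), so when E(s) is small compared with r^N one gets
    int (a - s)_+^p + (b - s)_+^q <= L r E(s) ([abs_level] for each
    component), with a constant L that does not depend on M. On
    {max(a, b) > t}, t > s, the left-hand integrand is at least of order
    (t - s)^N (a^p + b^q) ([energy_step]). With levels s_n = 2 - 2^-n and
    radii r_n = r_0 2^(-N n), the bound E(s_n) <= c r_n^N propagates
    ([de_giorgi_iteration]); it holds at s_0 = 1 because E(1) is at most the
    integral of U divided by M. Hence a, b <= 2 almost everywhere.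

    Truncations are justified by approximation. (u - k)^+ is replaced by
    [softplus] o u, where [softplus] is smooth and vanishes at 0, so that it
    maps test functions to test functions; u is a limit of these in W^(1,p),
    and the composites converge as well ([W0ext_softplus]). All functions are
    extended by zero to the whole space, where translations act: that the
    integral of a partial derivative vanishes ([integral_partial0]) and that
    partial derivatives bound increments ([pnorm_incr_partial]) both come from
    the translation invariance of the measure and a first-order expansion. *)

(** * Lebesgue measure on row vectors *)

Section LebesgueOnRV.
Context (R : realType) (N : nat).
Local Notation mu := (leb R N).
Implicit Types (x y : 'rV[R]_N).

Definition set_coord (v : 'rV[R]_N) (i : 'I_N) (c : R) : 'rV[R]_N :=
  \row_j (if j == i then c else v 0 j).

(** A hyperplane orthogonal to an axis cuts a box into two boxes. If it misses
    the box, one of the pieces is degenerate and the truncation at 0 in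
    [box_vol] gives it volume 0. *)
Lemma box_vol_split (ab : 'rV[R]_N * 'rV[R]_N) i t :
  (box_vol (ab.1, set_coord ab.2 i (Num.min (ab.2 0 i) t)%R) +
  box_vol (set_coord ab.1 i (Num.max (ab.1 0 i) t)%R, ab.2))%E = box_vol ab.
Proof.
rewrite /box_vol /= -EFinD; congr (_%:E).
rewrite !(bigD1 (P := xpredT) i) //= !mxE eqxx.
under eq_bigr => j ji do rewrite mxE (negbTE ji).
under [X in (_ + _ * X)]eq_bigr => j ji do rewrite mxE (negbTE ji).
rewrite -mulrDl; congr (_ * _).
move: (ab.1 0 i) (ab.2 0 i) => a b.
by case: (leP b t) => ?; case: (leP a t) => ?; case: (leP 0 (b - a)) => ?;
  case: (leP 0 (t - a)) => ?; case: (leP 0 (b - t)) => ?;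
  rewrite ?(max_l (ltW _)) ?max_r ?max_l //; lra.
Qed.

(** Caratheodory's criterion for a half-space: cutting every box of a cover of
    X gives covers of the two parts of X, with the same total volume by
    [box_vol_split]. *)
Lemma measurable_halfspace i (t : R) :
  measurable ([set x | (x 0 i <= t)] : set (lebT R N)).
Proof.
apply: le_caratheodory_measurable => X.
apply: le_ereal_inf_tmp => _ [[P B] /= cB <-].
rewrite (eq_esum (b := fun k =>
   box_vol ((B k).1, set_coord (B k).2 i (Num.min ((B k).2 0 i) t)%R) +
   box_vol (set_coord (B k).1 i (Num.max ((B k).1 0 i) t)%R, (B k).2))%E); last first.
  by move=> k _; rewrite box_vol_split.
rewrite esumD; [|by move=> *; exact: box_vol_ge0..].
apply: leeD; apply: ereal_inf_lbound.
- exists (P, fun k => ((B k).1, set_coord (B k).2 i (Num.min ((B k).2 0 i) t))) => //=.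
  move=> x [/cB [k Pk Bk] /= xt]; exists k => // j /=; rewrite mxE.
  by case: eqP => [->|_]; rewrite ?le_min ?xt ?andbT; exact: Bk.
- exists (P, fun k => (set_coord (B k).1 i (Num.max ((B k).1 0 i) t), (B k).2)) => //=.
  move=> x [/cB [k Pk Bk] /= /negP]; rewrite -ltNge => xt; exists k => // j /=; rewrite mxE.
  case: eqP => [->|_]; last exact: Bk.
  by have /andP[h1 h2] := Bk i; rewrite h2 gt_max h1 xt.
Qed.

Lemma measurable_coord i : measurable_fun setT (fun x : lebT R N => x 0 i).
Proof.
move=> _; apply: (measurability _ (RGenOInfty.measurableE R)) => //.
move=> _ [_ [t ->] <-]; rewrite setTI.
rewrite [X in measurable X](_ : _ = ~` [set x : lebT R N | x 0 i <= t]).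
  by apply: measurableC; exact: measurable_halfspace.
by apply/seteqP; split => x /=; rewrite in_itv /= andbT ltNge => /negP.
Qed.

Lemma measurable_box ab : measurable (box ab : set (lebT R N)).
Proof.
rewrite (_ : box ab = \bigcap_(i in [set: 'I_N])
   [set x | (ab.1 0 i < x 0 i <= ab.2 0 i)]); last first.
  by apply/seteqP; split => x h i; [move=> _|]; exact: h.
apply: fin_bigcap_measurable => // i _.
rewrite -[X in measurable X]setTI.
have := measurable_coord i measurableT (measurable_itv `]ab.1 0 i, ab.2 0 i]).
by congr measurable; apply/seteqP; split => x; rewrite /= in_itv.
Qed.

Lemma measurable_leb_ball x (e : R) : 0 < e -> measurable (ball x e : set (lebT R N)).
Proof.
move=> e0; rewrite [X in measurable X](_ : _ = \bigcap_(i in [set: 'I_N])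
   ((fun y : lebT R N => y 0 i) @^-1` (ball (x 0 i) e))); last first.
  apply/seteqP; split => y.
    by move=> [_ h] i _; exact: h.
  move=> h; split => // i j; rewrite (ord1 i); exact: h.
apply: fin_bigcap_measurable => // i _.
by rewrite -[X in measurable X]setTI; apply: measurable_coord => //; exact: measurable_ball.
Qed.

(** An open set is the union of the balls with rational centre and radius
    1/(n+1) that it contains, and these are countably many. *)
Lemma open_measurable_leb (A : set 'rV[R]_N) : open A -> measurable (A : set (lebT R N)).
Proof.
move=> oA.
pose c (z : 'rV[rat]_N * nat) : set 'rV[R]_N := ball (map_mx ratr z.1 : 'rV[R]_N) (z.2.+1%:R^-1).
rewrite [X in measurable X](_ : _ = \bigcup_(z in [set z | c z `<=` A]) (c z : set (lebT R N))); last first.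
  apply/seteqP; split=> [x Ax|x [z]]; last exact.
  have /nbhs_ballP[e /= e0 xeA] := open_nbhs_nbhs (conj oA Ax).
  have [n ne] : exists n, (n.+1%:R^-1 < e / 2 :> R).
    exists (Num.truncn ((e / 2)^-1)).
    rewrite invf_plt ?posrE//; last by rewrite divr_gt0.
    exact: truncnS_gt.
  have /choice[r hr] : forall i, exists r : rat, (`|x 0 i - ratr r| < n.+1%:R^-1).
    move=> i; have [r] := @rat_in_itvoo R (x 0 i - n.+1%:R^-1) (x 0 i + n.+1%:R^-1)
      ltac:(by rewrite ltrD2l gtrN// invr_gt0).
    by rewrite in_itv/= => h; exists r; rewrite ltr_distlC.
  have cx : c (\row_i r i, n) x.
    by split => [|i j]; rewrite ?invr_gt0// /ball /= !mxE (ord1 i) distrC.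
  exists (\row_i r i, n) => // y cy; apply: xeA.
  have h1 : ball x (e / 2) (map_mx ratr (\row_i r i) : 'rV[R]_N).
    by apply: ball_sym; apply: le_ball cx; exact: ltW.
  have h2 : ball (map_mx ratr (\row_i r i) : 'rV[R]_N) (e / 2) y.
    by apply: le_ball cy; exact: ltW.
  by have := ball_triangle h1 h2; rewrite -splitr.
rewrite (_ : \bigcup_(z in _) _ = \bigcup_(n in [set: nat])
    (if unpickle n is Some z then [set x : lebT R N | c z `<=` A /\ c z x] else set0)); last first.
  apply/seteqP; split => [x [z cz czx]|x [n _]].
    by exists (pickle z) => //; rewrite pickleK.
  by case: (unpickle n) => // z [cz czx]; exists z.
apply: bigcup_measurable => n _; case: (unpickle n) => // z.
have [cz|cz] := pselect (c z `<=` A).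
  rewrite [X in measurable X](_ : _ = (c z : set (lebT R N)));
    first by apply: measurable_leb_ball; rewrite invr_gt0.
  by apply/seteqP; split => x // -[].
rewrite [X in measurable X](_ : _ = (set0 : set (lebT R N))) //.
by apply/seteqP; split => x // -[].
Qed.

Lemma continuous_measurable_leb (f : 'rV[R]_N -> R) : continuous f ->
  measurable_fun setT (f : lebT R N -> R).
Proof.
move=> cf.
move=> _; apply: (measurability _ (RGenOInfty.measurableE R)) => //.
move=> _ [_ [t ->] <-]; rewrite setTI.
by apply: open_measurable_leb; apply: open_comp => // x _; exact: cf.
Qed.

Definition translate (y x : 'rV[R]_N) : 'rV[R]_N := x + y.

Definition cube (r : R) : set 'rV[R]_N := box (0, const_mx r).

Lemma box_vol_affine (r : R) (y : 'rV[R]_N) ab : 0 < r ->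
  box_vol (r *: ab.1 + y, r *: ab.2 + y) = ((r ^+ N)%:E * box_vol ab)%E.
Proof.
move=> r0; rewrite /box_vol /= -EFinM; congr EFin.
rewrite -[N in r ^+ N]card_ord -prodr_const -big_split /=.
apply: eq_bigr => i _; rewrite !mxE opprD addrACA subrr addr0 -mulrBr.
by rewrite maxr_pMr ?(ltW r0)// mulr0.
Qed.

Lemma esumZl (P : set nat) (c : R) (a : nat -> \bar R) : 0 <= c ->
  (forall k, (0 <= a k)%E) ->
  (\esum_(k in P) (c%:E * a k) = c%:E * \esum_(k in P) a k)%E.
Proof.
move=> c0 a0.
rewrite (_ : P = [set k | k \in P]); last by apply/seteqP; split=> k /=; rewrite inE.
rewrite -nneseries_esum; last by move=> k _; rewrite mule_ge0.
by rewrite -nneseries_esum // nneseriesZl.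
Qed.

(** Homotheties and translations map boxes to boxes, hence covers to covers. *)
Lemma leb_outer_affine_le (r : R) (y : 'rV[R]_N) A : 0 < r ->
  (leb_outer [set (r *: x + y)%R | x in A] <= (r ^+ N)%:E * leb_outer A)%E.
Proof.
move=> r0.
have rN0 : 0 < r ^+ N by rewrite exprn_gt0.
rewrite -lee_pdivrMl//.
apply: le_ereal_inf_tmp => _ [[P B] /= cB <-].
rewrite lee_pdivrMl// -esumZl ?(ltW rN0)//; last by move=> k; exact: box_vol_ge0.
under eq_esum do rewrite -(box_vol_affine y)//.
apply: ereal_inf_lbound; exists (P, fun k => (r *: (B k).1 + y, r *: (B k).2 + y)) => //=.
move=> _ [x /cB [k Pk Bk] <-]; exists k => // i /=.
by rewrite !mxE ltrD2r lerD2r ltr_pM2l// ler_pM2l.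
Qed.

Lemma leb_outer_translate y A : leb_outer (translate y @^-1` A) = leb_outer A.
Proof.
have H z B : (leb_outer (translate z @^-1` B) <= leb_outer B)%E.
  have := @leb_outer_affine_le 1 (- z) B ltr01.
  rewrite expr1n mul1e => /(le_trans _); apply.
  apply: le_leb_outer => x Bx; exists (x + z) => //.
  by rewrite scale1r addrK.
apply/eqP; rewrite eq_le H /=.
rewrite -[X in (leb_outer X <= _)%E](_ : translate (- y) @^-1` (translate y @^-1` A) = A).
  exact: H.
by apply/seteqP; split => x; rewrite /translate /= subrK.
Qed.

(** Caratheodory's criterion only involves the outer measure, which is
    invariant under translations. *)
Lemma measurable_preimage_translate y (A : set (lebT R N)) :
  measurable A -> measurable (translate y @^-1` A : set (lebT R N)).
Proof.
move=> mA; apply: le_caratheodory_measurable => X.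
have cA : caratheodory_measurable (@leb_outer R N) A by [].
have E B : translate (- y) @^-1` (translate y @^-1` B) = B.
  by apply/seteqP; split => x; rewrite /translate /= subrK.
have cX : leb_outer X = (leb_outer (translate (- y) @^-1` X `&` A) +
    leb_outer (translate (- y) @^-1` X `&` ~` A))%E.
  by rewrite -(leb_outer_translate (- y) X); exact: cA.
suff -> : (leb_outer (X `&` (translate y @^-1` A)) + leb_outer (X `&` ~` (translate y @^-1` A)))%E
  = leb_outer X by [].
rewrite -(leb_outer_translate (- y) (X `&` _)) -(leb_outer_translate (- y) (X `&` ~` _)).
by rewrite !preimage_setI preimage_setC !E cX.
Qed.

Lemma measurable_translate y : measurable_fun setT (translate y : lebT R N -> lebT R N).
Proof. by move=> _ A mA; rewrite setTI; exact: measurable_preimage_translate. Qed.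

Lemma leb_box_le ab : (leb R N (box ab) <= box_vol ab)%E.
Proof.
apply: ereal_inf_lbound; exists ([set 0%N], fun=> ab) => /=.
  by move=> x Bx; exists 0%N.
by rewrite esum_set1// box_vol_ge0.
Qed.

(** The homothety of ratio 1/r maps [cube r] onto [cube 1]. The measure
    of small cubes is thus bounded below in terms of that of the unit cube,
    which is positive unless the measure is trivial ([leb_cube0]). *)
Lemma leb_cube_ge r : 0 < r -> ((r ^+ N)%:E * leb R N (cube 1) <= leb R N (cube r))%E.
Proof.
move=> r0; have rN0 : 0 < r ^+ N by rewrite exprn_gt0.
rewrite -lee_pdivlMl// -exprVn.
apply: le_trans (leb_outer_affine_le 0 (cube r) _); last by rewrite invr_gt0.
apply: le_leb_outer => x Qx; exists (r *: x).
  move=> i; have := Qx i; rewrite !mxE /= => /andP[h1 h2].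
  by rewrite mulr_gt0//= ler_piMr// ltW.
by rewrite scalerA mulVf ?gt_eqF// scale1r addr0.
Qed.

Definition big_box (n : nat) : set 'rV[R]_N := box (const_mx (- n%:R), const_mx n%:R).

Lemma big_box_cover : [set: 'rV[R]_N] = \bigcup_n big_box n.
Proof.
apply/seteqP; split => // x _.
exists (Num.truncn (\sum_i `|x 0 i|)).+1 => // i; rewrite !mxE /=.
have h : `|x 0 i| < (Num.truncn (\sum_i `|x 0 i|)).+1%:R.
  apply: le_lt_trans (truncnS_gt _).
  by rewrite (bigD1 i)//= lerDl sumr_ge0.
by move: h; rewrite ltr_norml => /andP[-> /ltW ->].
Qed.

Lemma leb_big_box_lty n : (leb R N (big_box n) < +oo)%E.
Proof. by apply: le_lt_trans (leb_box_le _) _; rewrite ltry. Qed.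

Lemma leb_sigma_finite : sigma_finite setT (leb R N).
Proof.
exists big_box; first exact: big_box_cover.
by move=> n; split; [exact: measurable_box|exact: leb_big_box_lty].
Qed.

HB.instance Definition _ := @Measure_isSigmaFinite.Build _ _ _ (leb R N) leb_sigma_finite.

(** The centred boxes exhaust the space, and they are images of the unit cube
    under homotheties and translations. *)
Lemma leb_cube0 : (0 < N)%N -> leb R N (cube 1) = 0%E -> leb R N setT = 0%E.
Proof.
move=> N0 Q0.
have B0 n : leb R N (big_box n) = 0%E.
  apply/eqP; rewrite eq_le measure_ge0 andbT.
  case: n => [|n].
    apply: le_trans (le_leb_outer (_ : _ `<=` set0)) _; last by rewrite leb_outer0.
    move=> x Bx /=; have := Bx (Ordinal N0); rewrite !mxE /= oppr0 => /andP[].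
    by move=> /lt_le_trans /[apply]; rewrite ltxx.
  have n0 : 0 < 2 * n.+1%:R :> R by rewrite mulr_gt0.
  have := leb_outer_affine_le (const_mx (- n.+1%:R)) (cube 1) n0.
  rewrite -/(leb R N (cube 1)) Q0 mule0; apply: le_trans.
  apply: le_leb_outer => x Bx; exists ((2 * n.+1%:R)^-1 *: (x + const_mx n.+1%:R)).
    move=> i; have := Bx i; rewrite !mxE /= => /andP[h1 h2].
    rewrite mulr_gt0 ?invr_gt0//; last by rewrite -ltrBlDr sub0r.
    by rewrite ler_pdivrMl// mulr1; lra.
  rewrite scalerA divff ?gt_eqF// scale1r.
  by apply/rowP => i; rewrite !mxE addrK.
apply/eqP; rewrite eq_le measure_ge0 andbT big_box_cover.
apply: le_trans (leb_outer_sigma_subadditive _) _.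
by rewrite eseries0// => n _ _; exact: B0.
Qed.

End LebesgueOnRV.

(** * Lebesgue norms and increments *)

Section Lnorms.
Context d (T : measurableType d) (R : realType) (mu : {measure set T -> \bar R}).
Implicit Types (f g : T -> R) (p : R).

Definition meas f := measurable_fun [set: T] f.

Definition pnorm p f : \bar R := 'N[mu]_p%:E[EFin \o f]%E.

Lemma meas_powR p f : meas f -> meas (fun x => `|f x| `^ p).
Proof.
move=> h; apply: (measurableT_comp (measurable_powR p)).
exact: measurableT_comp.
Qed.

Lemma emeas_powR p f : meas f ->
  measurable_fun setT (fun x : T => (`|f x| `^ p)%:E).
Proof. by move=> h; apply/measurable_EFinP; exact: meas_powR. Qed.

Lemma pnormE p f : pnorm p f = ((\int[mu]_x (`|f x| `^ p)%:E) `^ p^-1)%E.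
Proof. by rewrite /pnorm unlock. Qed.

Lemma pnorm_ge0 p f : (0 <= pnorm p f)%E. Proof. exact: Lnorm_ge0. Qed.

Lemma pnormN p f : pnorm p (\- f)%R = pnorm p f.
Proof. by rewrite !pnormE; under eq_integral do rewrite /= normrN. Qed.

Lemma measN f : meas f -> meas (\- f)%R.
Proof. by move=> h; exact: measurableT_comp. Qed.

Lemma measD f g : meas f -> meas g -> meas (f \+ g)%R.
Proof. by move=> h1 h2; exact: measurable_funD. Qed.

Lemma measB f g : meas f -> meas g -> meas (f \- g)%R.
Proof. by move=> h1 h2; exact: measurable_funB. Qed.

Lemma measM f g : meas f -> meas g -> meas (f \* g)%R.
Proof. by move=> h1 h2; exact: measurable_funM. Qed.

Lemma measZ c f : meas f -> meas (fun x => c * f x).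
Proof. by move=> h; apply: (measurable_funM (measurable_cst c) h). Qed.

Lemma pnormD p f g : 1 <= p -> meas f -> meas g -> (pnorm p (f \+ g)%R <= pnorm p f + pnorm p g)%E.
Proof. by move=> p1 h1 h2; exact: minkowski_EFin. Qed.

Lemma pnormB p f g : 1 <= p -> meas f -> meas g -> (pnorm p (f \- g)%R <= pnorm p f + pnorm p g)%E.
Proof. by move=> p1 h1 h2; rewrite -[pnorm p g]pnormN; apply: pnormD => //; exact: measN. Qed.

Lemma pnorm_le p f g : 0 <= p -> meas f -> meas g -> (forall x, `|f x| <= `|g x|) ->
  (pnorm p f <= pnorm p g)%E.
Proof.
move=> p0 h1 h2 h; rewrite !pnormE.
have I0 k : (0 <= \int[mu]_x (`|k x| `^ p)%:E)%E.
  by apply: integral_ge0 => x _; rewrite lee_fin powR_ge0.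
apply: gt0_ler_poweR; rewrite ?invr_ge0 ?in_itv/= ?I0 ?leey//.
apply: ge0_le_integral => //; [exact: emeas_powR|exact: emeas_powR|].
by move=> x _; rewrite lee_fin ge0_ler_powR ?nnegrE.
Qed.

Lemma pnormZ p c f : 1 <= p -> meas f -> (pnorm p (fun x => c * f x)%R = `|c|%:E * pnorm p f)%E.
Proof.
move=> p1 h; rewrite !pnormE.
have p0 : 0 < p by exact: lt_le_trans p1.
under eq_integral do rewrite /= normrM powRM// EFinM.
rewrite ge0_integralZl_EFin ?powR_ge0//; last exact: emeas_powR.
have I0 : (0 <= \int[mu]_x (`|f x| `^ p)%:E)%E.
  by apply: integral_ge0 => x _; rewrite lee_fin powR_ge0.
rewrite poweRM ?lee_fin ?powR_ge0//.
by rewrite poweR_EFin -powRrM mulfV ?gt_eqF// powRr1.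
Qed.

Lemma pnorm0 p : 0 < p -> pnorm p (cst 0) = 0%E.
Proof. by move=> p0; apply: Lnorm0; rewrite eqe gt_eqF. Qed.

End Lnorms.

Section LnormShift.
Context (R : realType) (N : nat).
Implicit Types (w f g : lebT R N -> R) (x y : 'rV[R]_N) (p : R).
Local Notation mu := (leb R N).
Local Notation meas := (@meas _ (lebT R N) R).

Lemma meas_translate f y : meas f -> meas (f \o translate y).
Proof. by move=> h; exact: (measurableT_comp h (measurable_translate y)). Qed.

Lemma ge0_integral_translate (F : lebT R N -> \bar R) y :
  measurable_fun setT F -> (forall x, 0 <= F x)%E ->
  (\int[mu]_x F (translate y x) = \int[mu]_x F x)%E.
Proof.
move=> mF F0.
rewrite -[LHS](@ge0_integral_pushforward _ _ (lebT R N) (lebT R N) R (translate y)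
  (@measurable_translate R N y) (mu) setT F measurableT mF (fun x _ => F0 x)).
refine (@eq_measure_integral _ _ _ setT (mu) _ F _).
by move=> A mA _; exact: (leb_outer_translate y A).
Unshelve. exact: measurable_translate.
Qed.

Lemma pnorm_translate p f y : meas f -> pnorm mu p (f \o translate y) = pnorm mu p f.
Proof.
move=> h.
have F0 x : (0 <= (`|f x| `^ p)%:E)%E by rewrite lee_fin powR_ge0.
by rewrite !pnormE -(ge0_integral_translate y (emeas_powR p h) F0).
Qed.

Definition incr y w x : R := w (translate y x) - w x.

Lemma meas_incr y w : meas w -> meas (incr y w).
Proof. by move=> h; apply: measB => //; exact: meas_translate. Qed.

(** A shift by y + z is a shift by z followed by one by y, and the second
    increment is a translate of [incr y w]. *)
Lemma pnorm_incrD p y z w : 1 <= p -> meas w ->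
  (pnorm mu p (incr (y + z) w) <= pnorm mu p (incr y w) + pnorm mu p (incr z w))%E.
Proof.
move=> p1 h; rewrite -(pnorm_translate p z (meas_incr y h)).
rewrite (_ : incr (y + z) w = ((incr y w \o translate z) \+ incr z w)%R).
  by apply: pnormD => //; [apply: meas_translate|]; exact: meas_incr.
apply/funext => x; rewrite /incr /translate /=.
by rewrite -(addrA x z y) (addrC z y); ring.
Qed.

Lemma pnorm_incr0 p w : 0 < p -> pnorm mu p (incr 0 w) = 0%E.
Proof.
move=> p0; rewrite -(pnorm0 mu p0); congr pnorm; apply/funext => x.
by rewrite /incr /translate addr0 subrr.
Qed.

Lemma pnorm_incr_natmul p y w m : 1 <= p -> meas w ->
  (pnorm mu p (incr (y *+ m) w) <= m%:R%:E * pnorm mu p (incr y w))%E.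
Proof.
move=> p1 h; elim: m => [|m IH].
  by rewrite mulr0n pnorm_incr0 ?mul0e// (lt_le_trans _ p1).
rewrite mulrS; apply: le_trans (pnorm_incrD _ _ p1 h) _.
by rewrite -natr1 EFinD ge0_muleDl ?lee_fin// mul1e [leRHS]addeC leeD2l.
Qed.

(** The increment of f - g is a difference of two functions that have the norm
    of f - g; increment estimates therefore pass to limits in norm. *)
Lemma pnorm_incrB p y f g : 1 <= p -> meas f -> meas g ->
  (pnorm mu p (incr y f) <= pnorm mu p (incr y g) + (pnorm mu p (f \- g)%R + pnorm mu p (f \- g)%R))%E.
Proof.
move=> p1 h1 h2; have h := measB h1 h2.
have hi := meas_translate y h.
rewrite -{1}(pnorm_translate p y h).
rewrite (_ : incr y f = (incr y g \+ (((f \- g)%R \o translate y) \- (f \- g)%R))%R).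
  apply: le_trans (pnormD mu p1 (meas_incr y h2) (measB hi h)) _.
  by rewrite leeD2l// pnormB.
by apply/funext => x; rewrite /incr /=; ring.
Qed.

Lemma sum_coord y : y = \sum_i (y 0 i) *: delta_mx 0 i.
Proof. exact: row_sum_delta. Qed.

Lemma pnorm_incr_sum p y w : 1 <= p -> meas w ->
  (pnorm mu p (incr y w) <= \sum_i pnorm mu p (incr (y 0%R i *: delta_mx 0%R i) w))%E.
Proof.
move=> p1 h; rewrite {1}(sum_coord y).
elim/big_ind2: _ => [|a b c d h1 h2|//].
  by rewrite pnorm_incr0// (lt_le_trans _ p1).
by apply: le_trans (pnorm_incrD _ _ p1 h) _; exact: leeD.
Qed.

End LnormShift.

(** * Calculus along lines, and a smooth truncation *)

Section Calculus.
Context (R : realType).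

Section Lines.
Context (V : normedModType R).
Implicit Types (f : V -> R) (a v : V).

(** One-variable results apply to derivatives in a direction v because the
    difference quotients are literally those of t |-> f (a + t v). *)
Lemma line_quotient f a v (s : R) :
  (fun h : R => h^-1 *: (((fun t : R => f (a + t *: v)) \o shift s) (h *: 1) - f (a + s *: v)))
  = (fun h : R => h^-1 *: ((f \o shift (a + s *: v)) (h *: v) - f (a + s *: v))).
Proof.
apply/funext => h /=; congr (_ *: (f _ - _)).
by rewrite [h *: 1]mulr1 scalerDl addrCA.
Qed.

Lemma is_derive_line f a v (s : R) : derivable f (a + s *: v) v ->
  is_derive s 1 (fun t : R => f (a + t *: v)) ('D_v f (a + s *: v)).
Proof.
move=> df; split.
  by rewrite /derivable line_quotient.
by rewrite /derive line_quotient.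
Qed.

Lemma is_derive_of_line f a v (df : R) :
  is_derive (0 : R) 1 (fun t : R => f (a + t *: v)) df -> is_derive a v f df.
Proof.
move=> [h1 h2].
have E : a + (0 : R) *: v = a by rewrite scale0r addr0.
split.
  by move: h1; rewrite /derivable line_quotient E.
by move: h2; rewrite /derive line_quotient E.
Qed.

Lemma is_derive_chain1 (h g : R -> R) (s dg dh : R) : is_derive s 1 g dg ->
  is_derive (g s) 1 h dh -> is_derive s 1 (h \o g) (dh * dg).
Proof.
move=> [dg1 dg2] [dh1 dh2]; split.
  by apply/derivable1_diffP; apply: differentiable_comp; apply/derivable1_diffP.
by rewrite -derive1E derive1_comp// !derive1E dg2 dh2.
Qed.

Lemma is_derive_chain f (h : R -> R) a v (dh : R) : derivable f a v ->
  is_derive (f a) 1 h dh -> is_derive a v (h \o f) (dh * 'D_v f a).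
Proof.
move=> df dh1; apply: is_derive_of_line.
have E : a + (0 : R) *: v = a by rewrite scale0r addr0.
have := @is_derive_line f a v 0; rewrite E => /(_ df) dl.
apply: (is_derive_chain1 (h := h) dl).
by rewrite E.
Qed.

End Lines.

Lemma line_mvt (V : normedModType R) (f : V -> R) (v : V) (a : V) (t : R) :
  (forall x, derivable f x v) -> 0 < t ->
  exists2 c, 0 <= c <= t & f (a + t *: v) - f a = t * 'D_v f (a + c *: v).
Proof.
move=> df t0.
have dl s := is_derive_line (df (a + s *: v)).
have [|c] := @MVT_segment R (fun s : R => f (a + s *: v))
  (fun s : R => 'D_v f (a + s *: v)) 0 t (ltW t0) (fun s _ => dl s).
  apply: continuous_subspaceT => s.
  by apply: differentiable_continuous; apply/derivable1_diffP; case: (dl s).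
rewrite in_itv /= => hc; rewrite scale0r addr0 subr0 => E.
by exists c => //; rewrite E mulrC.
Qed.

(** Compactness of K gives uniform continuity near K, and a pair with both
    points outside K contributes nothing. *)
Lemma unif_cont_compact_support (N : nat) (f : 'rV[R]_N -> R) (K : set 'rV[R]_N) (eta : R) :
  continuous f -> compact K -> (forall x, ~ K x -> f x = 0) -> 0 < eta ->
  exists2 d, 0 < d & forall x y, ball x d y -> `|f x - f y| < eta.
Proof.
move=> cf /compact_near_coveringP cK f0 e0.
pose P (d : R) (x : 'rV[R]_N) := forall y, ball x d y -> `|f x - f y| < eta.
have : \forall d \near 0^'+, K `<=` P d.
  apply: cK => x Kx.
  have e20 : 0 < eta / 2 by rewrite divr_gt0.
  have /cvgrPdist_lt /(_ _ e20) /nbhs_ballP [d /= d0 Hd] := cf x.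
  have d20 : 0 < d / 2 by rewrite divr_gt0.
  have hd : \forall e \near 0^'+, 0 < e /\ e < d / 2.
    by apply: filterI; [exact: nbhs_right_gt|exact: nbhs_right_lt].
  exists (ball x (d / 2), [set e : R | 0 < e /\ e < d / 2]) => /=.
    by split; [exact: nbhsx_ballx|].
  move=> [z e] /= [xz [e0' ed]] y zy.
  have xy : ball x d y.
    rewrite (splitr d); apply: ball_triangle xz _.
    by apply: le_ball zy; exact: ltW.
  have xz' : ball x d z by apply: le_ball xz; lra.
  have h1 := Hd _ xz'; have h2 := Hd _ xy.
  rewrite (splitr eta) -[f z - f y](subrKA (f x)).
  by apply: le_lt_trans (ler_normD _ _) _; rewrite distrC ltrD.
move=> Hd.
have /filter_ex [d [d0 HK]] : \forall d \near 0^'+, 0 < d /\ K `<=` P d.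
  by near=> d; split => //; near: d.
exists d => // x y xy.
have [Kx|nKx] := pselect (K x); first exact: HK.
have [Ky|nKy] := pselect (K y); first by rewrite distrC; apply: HK => //; exact: ball_sym.
by rewrite !f0// subrr normr0.
Unshelve. all: by end_near. Qed.

Section Ck.
Context (N : nat).
Implicit Types (f g phi : 'rV[R]_N -> R).

Lemma Ck_continuous k f : Ck k f -> continuous f.
Proof. by case: k => [//|k []]. Qed.

Lemma CkW k f : Ck k.+1 f -> Ck k f.
Proof.
elim: k f => [|k IH] f /=; first by case.
move=> [cf H]; split => // i; have [df Cf] := H i; split => //.
exact: IH.
Qed.

Lemma Ck_cst k (c : R) : Ck k (cst c : 'rV[R]_N -> R).
Proof.
elim: k c => [|k IH] c /=; first exact: cst_continuous.
split; first exact: cst_continuous.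
move=> i; split; first by move=> x; exact: derivable_cst.
rewrite (_ : partial i _ = cst 0); first exact: IH.
by apply/funext => x; rewrite /partial derive_cst.
Qed.

Lemma CkB k f g : Ck k f -> Ck k g -> Ck k (f - g).
Proof.
elim: k f g => [|k IH] f g /=.
  by move=> cf cg x; apply: continuousB; [exact: cf|exact: cg].
move=> [cf Hf] [cg Hg]; split.
  by move=> x; apply: continuousB; [exact: cf|exact: cg].
move=> i; have [df Cf] := Hf i; have [dg Cg] := Hg i; split.
  by move=> x; exact: derivableB.
rewrite (_ : partial i _ = partial i f - partial i g); first exact: IH.
by apply/funext => x; rewrite /partial deriveB.
Qed.

Lemma CkD k f g : Ck k f -> Ck k g -> Ck k (f + g).
Proof.
elim: k f g => [|k IH] f g /=.
  by move=> cf cg x; apply: continuousD; [exact: cf|exact: cg].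
move=> [cf Hf] [cg Hg]; split.
  by move=> x; apply: continuousD; [exact: cf|exact: cg].
move=> i; have [df Cf] := Hf i; have [dg Cg] := Hg i; split.
  by move=> x; exact: derivableD.
rewrite (_ : partial i _ = partial i f + partial i g); first exact: IH.
by apply/funext => x; rewrite /partial deriveD.
Qed.

Lemma CkM k f g : Ck k f -> Ck k g -> Ck k (f * g).
Proof.
elim: k f g => [|k IH] f g.
  by move=> cf cg x; apply: continuousM; [exact: cf|exact: cg].
move=> Cf1 Cg1; have Cf := CkW Cf1; have Cg := CkW Cg1.
move: Cf1 Cg1 => /= [cf Hf] [cg Hg]; split.
  by move=> x; apply: continuousM; [exact: cf|exact: cg].
move=> i; have [df Cdf] := Hf i; have [dg Cdg] := Hg i; split.
  by move=> x; exact: derivableM.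
rewrite (_ : partial i _ = f * partial i g + g * partial i f).
  by apply: CkD; exact: IH.
by apply/funext => x; rewrite /partial deriveM.
Qed.

End Ck.

Section Softplus.
Context (m k : R) (m0 : 0 < m).

Definition sigmoid (s : R) : R := expR (m * (s - k)) / (1 + expR (m * (s - k))).

Definition softplus0 (s : R) : R := m^-1 * ln (1 + expR (m * (s - k))).

(** A smooth substitute for s |-> max(s - k, 0), which it approaches uniformly
    as m grows ([softplus_approx]). Subtracting the value at 0 makes it vanish
    there, so that composing with it keeps supports compact. *)
Definition softplus (s : R) : R := softplus0 s - softplus0 0.

Let e_gt0 (s : R) : 0 < 1 + expR (m * (s - k)).
Proof. by rewrite addr_gt0// expR_gt0. Qed.

Let is_derive_e (s : R) : is_derive s 1 (fun s => 1 + expR (m * (s - k))) (m * expR (m * (s - k))).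
Proof.
have h : is_derive s 1 (fun s : R => m * (s - k)) m.
  apply: is_derive_eq; rewrite /GRing.scale /=; ring.
have h2 := @is_derive_chain1 expR _ s _ _ h (is_derive_expR _).
by apply: is_derive_eq; rewrite /=; ring.
Qed.

Lemma is_derive_softplus (s : R) : is_derive s 1 softplus (sigmoid s).
Proof.
have h := @is_derive_chain1 (@ln R) _ s _ _ (is_derive_e s) (is_derive1_ln (e_gt0 s)).
rewrite /softplus /softplus0.
apply: is_derive_eq.
rewrite subr0 /sigmoid /GRing.scale /=.
have := lt0r_neq0 (e_gt0 s); have := lt0r_neq0 m0.
by move: (expR _) => z ? ?; field; apply/andP.
Qed.

Lemma is_derive_sigmoid (s : R) : is_derive s 1 sigmoid (m * (sigmoid s * (1 - sigmoid s))).
Proof.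
have he := is_derive_e s.
have e0 := lt0r_neq0 (e_gt0 s).
have hV : is_derive s 1 (fun s => (1 + expR (m * (s - k)))^-1)
    (- (1 + expR (m * (s - k))) ^- 2 *: (m * expR (m * (s - k)))).
  split; first by apply: derivableV => //; case: he.
  by rewrite deriveV//; case: he => _ ->.
rewrite (_ : sigmoid = (fun s => 1 - (1 + expR (m * (s - k)))^-1)); last first.
  apply/funext => t; rewrite /sigmoid; have := lt0r_neq0 (e_gt0 t).
  by move: (expR _) => z z0; field.
apply: is_derive_eq.
rewrite /sigmoid /GRing.scale /=.
by move: (expR _) e0 => z z0; field.
Qed.

Lemma sigmoid_itv (s : R) : 0 <= sigmoid s <= 1.
Proof.
rewrite /sigmoid divr_ge0 ?expR_ge0 ?(ltW (e_gt0 _))//=.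
by rewrite ler_pdivrMr// mul1r lerDr.
Qed.

Lemma softplus_at0 : softplus 0 = 0. Proof. exact: subrr. Qed.

Lemma derive_lip (h dh : R -> R) (c s t : R) : 0 <= c ->
  (forall s : R, is_derive s 1 h (dh s)) -> (forall s, `|dh s| <= c) ->
  `|h s - h t| <= c * `|s - t|.
Proof.
move=> c0 hd hc.
wlog st : s t / t <= s.
  move=> W; have [/W//|/ltW/W] := leP t s.
  by rewrite distrC (distrC t).
have [|z _ ->] := @MVT_segment R h dh t s st (fun z _ => hd z).
  apply: continuous_subspaceT => z.
  by apply: differentiable_continuous; apply/derivable1_diffP; case: (hd z).
by rewrite normrM ler_wpM2r.
Qed.

Lemma softplus_lip (s t : R) : `|softplus s - softplus t| <= `|s - t|.
Proof.
rewrite -[leRHS]mul1r; apply: (@derive_lip _ sigmoid) => // [z|z]; first exact: is_derive_softplus.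
by have /andP[h1 h2] := sigmoid_itv z; rewrite ger0_norm.
Qed.

Lemma sigmoid_lip (s t : R) : `|sigmoid s - sigmoid t| <= m * `|s - t|.
Proof.
apply: (@derive_lip _ (fun z => m * (sigmoid z * (1 - sigmoid z)))) => [|z|z].
- exact: ltW.
- exact: is_derive_sigmoid.
have /andP[h1 h2] := sigmoid_itv z.
rewrite ger0_norm; last by rewrite mulr_ge0 ?(ltW m0)// mulr_ge0// subr_ge0.
by rewrite ler_piMr ?(ltW m0)// mulr_ile1 ?subr_ge0// gerBl.
Qed.

Lemma softplus_norm (s : R) : `|softplus s| <= `|s|.
Proof. by have := softplus_lip s 0; rewrite softplus_at0 !subr0. Qed.

Let softplus0_bnd (s : R) : Num.max (s - k) 0 <= softplus0 s <= Num.max (s - k) 0 + m^-1.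
Proof.
have eg := expR_gt0 (m * (s - k)).
apply/andP; split.
  rewrite ge_max; apply/andP; split; rewrite /softplus0 ler_pdivlMl//; last first.
    by rewrite mulr0 ln_ge0// lerDl ltW.
  by rewrite -[leLHS]expRK ler_ln ?posrE// lerDr.
rewrite /softplus0 ler_pdivrMl// [leRHS]mulrDr mulfV ?gt_eqF//.
rewrite -[leRHS]expRK ler_ln ?posrE ?expR_gt0//.
rewrite expRD.
(* With z = m (s - k): 1 + e^z <= 2 e^max(z, 0) <= e^(max(z, 0) + 1). *)
have e2 : 2 <= expR 1 :> R by have := expR_ge1Dx (1 : R); rewrite -natr1.
have h1 : 1 <= expR (m * Num.max (s - k) 0).
  by rewrite -expR0 ler_expR mulr_ge0 ?(ltW m0)// le_max lexx orbT.
have h2 : expR (m * (s - k)) <= expR (m * Num.max (s - k) 0).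
  by rewrite ler_expR ler_pM2l// le_max lexx.
nra.
Qed.

Lemma softplus_approx (s : R) : 0 <= k ->
  `|softplus s - Num.max (s - k) 0| <= m^-1.
Proof.
move=> k0; have /andP[h1 h2] := softplus0_bnd s; have /andP[] := softplus0_bnd 0.
have -> : Num.max (0 - k) 0 = 0 by apply: max_r; rewrite sub0r oppr_le0.
rewrite /softplus; move: (Num.max _ _) h1 h2 => z h1 h2 h3 h4.
by rewrite ler_norml; apply/andP; split; lra.
Qed.

(** The logistic equation sigmoid' = m sigmoid (1 - sigmoid) expresses the
    partial derivatives of sigmoid o phi through sigmoid o phi itself, so that
    regularity follows by induction on the order. *)
Lemma Ck_sigmoid (N j : nat) (phi : 'rV[R]_N -> R) : Ck j phi -> Ck j (sigmoid \o phi).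
Proof.
elim: j => [|j IH] Cphi.
  move=> x; apply: continuous_comp; first exact: (Ck_continuous Cphi).
  by apply: differentiable_continuous; apply/derivable1_diffP; case: (is_derive_sigmoid (phi x)).
have C1 := IH (CkW Cphi).
move: (Cphi) => /= [cphi H]; split.
  move=> x; apply: continuous_comp; first exact: cphi.
  by apply: differentiable_continuous; apply/derivable1_diffP; case: (is_derive_sigmoid (phi x)).
move=> i; have [dphi Cdphi] := H i.
have D x := is_derive_chain (dphi x) (is_derive_sigmoid (phi x)).
split; first by move=> x; case: (D x).
rewrite (_ : partial i _ = cst m * ((sigmoid \o phi) * (cst 1 - (sigmoid \o phi))) * partial i phi).
  apply: CkM => //; apply: CkM; first exact: Ck_cst.
  by apply: CkM => //; apply: CkB => //; exact: Ck_cst.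
by apply/funext => x; rewrite /partial; case: (D x) => _ ->.
Qed.

Lemma partial_softplus (N : nat) i (phi : 'rV[R]_N -> R) : (forall x, derivable phi x (delta_mx 0 i)) ->
  partial i (softplus \o phi) = (sigmoid \o phi) * partial i phi.
Proof.
move=> dphi; apply/funext => x.
by have [_ E] := is_derive_chain (dphi x) (is_derive_softplus (phi x)); rewrite /partial E.
Qed.

Lemma smooth_softplus (N : nat) (phi : 'rV[R]_N -> R) : smooth phi -> smooth (softplus \o phi).
Proof.
move=> sphi j; have := sphi j.+1; move/CkW => C0.
have cc : continuous (softplus \o phi).
  move=> x; apply: continuous_comp; first exact: (Ck_continuous C0).
  by apply: differentiable_continuous; apply/derivable1_diffP; case: (is_derive_softplus (phi x)).
case: j C0 => [//|j] Cphi.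
split => // i; have [_ /(_ i) [dphi Cdphi]] := Cphi.
split; first by move=> x; have [] := is_derive_chain (dphi x) (is_derive_softplus (phi x)).
rewrite partial_softplus//; apply: CkM => //; apply: Ck_sigmoid.
exact: CkW.
Qed.

End Softplus.

End Calculus.

(** * Compactly supported functions and translations *)

Section Integrals.
Context d (T : measurableType d) (R : realType) (mu : {measure set T -> \bar R}).
Implicit Types (f g : T -> R).

Definition integ f := mu.-integrable [set: T] (EFin \o f).

Lemma integ_meas f : integ f -> meas f.
Proof. by move=> /integrableP[h _]; exact/measurable_EFinP. Qed.

Lemma meas_norm f : meas f -> meas (fun x => `|f x|).
Proof. by move=> h; exact: measurableT_comp. Qed.

Lemma integP f : integ f <-> meas f /\ (\int[mu]_x (`|f x|)%:E < +oo)%E.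
Proof.
split; first by move=> /integrableP[h1 h2]; split => //; exact/measurable_EFinP.
by move=> [h1 h2]; apply/integrableP; split => //; exact/measurable_EFinP.
Qed.

Lemma integ_dom f g : meas f -> (forall x, `|f x| <= `|g x|) -> integ g -> integ f.
Proof.
move=> h fg; apply: le_integrable => //; first exact/measurable_EFinP.
by move=> x _; rewrite /= lee_fin.
Qed.

Lemma integD f g : integ f -> integ g -> integ (f \+ g)%R.
Proof. by move=> h1 h2; exact: (integrableD measurableT h1 h2). Qed.

Lemma integB f g : integ f -> integ g -> integ (f \- g)%R.
Proof. by move=> h1 h2; exact: (integrableB measurableT h1 h2). Qed.

Lemma integZ c f : integ f -> integ (fun x => c * f x).
Proof. by move=> h1; exact: (integrableZl measurableT c h1). Qed.

Lemma integ_indic A : measurable A -> (mu A < +oo)%E -> integ (\1_A).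
Proof.
move=> mA fA; apply/integrableP; split; first exact/measurable_EFinP.
under eq_integral do rewrite /= ger0_norm//.
by rewrite integral_indic// setIT.
Qed.

Lemma le_norm_Rint f g : integ f -> integ g -> (forall x, `|f x| <= g x) ->
  `|\int[mu]_x f x| <= \int[mu]_x g x.
Proof.
move=> h1 h2 fg; apply: le_trans (le_normr_Rintegral measurableT h1) _.
apply: le_Rintegral => //.
apply: (integ_dom _ _ h1) => //; first by apply: measurableT_comp => //; exact: (integ_meas h1).
by move=> x; rewrite normr_id.
Qed.

End Integrals.

Section CompactSupport.
Context (R : realType) (N : nat).
Implicit Types (f g : 'rV[R]_N -> R) (K : set 'rV[R]_N).
Local Notation mu := (leb R N).
Local Notation meas := (@meas _ (lebT R N) R).
Local Notation e_ i := (delta_mx 0 i : 'rV[R]_N).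

Lemma ler_coord_norm (x : 'rV[R]_N) i : `|x 0 i| <= `|x|.
Proof.
by rewrite [leRHS]mx_normrE; exact: (le_bigmax_cond _ (fun ij => `|x ij.1 ij.2|) (j := (0, i))).
Qed.

Lemma bounded_big_box K : bounded_set K -> exists n, K `<=` big_box n.
Proof.
move=> [M [_ HM]]; exists (Num.truncn (`|M| + 1)).+1 => x Kx i; rewrite !mxE /=.
have h : `|x 0 i| < (Num.truncn (`|M| + 1)).+1%:R.
  apply: le_lt_trans (truncnS_gt _).
  apply: le_trans (ler_coord_norm x i) _; apply: HM => //.
  by rewrite (le_lt_trans (ler_norm M))// ltrDl.
by move: h; rewrite ltr_norml => /andP[-> /ltW ->].
Qed.

Definition supp_in K f := forall x, ~ K x -> f x = 0.

Lemma partial_supp_in i f K : closed K -> supp_in K f -> supp_in K (partial i f).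
Proof.
move=> cK f0 x nKx; rewrite /partial -(derive_cst (0 : R) x (e_ i)).
apply: near_eq_derive.
have : nbhs x (~` K) by apply: open_nbhs_nbhs; split => //; exact: closed_openC.
by apply: filterS => y nKy; rewrite f0.
Qed.

Lemma coord_shift (i : 'I_N) (t : R) (x : 'rV[R]_N) j :
  (x + t *: e_ i) 0 j = x 0 j + t * (j == i)%:R.
Proof. by rewrite !mxE eqxx. Qed.

(** By the mean value theorem the error is the oscillation of the partial
    derivative, which is uniformly continuous. The box carrying the error does
    not depend on eta, so the error is small in every L^p norm. *)
Lemma incr_taylor i f K : Ck 1 f -> compact K -> supp_in K f ->
  exists n, forall eta, 0 < eta -> exists2 d, 0 < d & forall t, 0 < t < d -> forall x,
    `|incr (t *: e_ i) f x - t * partial i f x| <= t * (eta * \1_(big_box n) x).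
Proof.
move=> /= [cf /(_ i) [df cdf]] cK f0.
have clK : closed K by apply: compact_closed.
have df0 := partial_supp_in i clK f0.
have [n Kn] := bounded_big_box (compact_bounded cK).
(* Shifts are at most 1 long, so enlarging the box by 1 makes it contain all
   the points x that are in K or are shifted into K. *)
exists n.+1 => eta e0.
have [d d0 Hd] := unif_cont_compact_support cdf cK df0 e0.
exists (Num.min d 1); first by rewrite lt_min d0 ltr01.
move=> t /andP[t0]; rewrite lt_min => /andP[td t1] x.
rewrite /incr /translate.
have [Bx|nBx] := pselect (big_box n.+1 x).
  rewrite indicE mem_set// mulr1.
  have [c /andP[c0 ct] ->] := line_mvt x df t0.
  rewrite -mulrBr normrM gtr0_norm// ler_pM2l// ltW// distrC Hd//.
  split => // j k; rewrite (ord1 j) coord_shift /ball /= opprD addrA subrr sub0r normrN.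
  case: (k == i); rewrite ?mulr0 ?normr0// mulr1 ger0_norm//.
  exact: le_lt_trans td.
have nK y : K y -> (forall j, `|y 0 j - x 0 j| <= 1) -> False.
  move=> /Kn By h; apply: nBx => j.
  have := By j; rewrite !mxE /= -natr1 => /andP[h1 h2].
  by have := h j; rewrite ler_norml => /andP[h3 h4]; apply/andP; split; lra.
have nKx : ~ K x by move=> /nK; apply => j; rewrite subrr normr0.
have nKy : ~ K (x + t *: e_ i).
  move=> /nK; apply => j; rewrite coord_shift addrAC subrr add0r.
  by case: (j == i); rewrite ?mulr0 ?normr0// mulr1 ger0_norm ltW.
rewrite !f0// df0// subrr mulr0 subrr normr0.
by rewrite !mulr_ge0// ltW.
Qed.

Lemma meas_cont f : continuous f -> meas f.
Proof. exact: continuous_measurable_leb. Qed.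

Lemma cont_supp_bound f K : continuous f -> compact K -> supp_in K f ->
  exists n, exists2 M : R, 0 <= M & forall x, `|f x| <= M * \1_(big_box n) x.
Proof.
move=> cf cK f0.
have [n Kn] := bounded_big_box (compact_bounded cK).
have /compact_bounded [M [_ HM]] : compact (f @` K).
  by apply: continuous_compact => //; exact: continuous_subspaceT.
exists n, (`|M| + 1) => // x.
have [Kx|nKx] := pselect (K x); last by rewrite f0// normr0 mulr_ge0.
rewrite indicE mem_set ?mulr1; last exact: Kn.
by apply: HM; [rewrite (le_lt_trans (ler_norm M))// ltrDl|exists x].
Qed.

Lemma integ_cont_supp f K : continuous f -> compact K -> supp_in K f -> integ mu f.
Proof.
move=> cf cK f0; have [n [M M0 HM]] := cont_supp_bound cf cK f0.
apply: (@integ_dom _ (lebT R N) R mu f (fun x => M * \1_(big_box n) x)).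
- exact: meas_cont.
- by move=> x; rewrite [leRHS]ger0_norm ?mulr_ge0.
- apply: integZ; apply: integ_indic; [exact: measurable_box|exact: leb_big_box_lty].
Qed.

Lemma Rintegral_translate f y : integ mu f -> \int[mu]_x f (translate y x) = \int[mu]_x f x.
Proof.
move=> /integrableP[h _]; rewrite /Rintegral; congr fine.
rewrite [LHS]integralE [RHS]integralE.
have h1 := ge0_integral_translate y (measurable_funepos h) (@funepos_ge0 _ _ _).
have h2 := ge0_integral_translate y (measurable_funeneg h) (@funeneg_ge0 _ _ _).
by rewrite -h1 -h2; congr (_ - _)%E; apply: eq_integral => x _; rewrite ?funeposE ?funenegE.
Qed.

Lemma integ_translate f y : integ mu f -> integ mu (f \o translate y).
Proof.
move=> /integP[h fi]; apply/integP; split; first exact: meas_translate.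
have hh : measurable_fun setT (fun x : lebT R N => (`|f x|)%:E).
  by apply/measurable_EFinP; exact: meas_norm.
by rewrite (ge0_integral_translate y hh) // => x; rewrite lee_fin.
Qed.

(** A function and its translates have the same integral, so the integral of
    every difference quotient is zero; these converge to the partial
    derivative by [incr_taylor]. *)
Lemma integral_partial0 i f K : Ck 1 f -> compact K -> supp_in K f ->
  \int[mu]_x partial i f x = 0.
Proof.
move=> Cf cK f0.
have clK : closed K by apply: compact_closed.
have [cf /(_ i) [df cdf]] := Cf.
have If := integ_cont_supp cf cK f0.
have Idf := integ_cont_supp cdf cK (partial_supp_in i clK f0).
have It y := integ_translate y If.
have E n : measurable (big_box n : set (lebT R N)) by exact: measurable_box.
have [n Hn] := incr_taylor i Cf cK f0.
have key eta : 0 < eta -> `|\int[mu]_x partial i f x| <= eta * fine (mu (big_box n)).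
  move=> eta0; have [d d0 H] := Hn _ eta0.
  have d20 : 0 < d / 2 < d by apply/andP; split; lra.
  have := H _ d20; set t := d / 2 => Ht.
  have t0 : 0 < t by case/andP: d20.
  have I1 : integ mu (incr (t *: e_ i) f) := integB (It (t *: e_ i)) If.
  have I2 := integZ t Idf.
  have I3 : integ mu (\1_(big_box n)).
    by apply: integ_indic; [exact: E|exact: leb_big_box_lty].
  have := le_norm_Rint (integB I1 I2) (integZ t (integZ eta I3)) Ht.
  have E1 : \int[mu]_x incr (t *: e_ i) f x = 0.
    have := RintegralB measurableT (It (t *: e_ i)) If.
    by rewrite Rintegral_translate// subrr.
  rewrite (RintegralB measurableT I1 I2) E1 sub0r normrN.
  rewrite (RintegralZl t measurableT Idf) (RintegralZl t measurableT (integZ eta I3)).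
  rewrite (RintegralZl eta measurableT I3) normrM gtr0_norm// ler_pM2l//.
  by rewrite /Rintegral integral_indic// setIT.
apply/eqP; rewrite -normr_le0; apply/ler_addgt0Pr => e e0; rewrite add0r.
set V := fine (mu (big_box n)) in key.
have V0 : 0 <= V by rewrite fine_ge0.
have h : 0 < e / (V + 1) by rewrite divr_gt0// ltr_wpDl.
apply: le_trans (key _ h) _.
by rewrite -mulrA ler_piMr ?(ltW e0)// mulrC ler_pdivrMr ?ltr_wpDl// mul1r lerDl.
Qed.

Lemma pnorm_indic_lty p n : 0 < p -> (pnorm mu p (\1_(big_box n)) < +oo)%E.
Proof.
move=> p0; rewrite pnormE.
under eq_integral => x _.
  rewrite (_ : `|_| `^ p = \1_(big_box n) x); last first.
    by rewrite indicE; case: (x \in _) => /=; rewrite ?normr1 ?powR1 ?normr0 ?powR0 ?gt_eqF.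
  over.
rewrite integral_indic ?setIT; [|exact: measurableT|exact: measurable_box].
exact/poweR_lty/leb_big_box_lty.
Qed.

(** The norm of an increment is subadditive in the shift, so the shift may be
    divided into arbitrarily short ones, where [incr_taylor] applies. *)
Lemma pnorm_incr_partial p i f K (t : R) : 1 <= p -> Ck 1 f -> compact K -> supp_in K f ->
  0 < t -> (pnorm mu p (incr (t *: e_ i) f) <= t%:E * pnorm mu p (partial i f))%E.
Proof.
move=> p1 Cf cK f0 t0.
have p0 : 0 < p by exact: lt_le_trans p1.
have [cf /(_ i) [df cdf]] := Cf.
have mesf := meas_cont cf; have mdf := meas_cont cdf.
have [n Hn] := incr_taylor i Cf cK f0.
have mB : meas (\1_(big_box n)) by apply: measurable_indic; exact: measurable_box.
have key eta : 0 < eta ->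
    (pnorm mu p (incr (t *: e_ i) f) <= t%:E *
      (pnorm mu p (partial i f) + eta%:E * pnorm mu p (\1_(big_box n))))%E.
  move=> eta0; have [d d0 H] := Hn _ eta0.
  have [m md] : exists m, t / m.+1%:R < d.
    exists (Num.truncn (t / d)); rewrite ltr_pdivrMr// mulrC -ltr_pdivrMr//.
    exact: truncnS_gt.
  have m0 : 0 < t / m.+1%:R by rewrite divr_gt0.
  have {}H := H (t / m.+1%:R) ltac:(by rewrite m0).
  rewrite (_ : t *: e_ i = ((t / m.+1%:R) *: e_ i) *+ m.+1); last first.
    by rewrite scalerMnl -mulr_natr divfK.
  apply: le_trans (pnorm_incr_natmul _ _ p1 mesf) _.
  rewrite [in leRHS](_ : t = m.+1%:R * (t / m.+1%:R)); last by rewrite mulrC divfK.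
  rewrite EFinM -muleA lee_pmul2l ?lte_fin//.
  move: (t / m.+1%:R) m0 H => s s0 H.
  have mZ : meas (fun x => s * partial i f x) := measZ s mdf.
  have mI := meas_incr (s *: e_ i) mesf.
  have mD := measB mI mZ.
  have mE : meas (fun x => s * (eta * \1_(big_box n) x)) := measZ s (measZ eta mB).
  have Hle x : `|(incr (s *: e_ i) f \- (fun x => s * partial i f x)) x| <=
               `|s * (eta * \1_(big_box n) x)|.
    by rewrite [leRHS]ger0_norm ?mulr_ge0// ?(ltW s0)// ?(ltW eta0)//; exact: H.
  have h1 := pnorm_le mu (ltW p0) mD mE Hle.
  have h2 := pnormD mu p1 mZ mD.
  rewrite (_ : incr (s *: e_ i) f = ((fun x => s * partial i f x) \+
     (incr (s *: e_ i) f \- (fun x => s * partial i f x)))%R); last first.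
    by apply/funext => x /=; rewrite addrC subrK.
  apply: le_trans h2 _.
  rewrite (pnormZ _ _ p1 mdf) gtr0_norm// (ge0_muleDr _ (pnorm_ge0 _ _ _)); last first.
    by rewrite mule_ge0 ?pnorm_ge0// lee_fin ltW.
  rewrite leeD2l//; apply: le_trans h1 _.
  by rewrite (pnormZ _ _ p1 (measZ eta mB)) (pnormZ _ _ p1 mB) !gtr0_norm.
have V := pnorm_indic_lty n p0.
have V0 := pnorm_ge0 mu p (\1_(big_box n)).
apply/lee_addgt0Pr => e e0.
set W := pnorm mu p (\1_(big_box n)) in V V0 key *.
have fW : (fine W)%:E = W by rewrite fineK// ge0_fin_numE.
have W0ext : 0 <= fine W by rewrite fine_ge0.
have h : 0 < e / (t * (fine W + 1)) by rewrite divr_gt0// mulr_gt0// ltr_wpDl.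
apply: le_trans (key _ h) _.
have hW : (0 <= (e / (t * (fine W + 1)))%:E * W)%E by rewrite mule_ge0// lee_fin ltW.
rewrite (ge0_muleDr _ (pnorm_ge0 _ _ _) hW) leeD2l// -fW -!EFinM lee_fin.
have W1 : 0 < fine W + 1 by rewrite ltr_wpDl.
rewrite [leLHS](_ : _ = e * (fine W / (fine W + 1))).
  by rewrite ler_piMr ?(ltW e0)// ler_pdivrMr// mul1r lerDl.
by field; rewrite !gt_eqF.
Qed.

End CompactSupport.

(** * Hoelder's inequality and tails *)

Section LpMore.
Context d (T : measurableType d) (R : realType) (mu : {measure set T -> \bar R}).
Implicit Types (f g : T -> R) (p q : R).

Lemma ecvg0P (a : nat -> \bar R) : (forall n, (0 <= a n)%E) ->
  a n @[n --> \oo] --> 0%E <-> forall e : R, 0 < e -> \forall n \near \oo, (a n <= e%:E)%E.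
Proof.
move=> a0; split.
  move=> /fine_cvgP [fa ca] e e0.
  move/cvgrPdist_le : ca => /(_ _ e0); apply: filterS2 fa => n fn.
  by rewrite sub0r normrN ger0_norm ?fine_ge0// -lee_fin fineK.
move=> H; apply/fine_cvgP; split.
  apply: filterS (H 1 ltr01) => n h; rewrite ge0_fin_numE//.
  by apply: le_lt_trans h _; exact: ltry.
apply/cvgrPdist_le => e e0; apply: filterS (H e e0) => n h.
rewrite sub0r normrN ger0_norm ?fine_ge0// -lee_fin fineK// ge0_fin_numE//.
by apply: le_lt_trans h _; exact: ltry.
Qed.

Lemma ge0_le_eint (f g : T -> \bar R) : (forall x, 0 <= f x)%E ->
  measurable_fun setT f -> measurable_fun setT g -> (forall x, f x <= g x)%E ->
  (\int[mu]_x f x <= \int[mu]_x g x)%E.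
Proof. by move=> f0 hf hg fg; apply: ge0_le_integral. Qed.

Lemma hoelder_int p q f g : 0 < p -> 0 < q -> p^-1 + q^-1 = 1 ->
  meas f -> meas g -> (pnorm mu p f < +oo)%E -> (pnorm mu q g < +oo)%E ->
  integ mu (f \* g)%R /\ `|\int[mu]_x (f x * g x)| <= fine (pnorm mu p f) * fine (pnorm mu q g).
Proof.
move=> p0 q0 pq hf hg ff fg.
have ffin : pnorm mu p f \is a fin_num by rewrite ge0_fin_numE ?pnorm_ge0.
have gfin : pnorm mu q g \is a fin_num by rewrite ge0_fin_numE ?pnorm_ge0.
have := @hoelder _ _ _ mu f g p q hf hg p0 q0 pq; rewrite Lnorm1 => h.
have h1 : (\int[mu]_x (`|(f \* g)%R x|)%:E <= (fine (pnorm mu p f) * fine (pnorm mu q g))%:E)%E.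
  by rewrite EFinM !fineK.
have I : integ mu (f \* g)%R.
  by apply/integP; split; [exact: measM|apply: le_lt_trans h1 _; rewrite ltry].
split => //; apply: le_trans (le_normr_Rintegral measurableT I) _.
rewrite /Rintegral -lee_fin fineK// ge0_fin_numE; last by apply: integral_ge0 => x _; rewrite lee_fin.
by apply: le_lt_trans h1 _; rewrite ltry.
Qed.

Lemma pnorm_lty p f : 0 < p -> meas f ->
  (pnorm mu p f < +oo)%E <-> integ mu (fun x => `|f x| `^ p).
Proof.
move=> p0 hf; rewrite pnormE; split => h.
  apply/integP; split; first exact: meas_powR.
  under eq_integral do rewrite /= ger0_norm ?powR_ge0//.
  by apply: lty_poweRy h; rewrite invr_neq0// gt_eqF.
apply: poweR_lty; move/integP : h => [_].
by under eq_integral do rewrite /= ger0_norm ?powR_ge0//.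
Qed.

Lemma pnorm_le_of_integral p f (c : R) : 0 < p -> 0 <= c ->
  (\int[mu]_x (`|f x| `^ p)%:E <= (c `^ p)%:E)%E -> (pnorm mu p f <= c%:E)%E.
Proof.
move=> p0 c0 h; rewrite pnormE.
have -> : c%:E = ((c `^ p)%:E `^ p^-1)%E by rewrite poweR_EFin -powRrM mulfV ?gt_eqF// powRr1.
apply: gt0_ler_poweR => //; rewrite ?invr_ge0 ?(ltW p0)//.
  by rewrite in_itv/= leey andbT; apply: integral_ge0 => x _; rewrite lee_fin powR_ge0.
by rewrite in_itv/= leey andbT lee_fin powR_ge0.
Qed.

Lemma EFin_Rint (F : T -> R) : integ mu F -> (forall x, 0 <= F x) ->
  (\int[mu]_x (F x)%:E)%E = (\int[mu]_x F x)%:E.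
Proof.
move=> /integP[_ h] F0; rewrite /Rintegral fineK// ge0_fin_numE.
  by move: h; under eq_integral do rewrite ger0_norm//.
by apply: integral_ge0 => x _; rewrite lee_fin.
Qed.

(** The unbounded part of f: the difference f - tail M f is bounded by M. *)
Definition tail (M : R) f x := if M < `|f x| then f x else 0.

Lemma tailE (M : R) f : tail M f = (fun x => f x * \1_[set x | M < `|f x|] x).
Proof.
apply/funext => x; rewrite /tail indicE; case: ifPn => h.
  by rewrite mem_set ?mulr1.
by rewrite memNset ?mulr0//; apply/negP.
Qed.

Lemma meas_tail M f : meas f -> meas (tail M f).
Proof.
move=> hf; rewrite tailE; apply: measM => //; apply: measurable_indic.
rewrite -[X in measurable X]setTI.
have := measurable_fun_ltr (measurable_cst M) (meas_norm hf).
by move=> /(_ measurableT [set true]); apply.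
Qed.

(** A function of L^p is bounded up to an arbitrarily small error: dominated
    convergence for the p-th powers of its tails. *)
Lemma pnorm_tail p f e : 0 < p -> meas f -> (pnorm mu p f < +oo)%E -> 0 < e ->
  \forall n \near \oo, (pnorm mu p (tail n%:R f) <= e%:E)%E.
Proof.
move=> p0 hf /(pnorm_lty p0 hf) If e0.
have D0 : (\int[mu]_x (`|tail n%:R f x| `^ p)%:E @[n --> \oo] --> \int[mu]_x 0%:E)%E.
  apply: (@dominated_cvg _ _ _ mu setT measurableT _ _ (fun x => (`|f x| `^ p)%:E)) => //.
  - by move=> n; apply/emeas_powR/meas_tail.
  - move=> x _; apply: cvg_near_cst.
    near=> n; rewrite /tail ifF ?normr0 ?powR0 ?gt_eqF//.
    apply/negbTE; rewrite -leNgt; near: n; exact: nbhs_infty_ger.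
  - move=> n x _; rewrite lee_fin ger0_norm ?powR_ge0// ge0_ler_powR ?nnegrE ?(ltW p0)//.
    by rewrite /tail; case: ifP => // _; rewrite normr0.
rewrite integral0 in D0.
have ep0 : 0 < e `^ p by exact: powR_gt0.
move/ecvg0P : D0 => /(_ _)/(_ _ ep0) H.
apply: filterS (H _) => [n|n]; first by apply: pnorm_le_of_integral => //; exact: ltW.
by apply: integral_ge0 => x _; rewrite lee_fin powR_ge0.
Unshelve. all: by end_near. Qed.

End LpMore.

(** * W_0^(1,p) in the whole space *)

Section ExtensionByZero.
Context (R : realType) (N : nat) (Omega : set 'rV[R]_N) (oO : open Omega).
Implicit Types (f phi u : 'rV[R]_N -> R) (g : 'I_N -> 'rV[R]_N -> R) (p : R).
Local Notation mu := (leb R N).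
Local Notation meas := (@meas _ (lebT R N) R).
Local Notation tl := (@tail _ (lebT R N) R).

Lemma restrict_in f x : Omega x -> (f \_ Omega) x = f x.
Proof. by move=> Ox; rewrite patchE mem_set. Qed.

Lemma restrict_out f x : ~ Omega x -> (f \_ Omega) x = 0.
Proof. by move=> Ox; rewrite patchE memNset. Qed.

Lemma restrictP (h : 'rV[R]_N -> R) f : (forall x, Omega x -> f x = h x) ->
  (forall x, ~ Omega x -> h x = 0) -> f \_ Omega = h.
Proof.
move=> h1 h2; apply/funext => x; have [Ox|Ox] := pselect (Omega x).
  by rewrite restrict_in// h1.
by rewrite restrict_out// h2.
Qed.

Lemma test_functionP phi : test_function Omega phi ->
  exists K, [/\ Ck 1 phi, compact K, supp_in K phi & K `<=` Omega].
Proof.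
move=> [sphi cK KO]; exists (closure [set x | phi x != 0]); split => //.
move=> x nKx; apply/eqP/negPn/negP => px; apply: nKx; exact: subset_closure.
Qed.

Lemma test_softplus m k phi : 0 < m -> test_function Omega phi ->
  test_function Omega (softplus m k \o phi).
Proof.
move=> m0 [sphi cK KO].
have sub : closure [set x | (softplus m k \o phi) x != 0] `<=` closure [set x | phi x != 0].
  apply: closureS => x /=; apply: contra => /eqP ->.
  by rewrite softplus_at0.
split; first exact: smooth_softplus.
- by apply: subclosed_compact cK sub; exact: closed_closure.
- exact: subset_trans sub KO.
Qed.

Lemma test_meas phi : test_function Omega phi -> meas phi.
Proof. by move=> [/(_ 0%N) sphi _ _]; exact: meas_cont. Qed.

Lemma test_partial_meas i phi : test_function Omega phi -> meas (partial i phi).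
Proof. by move=> [/(_ 1%N)[_ /(_ i)[_ h]] _ _]; exact: meas_cont. Qed.

Lemma test_out phi x : test_function Omega phi -> ~ Omega x -> phi x = 0.
Proof.
by move=> /test_functionP[K [_ _ s KO]] nO; apply: s => /KO.
Qed.

Lemma test_partial_out i phi x : test_function Omega phi -> ~ Omega x -> partial i phi x = 0.
Proof.
move=> /test_functionP[K [_ cK s KO]] nO.
have clK : closed K by apply: compact_closed.
by apply: (partial_supp_in i clK s) => /KO.
Qed.

Lemma measurable_Omega : measurable (Omega : set (lebT R N)).
Proof. exact: open_measurable_leb. Qed.

(** The closure of the test functions for the W^(1,p) norm, in the whole space.
    That g is the weak gradient of u is a consequence ([W0ext_weak]). *)
Definition W0ext p u g := [/\ meas u, forall i, meas (g i), (pnorm mu p u < +oo)%E,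
  forall i, (pnorm mu p (g i) < +oo)%E &
  forall e : R, 0 < e -> exists phi, [/\ test_function Omega phi,
    (pnorm mu p (u \- phi)%R <= e%:E)%E &
    forall i, (pnorm mu p (g i \- partial i phi)%R <= e%:E)%E]].

Lemma LpOnP p u : LpOn Omega p%:E u <-> meas (u \_ Omega) /\ (pnorm mu p (u \_ Omega) < +oo)%E.
Proof.
rewrite /LpOn inE; split.
  by move=> /andP[]; rewrite !inE /= => h1 h2.
by move=> [h1 h2]; apply/andP; rewrite !inE.
Qed.

Lemma sobolev0_W0ext p u Gu : sobolev0 Omega p u Gu ->
  W0ext p (u \_ Omega) (fun i => (fun x => Gu x 0 i) \_ Omega).
Proof.
move=> [[/LpOnP[h1 h2] h3 _] [phi [tphi c1 c2]]].
split => //; [by move=> i; have /LpOnP[] := h3 i|by move=> i; have /LpOnP[] := h3 i|].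
move=> e e0.
have H1 : \forall n \near \oo, (normLp Omega p%:E (fun x => (u x - phi n x)%R) <= e%:E)%E.
  by move/ecvg0P : c1 => /(_ (fun n => pnorm_ge0 mu p _)); exact.
have H2 : \forall n \near \oo, forall i,
    (normLp Omega p%:E (fun x => (Gu x 0%R i - partial i (phi n) x)%R) <= e%:E)%E.
  apply: filter_forall => i.
  by move/ecvg0P : (c2 i) => /(_ (fun n => pnorm_ge0 mu p _)); exact.
have [n [n1 n2]] := filter_ex (filterI H1 H2).
exists (phi n); split => // [|i].
  rewrite (_ : (_ \- _)%R = (fun x => (u x - phi n x)%R) \_ Omega); first exact: n1.
  apply: esym; apply: restrictP => x Ox /=; first by rewrite restrict_in.
  by rewrite restrict_out// (test_out (tphi n))// subrr.
rewrite (_ : (_ \- _)%R = (fun x => (Gu x 0%R i - partial i (phi n) x)%R) \_ Omega); first exact: n2.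
apply: esym; apply: restrictP => x Ox /=; first by rewrite restrict_in.
by rewrite restrict_out// (test_partial_out i (tphi n))// subrr.
Qed.

Lemma pnorm_cont_supp q f K : 1 <= q -> continuous f -> compact K -> supp_in K f ->
  (pnorm mu q f < +oo)%E.
Proof.
move=> q1 cf cK f0; have [n [M M0 HM]] := cont_supp_bound cf cK f0.
have q0 : 0 < q by exact: lt_le_trans q1.
have mB : meas (\1_(big_box n)) by apply: measurable_indic; exact: measurable_box.
have HM' x : `|f x| <= `|M * \1_(big_box n) x|.
  by rewrite [leRHS]ger0_norm ?mulr_ge0.
apply: le_lt_trans (pnorm_le mu (ltW q0) (meas_cont cf) (measZ M mB) HM') _.
rewrite (pnormZ mu M q1 mB) (ger0_norm M0) lte_mul_pinfty ?lee_fin//.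
exact: pnorm_indic_lty.
Qed.

(** If u is a test function phi, the identity says that the partial derivative
    of phi * psi has integral zero. Both sides are continuous in u and g for
    the L^p norm, by Hoelder's inequality against psi and its derivative. *)
Lemma W0ext_weak p u g i psi : 1 < p -> W0ext p u g -> test_function Omega psi ->
  \int[mu]_x (u x * partial i psi x) = - \int[mu]_x (g i x * psi x).
Proof.
move=> p1 [hu hg fu fg H] tpsi.
have p0 : 0 < p by exact: lt_trans p1.
pose q := (1 - p^-1)^-1.
have ip1 : p^-1 < 1 by rewrite invf_lt1.
have q0 : 0 < q by rewrite invr_gt0 subr_gt0.
have q1 : 1 <= q by rewrite invf_ge1 ?subr_gt0// gerBl invr_ge0 ltW.
have pq : p^-1 + q^-1 = 1 by rewrite invrK addrC subrK.
have [K [Cpsi cK sK KO]] := test_functionP tpsi.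
have clK : closed K by apply: compact_closed.
have [cpsi /(_ i) [dpsi cdpsi]] := Cpsi.
have f1 := pnorm_cont_supp q1 cpsi cK sK.
have f2 := pnorm_cont_supp q1 cdpsi cK (partial_supp_in i clK sK).
have m1 := meas_cont cpsi; have m2 := meas_cont cdpsi.
have [I1 _] := hoelder_int p0 q0 pq hu m2 fu f2.
have [I2 _] := hoelder_int p0 q0 pq (hg i) m1 (fg i) f1.
apply/eqP; rewrite -subr_eq0 opprK -normr_le0; apply/ler_addgt0Pr => e e0; rewrite add0r.
set A := fine (pnorm mu q (partial i psi)); set B := fine (pnorm mu q psi).
have A0 : 0 <= A by rewrite fine_ge0// pnorm_ge0.
have B0 : 0 <= B by rewrite fine_ge0// pnorm_ge0.
(* Replacing u and g i by a test function and its derivative within d in norm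
   changes the two integrals by at most d A and d B. *)
have d0 : 0 < e / (A + B + 1) by rewrite divr_gt0// ltr_wpDl// addr_ge0.
have [phi [tphi n1 /(_ i) n2]] := H _ d0.
move: d0 n1 n2; set d := e / _ => d0 n1 n2.
have [L [Cphi cL sL LO]] := test_functionP tphi.
have [cphi /(_ i) [dphi cdphi]] := Cphi.
have mphi := test_meas tphi; have mdphi := test_partial_meas i tphi.
have fin1 : (pnorm mu p (u \- phi)%R < +oo)%E by apply: le_lt_trans n1 _; rewrite ltry.
have fin2 : (pnorm mu p (g i \- partial i phi)%R < +oo)%E by apply: le_lt_trans n2 _; rewrite ltry.
have [J1 b1] := hoelder_int p0 q0 pq (measB hu mphi) m2 fin1 f2.
have [J2 b2] := hoelder_int p0 q0 pq (measB (hg i) mdphi) m1 fin2 f1.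
have clL : closed L by apply: compact_closed.
have Cpp : Ck 1 (phi * psi) := CkM Cphi Cpsi.
have spp : supp_in K (phi * psi).
  by move=> x nK; rewrite [LHS](_ : _ = phi x * psi x)// sK// mulr0.
have P0 := integral_partial0 i Cpp cK spp.
have PE : partial i (phi * psi) = (fun x => phi x * partial i psi x + partial i phi x * psi x).
  apply/funext => x; rewrite /partial deriveM//.
  by congr (_ + _); rewrite mulrC.
have K1 : integ mu (fun x => phi x * partial i psi x).
  have [] := hoelder_int p0 q0 pq mphi m2 (pnorm_cont_supp (ltW p1) cphi cL sL) f2; done.
have K2 : integ mu (fun x => partial i phi x * psi x).
  have [] := hoelder_int p0 q0 pq mdphi m1
    (pnorm_cont_supp (ltW p1) cdphi cL (partial_supp_in i clL sL)) f1; done.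
rewrite PE (RintegralD measurableT K1 K2) in P0.
rewrite (_ : _ + _ = \int[mu]_x ((u \- phi) x * partial i psi x) +
                     \int[mu]_x ((g i \- partial i phi) x * psi x)); last first.
  have -> : \int[mu]_x ((u \- phi) x * partial i psi x) =
      \int[mu]_x (u x * partial i psi x) - \int[mu]_x (phi x * partial i psi x).
    by rewrite -(RintegralB measurableT I1 K1); apply: eq_Rintegral => x _; rewrite /= mulrBl.
  have -> : \int[mu]_x ((g i \- partial i phi) x * psi x) =
      \int[mu]_x (g i x * psi x) - \int[mu]_x (partial i phi x * psi x).
    by rewrite -(RintegralB measurableT I2 K2); apply: eq_Rintegral => x _; rewrite /= mulrBl.
  by rewrite addrACA -opprD P0 subr0.
apply: le_trans (ler_normD _ _) _.
have c1 : fine (pnorm mu p (u \- phi)%R) <= d by rewrite -lee_fin fineK// ge0_fin_numE ?pnorm_ge0.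
have c2 : fine (pnorm mu p (g i \- partial i phi)%R) <= d
  by rewrite -lee_fin fineK// ge0_fin_numE ?pnorm_ge0.
apply: (@le_trans _ _ (d * A + d * B)).
  by apply: lerD; [apply: le_trans b1 _|apply: le_trans b2 _]; apply: ler_wpM2r.
rewrite -mulrDr /d -mulrA ler_piMr ?(ltW e0)// mulrC ler_pdivrMr ?mul1r ?lerDl//.
by rewrite ltr_wpDl// addr_ge0.
Qed.

Lemma W0ext_sobolev0 p u (Gu : 'rV[R]_N -> 'rV[R]_N) : 1 < p ->
  W0ext p (u \_ Omega) (fun i => (fun x => Gu x 0 i) \_ Omega) -> sobolev0 Omega p u Gu.
Proof.
move=> p1 W; have [hu hg fu fg H] := W.
split.
  split; [exact/LpOnP|by move=> i; exact/LpOnP|].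
  move=> i psi tpsi; rewrite Rintegral_mkcond [in RHS]Rintegral_mkcond.
  rewrite [X in Rintegral _ _ X](_ : _ = (fun x => (u \_ Omega) x * partial i psi x)); last first.
    apply: restrictP => x Ox; first by rewrite restrict_in.
    by rewrite restrict_out ?mul0r.
  rewrite [X in - Rintegral _ _ X](_ : _ = (fun x => ((fun x => Gu x 0 i) \_ Omega) x * psi x)); last first.
    apply: restrictP => x Ox; first by rewrite restrict_in.
    by rewrite restrict_out ?mul0r.
  exact: (W0ext_weak i p1 W).
have /choice[phi Hphi] : forall n : nat, exists phi, [/\ test_function Omega phi,
    (pnorm mu p (u \_ Omega \- phi)%R <= n.+1%:R^-1%:E)%E &
    forall i, (pnorm mu p (((fun x => Gu x 0 i) \_ Omega) \- partial i phi)%R <= n.+1%:R^-1%:E)%E].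
  by move=> n; apply: H; rewrite invr_gt0.
have inv0 (e : R) : 0 < e -> \forall n \near \oo, n.+1%:R^-1 <= e.
  move=> e0; apply: filterS (near_infty_natSinv_lt (PosNum e0)) => n; exact: ltW.
have nE n : pnorm mu p (u \_ Omega \- phi n)%R = normLp Omega p%:E (fun x => u x - phi n x).
  have [tphi _ _] := Hphi n.
  rewrite (_ : (_ \- _)%R = (fun x => (u x - phi n x)%R) \_ Omega) //.
  apply: esym; apply: restrictP => x Ox /=; first by rewrite restrict_in.
  by rewrite restrict_out// (test_out tphi)// subrr.
have nE2 i n : pnorm mu p (((fun x => Gu x 0 i) \_ Omega) \- partial i (phi n))%R =
    normLp Omega p%:E (fun x => Gu x 0 i - partial i (phi n) x).
  have [tphi _ _] := Hphi n.
  rewrite (_ : (_ \- _)%R = (fun x => (Gu x 0%R i - partial i (phi n) x)%R) \_ Omega) //.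
  apply: esym; apply: restrictP => x Ox /=; first by rewrite restrict_in.
  by rewrite restrict_out// (test_partial_out i tphi)// subrr.
exists phi; split => [n||i]; first by case: (Hphi n).
  apply/ecvg0P => [n|e e0]; first exact: pnorm_ge0.
  apply: filterS (inv0 e e0) => n ne; rewrite -nE.
  by have [_ h _] := Hphi n; apply: le_trans h _; rewrite lee_fin.
apply/ecvg0P => [n|e e0]; first exact: pnorm_ge0.
apply: filterS (inv0 e e0) => n ne; rewrite -nE2.
by have [_ _ /(_ i) h] := Hphi n; apply: le_trans h _; rewrite lee_fin.
Qed.

(** Shifting along one axis after the other, this is [pnorm_incr_partial] for
    test functions, and it passes to the limit by [pnorm_incrB]. *)
Lemma W0ext_incr p u g (y : 'rV[R]_N) : 1 < p -> W0ext p u g -> (forall i, 0 < y 0 i) ->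
  (pnorm mu p (incr y u) <= \sum_i ((y 0%R i)%:E * pnorm mu p (g i)))%E.
Proof.
move=> p1 [hu hg fu fg H] y0.
have p1' := ltW p1.
pose S := \sum_i y 0 i.
have S0 : 0 <= S by apply: sumr_ge0 => i _; exact: ltW.
apply/lee_addgt0Pr => e e0.
have d0 : 0 < e / (S + 2) by rewrite divr_gt0// ltr_wpDl.
have [phi [tphi n1 n2]] := H _ d0; move: d0 n1 n2; set d := e / _ => d0 n1 n2.
have mphi := test_meas tphi.
apply: le_trans (pnorm_incrB y p1' hu mphi) _.
have h1 : (pnorm mu p (incr y phi) <= \sum_i ((y 0%R i)%:E * (pnorm mu p (g i) + d%:E)))%E.
  apply: le_trans (pnorm_incr_sum y p1' mphi) _; apply: lee_sum => i _.
  have [K [Cphi cK sK KO]] := test_functionP tphi.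
  apply: le_trans (pnorm_incr_partial i p1' Cphi cK sK (y0 i)) _.
  rewrite lee_pmul2l ?lte_fin//.
  have md := test_partial_meas i tphi.
  rewrite (_ : partial i phi = (g i \- (g i \- partial i phi))%R).
    by apply: le_trans (pnormB mu p1' (hg i) (measB (hg i) md)) _; rewrite leeD2l.
  by apply/funext => x /=; rewrite opprB addrC subrK.
apply: le_trans (leeD h1 (leeD n1 n1)) _.
under eq_bigr => i _ do rewrite ge0_muleDr ?pnorm_ge0 ?lee_fin ?(ltW d0)//.
rewrite big_split /= -addeA leeD2l//.
under eq_bigr do rewrite -EFinM.
rewrite sumEFin -mulr_suml -/S -!EFinD lee_fin.
have -> : S * d + (d + d) = e by rewrite /d; field; rewrite gt_eqF// ltr_wpDl.
by [].
Qed.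

(** The chain rule. If phi is close to u in W^(1,p), then softplus o phi is
    close to softplus o u. The difference of the gradients contains the term
    (sigmoid u - sigmoid phi) g, a product of a function that is small in L^p
    with one that is merely in L^p; it is small because g is bounded up to a
    [tail] of small norm, while [sigmoid] is bounded and Lipschitz. *)
Lemma W0ext_softplus p u g m k : 1 < p -> 0 < m -> W0ext p u g ->
  W0ext p (softplus m k \o u) (fun i x => sigmoid m k (u x) * g i x).
Proof.
move=> p1 m0 [hu hg fu fg H].
have p0 : 0 < p by exact: lt_trans p1.
have p1' := ltW p1.
have msp : measurable_fun setT (softplus m k).
  apply: continuous_measurable_fun => s.
  by apply: differentiable_continuous; apply/derivable1_diffP; case: (is_derive_softplus k m0 s).
have msg : measurable_fun setT (sigmoid m k).
  apply: continuous_measurable_fun => s.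
  by apply: differentiable_continuous; apply/derivable1_diffP; case: (is_derive_sigmoid m k s).
have m1 : meas (softplus m k \o u) := measurableT_comp msp hu.
have m2 : meas (sigmoid m k \o u) := measurableT_comp msg hu.
have m3 i : meas (fun x => sigmoid m k (u x) * g i x) := measM m2 (hg i).
have sle i x : `|sigmoid m k (u x) * g i x| <= `|g i x|.
  have /andP[s0 s1] := sigmoid_itv m k (u x).
  by rewrite normrM (ger0_norm s0) ler_piMl.
split => //.
- by apply: le_lt_trans (pnorm_le mu (ltW p0) m1 hu _) fu => x; exact: softplus_norm.
- by move=> i; apply: le_lt_trans (pnorm_le mu (ltW p0) (m3 i) (hg i) (sle i)) (fg i).
move=> e e0.
have e30 : 0 < e / 3 by rewrite divr_gt0.
have HT : \forall n \near \oo, forall i, (pnorm mu p (tl n%:R (g i)) <= (e / 3)%:E)%E.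
  by apply: filter_forall => i; exact: pnorm_tail.
have [M HM] := filter_ex HT.
have c0 : 0 < 3 * (m * M%:R + 1) by rewrite mulr_gt0// ltr_wpDl// mulr_ge0// ltW.
have d0 : 0 < e / (3 * (m * M%:R + 1)) by rewrite divr_gt0.
have [phi [tphi n1 n2]] := H _ d0; move: d0 n1 n2; set d := e / _ => d0 n1 n2.
have mphi := test_meas tphi.
exists (softplus m k \o phi); split.
- exact: test_softplus.
- have mp : meas (softplus m k \o phi) := measurableT_comp msp mphi.
  apply: le_trans (pnorm_le mu (ltW p0) (measB m1 mp) (measB hu mphi) _) _.
    by move=> x; exact: softplus_lip.
  apply: le_trans n1 _; rewrite lee_fin /d ler_pdivrMr// ler_peMr ?(ltW e0)//.
  have : 0 <= m * M%:R by rewrite mulr_ge0// ltW.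
  lra.
move=> i.
have [K [Cphi cK sK KO]] := test_functionP tphi.
have [_ /(_ i) [dphi cdphi]] := Cphi.
rewrite partial_softplus//.
have md := test_partial_meas i tphi.
have mh := measB (hg i) md; have mb := measB hu mphi.
have mt : meas (tl M%:R (g i)) by apply: meas_tail.
(* The difference of the gradients is h1 + h2 + h3: h1 and h2 are small with
   d, and h3 by the choice of M. *)
pose h1 x := sigmoid m k (phi x) * (g i x - partial i phi x).
have msphi : meas (sigmoid m k \o phi) := measurableT_comp msg mphi.
have mh1 : meas h1 := measM msphi mh.
pose h2 x := (sigmoid m k (u x) - sigmoid m k (phi x)) * (g i x - tl M%:R (g i) x).
have mh2 : meas h2 := measM (measB m2 msphi) (measB (hg i) mt).
pose h3 x := (sigmoid m k (u x) - sigmoid m k (phi x)) * tl M%:R (g i) x.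
have mh3 : meas h3 := measM (measB m2 msphi) mt.
rewrite (_ : (_ \- _)%R = (h1 \+ (h2 \+ h3))%R); last first.
  apply/funext => x; rewrite [LHS](_ : _ = sigmoid m k (u x) * g i x -
    sigmoid m k (phi x) * partial i phi x) //.
  by rewrite /h1 /h2 /h3 /=; ring.
apply: le_trans (pnormD mu p1' mh1 (measD mh2 mh3)) _.
have b1 : (pnorm mu p h1 <= d%:E)%E.
  apply: le_trans (pnorm_le mu (ltW p0) mh1 mh _) (n2 i) => x.
  have /andP[s0 s1] := sigmoid_itv m k (phi x).
  by rewrite /h1 normrM (ger0_norm s0) ler_piMl.
have b2 : (pnorm mu p h2 <= (m * M%:R * d)%:E)%E.
  apply: le_trans (pnorm_le mu (g := fun x => m * M%:R * (u \- phi) x) (ltW p0) mh2 (measZ _ mb) _) _.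
    move=> x; rewrite /h2 !normrM (ger0_norm (ltW m0)) normr_nat mulrAC.
    apply: ler_pM => //; first exact: sigmoid_lip.
    rewrite /tail; case: ltP => hM; first by rewrite subrr normr0.
    by rewrite subr0.
  rewrite (pnormZ mu _ p1' mb) ger0_norm ?mulr_ge0 ?(ltW m0)// [leRHS]EFinM.
  by rewrite lee_wpmul2l ?lee_fin ?mulr_ge0 ?(ltW m0).
have b3 : (pnorm mu p h3 <= (e / 3)%:E)%E.
  apply: le_trans (pnorm_le mu (ltW p0) mh3 mt _) (HM i) => x.
  rewrite /h3 normrM ler_piMl// ler_norml.
  have /andP[s0 s1] := sigmoid_itv m k (phi x); have /andP[t0 t1] := sigmoid_itv m k (u x).
  by apply/andP; split; lra.
apply: le_trans (leeD b1 (pnormD mu p1' mh2 mh3)) _.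
apply: le_trans (leeD (lexx _) (leeD b2 b3)) _.
rewrite -!EFinD lee_fin.
have hd : d * (3 * (m * M%:R + 1)) = e by rewrite /d divfK// gt_eqF.
rewrite [X in _ <= X](_ : _ = 3 * (d + m * M%:R * d)); last by rewrite -[LHS]hd; ring.
have : e / 3 = d + m * M%:R * d by rewrite -[X in X / 3]hd; field.
lra.
Qed.

End ExtensionByZero.

(** * A Faber-Krahn inequality from increments *)

Section Averaging.
Context d (T : measurableType d) (R : realType).
Variable mu : {sigma_finite_measure set T -> \bar R}.

(** Integrate the last hypothesis over y in Q and exchange the integrals: the
    point x is counted for those y only that satisfy E (x, y), a set of
    measure at most b. *)
Lemma averaging (E : set (T * T)) (Q : set T) (W : T -> R) (M b : R) :
  measurable E -> measurable Q -> (mu Q < +oo)%E ->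
  (forall x, 0 <= W x) -> integ mu W -> 0 <= M ->
  (forall x, (mu [set y | E (x, y)] <= b%:E)%E) ->
  (forall y, Q y -> (\int[mu]_x (W x)%:E <= M%:E + \int[mu]_x (W x * \1_E (x, y))%:E)%E) ->
  (mu Q * \int[mu]_x (W x)%:E <= mu Q * M%:E + b%:E * \int[mu]_x (W x)%:E)%E.
Proof.
move=> mE mQ Qfin W0 IW M0 Eb HQ.
have mW := integ_meas IW.
have emW : measurable_fun setT (fun x => (W x)%:E) by exact/measurable_EFinP.
set I := (\int[mu]_x (W x)%:E)%E.
have I0 : (0 <= I)%E by apply: integral_ge0 => x _; rewrite lee_fin.
have Ifin : I \is a fin_num.
  rewrite ge0_fin_numE//; move/integP : IW => [_].
  by under eq_integral do rewrite ger0_norm//.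
have m1E : measurable_fun setT (\1_E : T * T -> R) by apply: measurable_indic.
have m1Q : measurable_fun setT (\1_Q : T -> R) by apply: measurable_indic.
pose f (z : T * T) : \bar R := ((W z.1 * \1_E z) * \1_Q z.2)%:E.
have f0 z : (0 <= f z)%E by rewrite lee_fin !mulr_ge0.
have mesf : measurable_fun setT f.
  apply/measurable_EFinP; apply: measurable_funM; last exact: (measurableT_comp m1Q measurable_snd).
  apply: measurable_funM => //.
  exact: (measurableT_comp mW measurable_fst).
have mfx x : measurable_fun setT (fun y => f (x, y)).
  by apply: (measurableT_comp mesf); exact: measurable_pair1.
have mfy y : measurable_fun setT (fun x => f (x, y)).
  by apply: (measurableT_comp mesf); exact: measurable_pair2.
have FT := @fubini_tonelli _ _ T T R mu mu f mesf f0.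
have mG := @measurable_fun_fubini_tonelli_G _ _ T T R mu f mesf f0.
have mF := @measurable_fun_fubini_tonelli_F _ _ T T R mu f mesf f0.
have mS x : measurable [set y | E (x, y)].
  rewrite (_ : [set y | _] = xsection E x); first exact: measurable_xsection.
  by apply/seteqP; split => y; rewrite /xsection /= inE.
have hFx x : (\int[mu]_y f (x, y) <= b%:E * (W x)%:E)%E.
  have m1S : measurable_fun setT (\1_[set y | E (x, y)] : T -> R) by apply: measurable_indic.
  apply: (@le_trans _ _ (\int[mu]_y ((W x)%:E * (\1_[set y | E (x, y)] y)%:E))%E).
    apply: ge0_le_eint (mfx x) _ _ => [y|| y]; first exact: f0.
      by apply/measurable_EFinP; exact: measZ.
    rewrite -EFinM lee_fin (_ : \1_[set y | E (x, y)] y = \1_E (x, y)).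
      by rewrite ler_piMr ?mulr_ge0// indicE; case: (_ \in _).
    by rewrite !indicE; congr (_%:R); congr nat_of_bool; apply/idP/idP; rewrite !inE.
  have em1S : measurable_fun setT (fun y => (\1_[set y | E (x, y)] y : R)%:E) by exact/measurable_EFinP.
  have pS y : setT y -> (0 <= (\1_[set y | E (x, y)] y : R)%:E)%E by move=> _; rewrite lee_fin.
  rewrite (ge0_integralZl_EFin mu measurableT pS em1S (W0 x)).
  rewrite (integral_indic mu measurableT (mS x)) setIT muleC.
  by apply: lee_wpmul2r; [rewrite lee_fin|exact: Eb].
have hF : (\int[mu]_x \int[mu]_y f (x, y) <= b%:E * I)%E.
  apply: (@le_trans _ _ (\int[mu]_x (b%:E * (W x)%:E))%E).
    apply: (ge0_le_eint mu _ mF _ hFx) => [x|]; last exact: measurable_funeM.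
    by apply: integral_ge0 => y _; exact: f0.
  by rewrite (integralZl measurableT IW).
have QI y : ((\1_Q y)%:E * I <= M%:E * (\1_Q y)%:E + \int[mu]_x f (x, y))%E.
  rewrite indicE; have [Qy|Qy] := boolP (y \in Q); last first.
    by rewrite mul0e mule0 add0e integral_ge0.
  rewrite mul1e mule1; rewrite inE in Qy.
  apply: le_trans (HQ y Qy) _; apply: leeD2l.
  apply: (ge0_le_eint mu _ _ (mfy y)) => [x||x]; first by rewrite lee_fin mulr_ge0.
    apply/measurable_EFinP; apply: (measM mW).
    by apply: (measurableT_comp m1E); exact: measurable_pair2.
  have Q1 : \1_Q y = 1 :> R by rewrite indicE mem_set.
  by rewrite lee_fin /= Q1 mulr1.
have em1Q : measurable_fun setT (fun y => (\1_Q y : R)%:E) by exact/measurable_EFinP.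
have iQ : (\int[mu]_y (\1_Q y)%:E = mu Q)%E.
  by rewrite (integral_indic mu measurableT mQ) setIT.
have pQ y : setT y -> (0 <= (\1_Q y : R)%:E)%E by move=> _; rewrite lee_fin.
have pG y : setT y -> (0 <= \int[mu]_x f (x, y))%E by move=> _; apply: integral_ge0.
have pMQ y : setT y -> (0 <= M%:E * (\1_Q y : R)%:E)%E by move=> _; rewrite -EFinM lee_fin mulr_ge0.
have mMQ : measurable_fun setT (fun y => M%:E * (\1_Q y : R)%:E)%E by exact: measurable_funeM.
have mIQ : measurable_fun setT (fun y => I * (\1_Q y : R)%:E)%E by exact: measurable_funeM.
have pIQ y : (0 <= I * (\1_Q y : R)%:E)%E by rewrite mule_ge0// lee_fin.
have QI' y : (I * (\1_Q y)%:E <= M%:E * (\1_Q y)%:E + \int[mu]_x f (x, y))%E.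
  by rewrite muleC; exact: QI.
have := ge0_le_eint mu pIQ mIQ (emeasurable_funD mMQ mG) QI'.
rewrite (ge0_integralD mu measurableT pMQ mMQ pG mG).
rewrite (ge0_integralZl_EFin mu measurableT pQ em1Q M0) iQ.
rewrite -[I](fineK Ifin) (ge0_integralZl_EFin mu measurableT pQ em1Q (fine_ge0 I0)) iQ (fineK Ifin).
rewrite [(I * _)%E]muleC [(M%:E * _)%E]muleC => /le_trans; apply.
by apply: leeD2l; rewrite -FT; exact: hF.
Qed.

End Averaging.

Section FaberKrahn.
Context (R : realType) (N : nat).
Implicit Types (w : 'rV[R]_N -> R) (y : 'rV[R]_N) (A B : set 'rV[R]_N).
Local Notation mu := (leb R N).
Local Notation T := (lebT R N).
Local Notation meas := (@meas _ (lebT R N) R).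

Definition box_union (F : nat -> 'rV[R]_N * 'rV[R]_N) (P : set nat) : set 'rV[R]_N :=
  \bigcup_(k in P) box (F k).

(** Unions of boxes are used as measurable majorants because, for them,
    x + y in B is a measurable condition on the pair (x, y)
    ([measurable_sum_box_union]). *)
Lemma box_union_approx A (c : \bar R) : (mu A < c)%E ->
  exists F P, A `<=` box_union F P /\ (mu (box_union F P) < c)%E.
Proof.
move=> /ereal_inf_lt [_ [[P F] /= cA <-] h]; exists F, P; split => //.
by apply: le_lt_trans h; apply: ereal_inf_lbound; exists (P, F).
Qed.

Lemma measurable_box_union F P : measurable (box_union F P : set T).
Proof. by apply: bigcup_measurable => k _; exact: measurable_box. Qed.

Lemma measurable_sum_box_union F P :
  measurable [set z : T * T | box_union F P (translate z.2 z.1)].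
Proof.
rewrite [X in measurable X](_ : _ = \bigcup_(k in P) \bigcap_(i in [set: 'I_N])
   [set z : T * T | (F k).1 0 i < z.1 0 i + z.2 0 i <= (F k).2 0 i]).
  apply: bigcup_measurable => k _; apply: fin_bigcap_measurable => // i _.
  have h : measurable_fun setT (fun z : T * T => z.1 0 i + z.2 0 i).
    apply: measurable_funD.
      exact: (measurableT_comp (@measurable_coord R N i) measurable_fst).
    exact: (measurableT_comp (@measurable_coord R N i) measurable_snd).
  rewrite -[X in measurable X]setTI.
  have := h measurableT _ (measurable_itv `](F k).1 0 i, (F k).2 0 i]).
  by congr measurable; apply/seteqP; split => z; rewrite /= in_itv.
apply/seteqP; split => z.
  move=> [k Pk Bk]; exists k => // i _ /=.
  by have := Bk i; rewrite /translate mxE.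
move=> [k Pk Bk]; exists k => // i.
by have := Bk i I; rewrite /translate mxE.
Qed.

(** Where x + y lies outside A, w (x) is the opposite of the increment of w, so
    int |w|^p <= M + int_(x + y in A) |w (x)|^p dx. The set of the y such that
    x + y lies in A is a translate of A and fills less than half of the cube:
    on average over y in the cube, the last term is at most half of the
    left-hand side and is absorbed by it. *)
Lemma faber_krahn p w A (r M : R) : 0 < p -> 0 < r -> 0 <= M ->
  meas w -> integ mu (fun x => `|w x| `^ p) ->
  (forall x, ~ A x -> w x = 0) ->
  (2%:E * mu A < mu (cube r))%E ->
  (forall y, cube r y -> (\int[mu]_x (`|incr y w x| `^ p)%:E <= M%:E)%E) ->
  (\int[mu]_x (`|w x| `^ p)%:E <= (2 * M)%:E)%E.
Proof.
move=> p0 r0 M0 hw Iw wA mA HM.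
have [F [P [AB mB2]]] : exists F P, A `<=` box_union F P /\ (mu (box_union F P) < 2^-1%:E * mu (cube r))%E.
  by apply: box_union_approx; rewrite lte_pdivlMl.
set B := box_union F P in AB mB2.
have mB : measurable (B : set T) := measurable_box_union F P.
have mQ : measurable (cube r : set T) := measurable_box _.
have mt x : measurable (translate x @^-1` B : set T) by exact: measurable_preimage_translate.
pose W x := `|w x| `^ p.
have W0 x : 0 <= W x by exact: powR_ge0.
have Qfin : (mu (cube r) < +oo)%E by apply: le_lt_trans (leb_box_le _) _; rewrite ltry.
have Bfin : (mu B < +oo)%E.
  apply: lt_le_trans mB2 _; rewrite leey//.
have fB : (fine (mu B))%:E = mu B by rewrite fineK// ge0_fin_numE.
have fQ : (fine (mu (cube r)))%:E = mu (cube r) by rewrite fineK// ge0_fin_numE.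
set E := [set z : T * T | B (translate z.2 z.1)].
have mE : measurable E := measurable_sum_box_union F P.
have Eb x : (mu [set y | E (x, y)] <= (fine (mu B))%:E)%E.
  have EB : mu (translate x @^-1` B) = mu B := leb_outer_translate x B.
  rewrite fB -EB (_ : [set y | E (x, y)] = translate x @^-1` B)//.
  by apply/seteqP; split => y; rewrite /E /= /translate addrC.
have mW : meas W := meas_powR p hw.
have HQ y : cube r y -> (\int[mu]_x (W x)%:E <= M%:E + \int[mu]_x (W x * \1_E (x, y))%:E)%E.
  move=> Qy; apply: le_trans (leeD (HM _ Qy) (lexx _)).
  have mi : meas (fun x => `|incr y w x| `^ p) := meas_powR p (meas_incr y hw).
  have mE1 : meas (\1_(translate y @^-1` B)) by apply: measurable_indic.
  have eE x : \1_E (x, y) = \1_(translate y @^-1` B) x :> R.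
    by rewrite !indicE; congr (_%:R); congr nat_of_bool; apply/idP/idP; rewrite !inE.
  have mWE : meas (fun x => W x * \1_E (x, y)).
    by under eq_fun do rewrite eE; exact: (measM mW mE1).
  have p1 x : setT x -> (0 <= (`|incr y w x| `^ p)%:E)%E by move=> _; rewrite lee_fin powR_ge0.
  have p2 x : setT x -> (0 <= (W x * \1_E (x, y))%:E)%E by move=> _; rewrite lee_fin mulr_ge0.
  have emi : measurable_fun setT (fun x : T => (`|incr y w x| `^ p)%:E) by exact/measurable_EFinP.
  have emWE : measurable_fun setT (fun x : T => (W x * \1_E (x, y))%:E) by exact/measurable_EFinP.
  have emW : measurable_fun setT (fun x : T => (W x)%:E) by exact/measurable_EFinP.
  rewrite -(ge0_integralD mu measurableT p1 emi p2 emWE).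
  apply: (ge0_le_eint mu _ emW (emeasurable_funD emi emWE)) => x; first by rewrite lee_fin.
  rewrite -EFinD lee_fin indicE.
  have [Bx|Bx] := boolP (_ \in E); first by rewrite mulr1 lerDr powR_ge0.
  rewrite mulr0 addr0 /incr wA ?sub0r ?normrN//.
  by move=> /AB Bxy; move: Bx; rewrite notin_setE; apply.
set I := (\int[mu]_x (W x)%:E)%E.
have h : (mu (cube r) * I <= mu (cube r) * M%:E + (fine (mu B))%:E * I)%E :=
  averaging mE mQ Qfin W0 Iw M0 Eb HQ.
have I0 : (0 <= I)%E by apply: integral_ge0 => x _; rewrite lee_fin.
have Ifin : I \is a fin_num.
  rewrite ge0_fin_numE//; move/integP : Iw => [_].
  by under eq_integral do rewrite ger0_norm ?powR_ge0//.
move: h; rewrite -[I]fineK// -fQ -!EFinM -EFinD !lee_fin => h.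
move: mB2; rewrite -fB -fQ -EFinM lte_fin => mB2.
have B0 : 0 <= fine (mu B) by rewrite fine_ge0.
have J0 : 0 <= fine I by rewrite fine_ge0.
move: (fine I) (fine (mu B)) (fine (mu (cube r))) J0 B0 mB2 h => J b c J0 b0 bc h.
have c0 : 0 < c by lra.
(* J is the integral of |w|^p, b the measure of B and c that of the cube. *)
rewrite -(ler_pM2l c0); nra.
Qed.

End FaberKrahn.

(** * Testing the equation with a truncation of the solution *)

Section Energy.
Context (R : realType) (N : nat) (Omega : set 'rV[R]_N) (oO : open Omega).
Implicit Types (f phi u h : 'rV[R]_N -> R) (g : 'I_N -> 'rV[R]_N -> R) (p : R).
Local Notation mu := (leb R N).
Local Notation meas := (@meas _ (lebT R N) R).
Local Notation T := (lebT R N).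

Lemma dot_ge0 (a : 'rV[R]_N) : 0 <= dot a a.
Proof. by apply: sumr_ge0 => i _; rewrite -expr2 sqr_ge0. Qed.

Lemma enorm_sqr (a : 'rV[R]_N) : enorm a ^+ 2 = dot a a.
Proof. by rewrite sqr_sqrtr// dot_ge0. Qed.

Lemma coord_le_enorm (a : 'rV[R]_N) i : `|a 0 i| <= enorm a.
Proof.
rewrite -(@ler_pXn2r _ 2)// ?nnegrE ?sqrtr_ge0// enorm_sqr /dot (bigD1 i)//=.
by rewrite real_normK ?num_real// expr2 lerDl sumr_ge0// => j _; rewrite -expr2 sqr_ge0.
Qed.

Lemma enorm_le_sum (a : 'rV[R]_N) : enorm a <= \sum_i `|a 0 i|.
Proof.
have S0 : 0 <= \sum_i `|a 0 i| by apply: sumr_ge0.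
rewrite -(@ler_pXn2r _ 2)// ?nnegrE ?sqrtr_ge0// enorm_sqr /dot.
rewrite [leRHS]expr2 mulr_suml; apply: ler_sum => i _.
rewrite -[a 0 i * a 0 i]expr2 -real_normK ?num_real// expr2 ler_wpM2l//.
by rewrite (bigD1 i)//= lerDl sumr_ge0.
Qed.

(** The case a = 0 has to be treated apart because of the negative exponent
    p - 2 when p < 2; both sides are then 0. *)
Lemma plap_identity (a : 'rV[R]_N) p s : p != 0 ->
  enorm a `^ (p - 2) * dot a (s *: a) = s * enorm a `^ p.
Proof.
move=> p0; have -> : dot a (s *: a) = s * enorm a ^+ 2.
  by rewrite enorm_sqr /dot mulr_sumr; apply: eq_bigr => i _; rewrite mxE mulrCA.
rewrite mulrCA; congr (_ * _).
have [->|e0] := eqVneq (enorm a) 0; first by rewrite expr0n mulr0 powR0.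
by rewrite -powR_mulrn ?sqrtr_ge0// -powRD ?subrK// e0 implybT.
Qed.

Lemma pnorm_sum p g : 1 <= p -> (forall i, meas (g i)) ->
  meas (fun x => \sum_i g i x) /\
  (pnorm mu p (fun x => \sum_i g i x)%R <= \sum_i pnorm mu p (g i))%E.
Proof.
move=> p1 hg.
have -> : (fun x => \sum_i g i x) = \big[(fun f k : T -> R => (f \+ k)%R)/cst 0]_i g i.
  by apply/funext => x; rewrite (big_morph (fun F : T -> R => F x) (id1 := 0) (op1 := +%R)).
elim/big_ind2: _ => [|a b c d' [m1 h1] [m2 h2]|i _].
- by split; [exact: measurable_cst|rewrite pnorm0// (lt_le_trans _ p1)].
- split; first exact: measD.
  by apply: le_trans (pnormD mu p1 m1 m2) _; exact: leeD.
- by split.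
Qed.

Lemma meas_enorm (G : 'rV[R]_N -> 'rV[R]_N) : (forall i, meas (fun x => G x 0 i)) ->
  meas (fun x => enorm (G x)).
Proof.
move=> hG; have ms : measurable_fun setT (@Num.sqrt R).
  by apply: continuous_measurable_fun => x; exact: sqrt_continuous.
apply: (measurableT_comp ms).
rewrite /dot.
have -> : (fun x => \sum_i G x 0 i * G x 0 i) =
   \big[(fun f k : T -> R => (f \+ k)%R)/cst 0]_i (fun x => G x 0 i * G x 0 i).
  by apply/funext => x; rewrite (big_morph (fun F : T -> R => F x) (id1 := 0) (op1 := +%R)).
elim/big_ind: _ => [|a b|i _]; [exact: measurable_cst|exact: measD|exact: measM].
Qed.

Lemma powR_le_self (a p : R) : 0 <= a <= 1 -> 1 <= p -> a `^ p <= a.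
Proof.
move=> /andP[a0 a1] p1; have [->|an0] := eqVneq a 0.
  by rewrite powR0// gt_eqF// (lt_le_trans _ p1).
rewrite -[leRHS]powRr1//; apply: ger_powR => //.
by rewrite a1 andbT lt_neqAle eq_sym an0.
Qed.

Definition tests_against p (Gu : 'rV[R]_N -> 'rV[R]_N) h :=
  forall phi Gphi, sobolev0 Omega p phi Gphi -> weak_eq Omega p Gu h phi Gphi.

(** With softplus o u as test function the left-hand side of the equation is
    the integral of sigmoid (u) |Du|^p, which dominates that of
    |sigmoid (u) D_i u|^p since [sigmoid] takes its values in [0, 1]. *)
Lemma energy p u Gu h m k : 1 < p -> 0 < m -> sobolev0 Omega p u Gu ->
  meas (h \_ Omega) -> integ mu (fun x => (h \_ Omega) x * (u \_ Omega) x) ->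
  tests_against p Gu h ->
  forall J, J = \int[mu]_x ((h \_ Omega) x * softplus m k ((u \_ Omega) x)) ->
  0 <= J /\ forall i,
  (pnorm mu p (fun x => sigmoid m k ((u \_ Omega) x) * ((fun x => Gu x 0 i) \_ Omega) x)%R
    <= (J `^ p^-1)%:E)%E.
Proof.
move=> p1 m0 sob mh Ihu Heq.
have p0 : 0 < p by exact: lt_trans p1.
have pn0 : p != 0 by rewrite gt_eqF.
have W := sobolev0_W0ext sob.
have W' := W0ext_softplus k p1 m0 W.
have [hu hg fu fg _] := W; have [hu' hg' fu' fg' _] := W'.
set uh := u \_ Omega in W W' hu hu' fu fu' Ihu *; set hh := h \_ Omega in mh Ihu *.
pose g i := (fun x => Gu x 0 i) \_ Omega.
pose phi x := softplus m k (u x); pose Gphi x := sigmoid m k (u x) *: Gu x.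
have E1 : phi \_ Omega = softplus m k \o uh.
  apply: restrictP => x Ox; first by rewrite /= /uh restrict_in.
  by rewrite /= /uh restrict_out// softplus_at0.
have E2 i : (fun x => Gphi x 0 i) \_ Omega = (fun x => sigmoid m k (uh x) * g i x).
  apply: restrictP => x Ox; first by rewrite /uh /g !restrict_in// mxE.
  by rewrite /g [X in _ * X]restrict_out// mulr0.
have sphi : sobolev0 Omega p phi Gphi.
  apply: W0ext_sobolev0 => //; rewrite E1.
  by rewrite (_ : (fun i => _) = (fun i x => sigmoid m k (uh x) * g i x))//; apply/funext.
have IJ : integ mu (fun x => hh x * softplus m k (uh x)).
  apply: (integ_dom _ _ Ihu); first exact: measM.
  by move=> x; rewrite !normrM ler_wpM2l// softplus_norm.
have := Heq _ _ sphi.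
have IO : mu.-integrable Omega (fun x : T => (h x * phi x)%:E).
  have := integrableS measurableT (measurable_Omega oO) (@subsetT _ _) IJ.
  by apply: eq_integrable; [exact: measurable_Omega|move=> x /set_mem Ox; rewrite /= /hh /uh !restrict_in].
move=> /(_ IO).
rewrite [RHS]Rintegral_mkcond.
have -> : (fun x => h x * phi x) \_ Omega = (fun x => hh x * softplus m k (uh x)).
  apply: restrictP => x Ox; first by rewrite /hh /uh !restrict_in.
  by rewrite /hh restrict_out// mul0r.
rewrite /plaplacian_form Rintegral_mkcond.
pose G x : 'rV[R]_N := \row_i g i x.
have mG i : meas (fun x => G x 0 i) by under eq_fun do rewrite mxE; exact: hg.
have -> : (fun x => enorm (Gu x) `^ (p - 2) * dot (Gu x) (Gphi x)) \_ Omega =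
    (fun x => sigmoid m k (uh x) * enorm (G x) `^ p).
  apply: restrictP => x Ox.
    rewrite /Gphi (plap_identity _ _ pn0) /uh restrict_in//; congr (_ * enorm _ `^ _).
    by apply/rowP => i; rewrite mxE /g restrict_in.
  have -> : G x = 0 by apply/rowP => i; rewrite !mxE /g restrict_out.
  rewrite (_ : enorm 0 = 0) ?powR0 ?mulr0 ?gt_eqF//.
  by rewrite /enorm /dot big1 ?sqrtr0// => i _; rewrite mxE mul0r.
rewrite -/hh -/uh => EJ J JE.
have me : meas (fun x => enorm (G x)) := meas_enorm mG.
have Ie : integ mu (fun x => `|enorm (G x)| `^ p).
  apply/pnorm_lty => //.
  have [ms hs] := pnorm_sum (ltW p1) (fun i => meas_norm (mG i)).
  apply: le_lt_trans (pnorm_le mu (ltW p0) me ms _) _.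
    move=> x; rewrite !ger0_norm ?sqrtr_ge0 ?sumr_ge0//; exact: enorm_le_sum.
  apply: le_lt_trans hs _; apply: lte_sum_pinfty => i _.
  apply: le_lt_trans (pnorm_le mu (ltW p0) (meas_norm (mG i)) (hg i) _) (fg i) => x.
  by rewrite normr_id mxE.
have s01 x := sigmoid_itv m k (uh x).
have msg : meas (fun x => sigmoid m k (uh x)).
  apply: (@measurableT_comp _ _ _ _ _ _ (sigmoid m k)) => //.
  apply: continuous_measurable_fun => s.
  by apply: differentiable_continuous; apply/derivable1_diffP; case: (is_derive_sigmoid m k s).
have mse : meas (fun x => sigmoid m k (uh x) * enorm (G x) `^ p).
  by apply: measM => //; have := meas_powR p me; under eq_fun do rewrite ger0_norm ?sqrtr_ge0//.
have se0 x : 0 <= sigmoid m k (uh x) * enorm (G x) `^ p.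
  by case/andP: (s01 x) => ? ?; rewrite mulr_ge0 ?powR_ge0.
have Ise : integ mu (fun x => sigmoid m k (uh x) * enorm (G x) `^ p).
  apply: (integ_dom mse _ Ie) => x; case/andP: (s01 x) => ? ?.
  by rewrite !ger0_norm ?powR_ge0 ?sqrtr_ge0// ler_piMl// powR_ge0.
have J0 : 0 <= J by rewrite JE -EJ; apply: Rintegral_ge0.
split => // i.
apply: pnorm_le_of_integral => //; first exact: powR_ge0.
rewrite -powRrM mulVf ?gt_eqF// powRr1// JE -EJ -EFin_Rint//.
apply: ge0_le_eint => [x|||x]; first by rewrite lee_fin powR_ge0.
- exact/emeas_powR/hg'.
- exact/measurable_EFinP.
have /andP[s0 s1] := s01 x.
rewrite lee_fin normrM powRM// (ger0_norm s0); apply: ler_pM; rewrite ?powR_ge0//.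
  by apply: powR_le_self; [rewrite s0|exact: ltW].
rewrite ge0_ler_powR ?nnegrE ?sqrtr_ge0 ?(ltW p0)//.
by have := coord_le_enorm (G x) i; rewrite mxE.
Qed.

End Energy.

(** * Estimates above a level *)

Section Level.
Context (R : realType) (N : nat) (Omega : set 'rV[R]_N) (oO : open Omega).
Implicit Types (u h : 'rV[R]_N -> R) (p : R).
Local Notation mu := (leb R N).
Local Notation meas := (@meas _ (lebT R N) R).
Local Notation T := (lebT R N).
Hypothesis fO : (mu Omega < +oo)%E.

Lemma integral_le_of_pnorm p (f : T -> R) (c : R) : 0 < p -> 0 <= c ->
  (pnorm mu p f <= c%:E)%E -> (\int[mu]_x (`|f x| `^ p)%:E <= (c `^ p)%:E)%E.
Proof.
move=> p0 c0; rewrite pnormE; set I := (\int[mu]_x _)%E => h.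
have I0 : (0 <= I)%E by apply: integral_ge0 => x _; rewrite lee_fin powR_ge0.
have -> : I = ((I `^ p^-1) `^ p)%E by rewrite -poweRrM mulVf ?gt_eqF// poweRe1.
rewrite -poweR_EFin; apply: gt0_ler_poweR => //; first exact: ltW.
- by rewrite in_itv/= leey andbT poweR_ge0.
- by rewrite in_itv/= leey andbT lee_fin.
Qed.

(** Absorbs the error made on an energy into the p-th root of this energy. *)
Lemma powR_add_slack (a e p : R) : 0 <= a -> 0 <= e -> 1 <= p ->
  a `^ p + e `^ p <= (2 * (a + e)) `^ p.
Proof.
move=> a0 e0 p1; have p0 : 0 <= p by exact: le_trans p1.
rewrite powRM ?addr_ge0//.
have h1 : a `^ p <= (a + e) `^ p.
  by rewrite ge0_ler_powR ?nnegrE ?addr_ge0// lerDl.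
have h2 : e `^ p <= (a + e) `^ p.
  by rewrite ge0_ler_powR ?nnegrE ?addr_ge0// lerDr.
have h3 : 2 <= 2 `^ p :> R.
  by rewrite -[leLHS]powRr1// ler_powR// ler1n.
have h4 := powR_ge0 (a + e) p.
nra.
Qed.

Definition excess (k : R) (f : T -> R) x := Num.max (f x - k) 0.

Lemma meas_excess k (f : T -> R) : meas f -> meas (excess k f).
Proof.
by move=> hf; apply: measurable_maxr; [exact: (measB hf (measurable_cst k))|exact: measurable_cst].
Qed.

Lemma excess_ge0 k (f : T -> R) x : 0 <= excess k f x.
Proof. by rewrite le_max lexx orbT. Qed.

Lemma excess_le k (f : T -> R) x : 0 <= k -> excess k f x <= `|f x| * \1_[set x | k < f x] x.
Proof.
move=> k0; rewrite indicE; have [h|h] := ltP k (f x).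
  rewrite mem_set//= mulr1 ge_max normr_ge0 andbT.
  by apply: le_trans (ler_norm _); rewrite gerBl.
rewrite memNset /= ?mulr0; last by apply/negP; rewrite -leNgt.
by rewrite ge_max lexx andbT subr_le0.
Qed.

Lemma measurable_superlevel k (f : T -> R) : meas f -> measurable [set x | k < f x].
Proof.
move=> hf; rewrite -[X in measurable X]setTI.
have := measurable_fun_ltr (measurable_cst k) hf.
by move=> /(_ measurableT [set true]); apply.
Qed.

(** The limit m -> oo of [energy], expressed through increments by
    [W0ext_incr]. Replacing softplus by the excess over k costs at most
    |h| / m in the energy and 1 / m pointwise on Omega, which has finite
    measure. *)
Lemma level_incr p u Gu h k r y : 1 < p -> 0 <= k -> 0 < r -> cube r y ->
  sobolev0 Omega p u Gu ->
  integ mu (h \_ Omega) -> integ mu (fun x => (h \_ Omega) x * (u \_ Omega) x) ->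
  tests_against Omega p Gu h ->
  forall E, E = \int[mu]_x (`|(h \_ Omega) x * (u \_ Omega) x| * \1_[set x | k < (u \_ Omega) x] x) ->
  (pnorm mu p (incr y (excess k (u \_ Omega))) <= (2 * N%:R * r * E `^ p^-1)%:E)%E.
Proof.
move=> p1 k0 r0 Qy sob Ih Ihu Heq E EE.
have p0 : 0 < p by exact: lt_trans p1.
have p1' := ltW p1.
have W := sobolev0_W0ext sob.
have [hu hg fu fg _] := W.
set uh := u \_ Omega in W hu fu Ihu EE *; set hh := h \_ Omega in Ih Ihu EE *.
have mh := integ_meas Ih.
set w := excess k uh.
have mw : meas w := meas_excess k hu.
have mA := measurable_superlevel k hu.
have m1A : meas (\1_[set x | k < uh x]) by apply: measurable_indic.
have m1O : meas (\1_Omega) by apply: measurable_indic; exact: measurable_Omega.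
have IE : integ mu (fun x => `|hh x * uh x| * \1_[set x | k < uh x] x).
  apply: (integ_dom (measM (meas_norm (measM mh hu)) m1A) _ Ihu) => x.
  by rewrite normrM normr_id ler_piMr// indicE; case: (_ \in _); rewrite ?normr1 ?normr0.
have Ihn : integ mu (fun x => `|hh x|).
  by apply: (integ_dom (meas_norm mh) _ Ih) => x; rewrite normr_id.
have E0 : 0 <= E by rewrite EE; apply: Rintegral_ge0 => x _; rewrite mulr_ge0.
set a := E `^ p^-1; have a0 : 0 <= a by exact: powR_ge0.
have aE : a `^ p = E by rewrite -powRrM mulVf ?gt_eqF// powRr1.
set H1 := \int[mu]_x `|hh x|; have H10 : 0 <= H1 by apply: Rintegral_ge0.
have fV : (pnorm mu p (\1_Omega) < +oo)%E.
  apply/(pnorm_lty _ p0 m1O).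
  rewrite (_ : (fun x => _) = \1_Omega); first by apply: integ_indic => //; exact: measurable_Omega.
  apply/funext => x; rewrite indicE; case: (_ \in _) => /=; rewrite ?normr1 ?powR1 ?normr0 ?powR0 ?gt_eqF//.
set V := fine (pnorm mu p (\1_Omega)); have V0 : 0 <= V by rewrite fine_ge0// pnorm_ge0.
have VE : pnorm mu p (\1_Omega) = V%:E by rewrite fineK// ge0_fin_numE// pnorm_ge0.
have y0 i : 0 < y 0 i by have := Qy i; rewrite !mxE => /andP[].
have yr i : y 0 i <= r by have := Qy i; rewrite !mxE => /andP[].
have key e : 0 < e -> (pnorm mu p (incr y w) <= (2 * N%:R * r * (a + e) + e)%:E)%E.
  move=> e0.
  have ep0 : 0 < e `^ p by exact: powR_gt0.
  (* The inverse of m: the first bound makes the error on the energy at most e^p,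
     the second one the error on the increments at most e. *)
  pose dl := Num.min (e `^ p / (H1 + 1)) (e / (2 * V + 1)).
  have H11 : 0 < H1 + 1 by rewrite ltr_wpDl.
  have V21 : 0 < 2 * V + 1 by rewrite ltr_wpDl// mulr_ge0.
  have dl0 : 0 < dl by rewrite lt_min !divr_gt0.
  have d1 : dl * H1 <= e `^ p.
    apply: (@le_trans _ _ (dl * (H1 + 1))); first by rewrite ler_pM2l// lerDl.
    by rewrite -ler_pdivlMr// ge_min lexx.
  have d2 : dl * V + dl * V <= e.
    apply: (@le_trans _ _ (dl * (2 * V + 1))); first by rewrite mulrDr mulr1; lra.
    by rewrite -ler_pdivlMr// ge_min lexx orbT.
  pose m := dl^-1; have m0 : 0 < m by rewrite invr_gt0.
  have mV : m^-1 = dl by rewrite invrK.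
  set J := \int[mu]_x (hh x * softplus m k (uh x)).
  have [J0 HJ] := energy oO p1 m0 sob mh Ihu Heq (erefl J).
  have W' := W0ext_softplus k p1 m0 W.
  have [hu' hg' fu' fg' _] := W'.
  have appr x : `|softplus m k (uh x) - w x| <= dl by rewrite -mV; exact: softplus_approx.
  have JE : J <= E + dl * H1.
    have IR : integ mu (fun x => `|hh x * uh x| * \1_[set x | k < uh x] x + dl * `|hh x|).
      by apply: integD => //; exact: integZ.
    have -> : E + dl * H1 = \int[mu]_x (`|hh x * uh x| * \1_[set x | k < uh x] x + dl * `|hh x|).
      by rewrite EE /H1 -(RintegralZl dl measurableT Ihn) -(RintegralD measurableT IE (integZ dl Ihn)).
    apply: le_Rintegral => //.
      apply: (integ_dom (measM mh hu') _ Ihu) => x.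
      by rewrite !normrM ler_wpM2l// softplus_norm.
    move=> x _; apply: le_trans (ler_norm _) _; rewrite !normrM.
    rewrite [dl * _]mulrC -mulrA -mulrDr ler_wpM2l//.
    have h1 := excess_le uh x k0.
    have h2 := appr x; have h3 := excess_ge0 k uh x.
    rewrite -[softplus m k (uh x)](subrK (w x)).
    apply: le_trans (ler_normD _ _) _; rewrite addrC.
    have w0 : 0 <= w x := h3.
    by apply: lerD; [rewrite (ger0_norm w0); exact: h1|exact: h2].
  have Ja : J `^ p^-1 <= 2 * (a + e).
    have ae0 : 0 <= 2 * (a + e) by rewrite mulr_ge0// addr_ge0// ltW.
    have -> : 2 * (a + e) = ((2 * (a + e)) `^ p) `^ p^-1.
      by rewrite -powRrM mulfV ?powRr1// gt_eqF.
    rewrite ge0_ler_powR ?nnegrE ?invr_ge0 ?powR_ge0 ?(ltW p0)//.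
    apply: le_trans JE _; apply: le_trans _ (powR_add_slack a0 (ltW e0) p1').
    by rewrite aE lerD2l.
  apply: le_trans (pnorm_incrB y p1' mw hu') _.
  have hm : (pnorm mu p (w \- (softplus m k \o uh))%R <= (dl * V)%:E)%E.
    rewrite EFinM -VE -[dl in leRHS](ger0_norm (ltW dl0)) -(pnormZ mu dl p1' m1O).
    apply: (pnorm_le mu (ltW p0) (measB mw hu') (measZ dl m1O)) => x.
    rewrite indicE; have [Ox|Ox] := pselect (Omega x).
      by rewrite mem_set//= mulr1 distrC (ger0_norm (ltW dl0)); exact: appr.
    rewrite memNset//= mulr0 normr0 /w /excess /uh restrict_out// softplus_at0 subr0.
    by rewrite sub0r max_r ?normr0// oppr_le0.
  have hi : (pnorm mu p (incr y (softplus m k \o uh)) <= (2 * N%:R * r * (a + e))%:E)%E.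
    apply: le_trans (W0ext_incr p1 W' y0) _.
    apply: (@le_trans _ _ (\sum_(i < N) (r * (2 * (a + e)))%:E)%E).
      apply: lee_sum => i _; rewrite EFinM.
      apply: lee_pmul; rewrite ?lee_fin ?pnorm_ge0 ?(ltW (y0 i))//.
      by apply: le_trans (HJ i) _; rewrite lee_fin.
    rewrite sumEFin sumr_const card_ord lee_fin -mulr_natl.
    by rewrite le_eqVlt; apply/orP; left; apply/eqP; ring.
  apply: le_trans (leeD hi (leeD hm hm)) _.
  by rewrite -!EFinD lee_fin lerD2l.
apply/lee_addgt0Pr => e e0.
have c0 : 0 < 2 * N%:R * r + 1 by rewrite ltr_wpDl// !mulr_ge0// ltW.
have := key (e / (2 * N%:R * r + 1)) ltac:(by rewrite divr_gt0).
move=> /le_trans; apply; rewrite -EFinD lee_fin.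
by rewrite le_eqVlt; apply/orP; left; apply/eqP; field; rewrite gt_eqF.
Qed.

(** The excess over k vanishes outside {u > k}; the smallness of this set lets
    [faber_krahn] turn the estimate of increments into one of the function. *)
Lemma level_estimate p u Gu h k r : 1 < p -> 0 <= k -> 0 < r ->
  sobolev0 Omega p u Gu ->
  integ mu (h \_ Omega) -> integ mu (fun x => (h \_ Omega) x * (u \_ Omega) x) ->
  tests_against Omega p Gu h ->
  (2%:E * mu [set x | (k < (u \_ Omega) x)%R] < mu (cube r))%E ->
  (\int[mu]_x (`|excess k (u \_ Omega) x| `^ p)%:E <=
   (2 * ((2 * N%:R * r) `^ p *
     \int[mu]_x (`|(h \_ Omega) x * (u \_ Omega) x| * \1_[set x | k < (u \_ Omega) x] x)))%:E)%E.
Proof.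
move=> p1 k0 r0 sob Ih Ihu Heq hA.
have p0 : 0 < p by exact: lt_trans p1.
have [hu hg fu fg _] := sobolev0_W0ext sob.
set E := \int[mu]_x _.
have E0 : 0 <= E by apply: Rintegral_ge0 => x _; rewrite mulr_ge0.
have mw := meas_excess k hu.
apply: (faber_krahn p0 r0 _ mw _ _ hA).
- by rewrite mulr_ge0 ?powR_ge0.
- apply/(pnorm_lty _ p0 mw); apply: le_lt_trans fu; apply: (pnorm_le mu (ltW p0) mw hu) => x.
  rewrite ger0_norm ?excess_ge0//; apply: le_trans (excess_le _ _ k0) _.
  by rewrite ler_piMr// indicE; case: (_ \in _).
- move=> x /negP; rewrite -leNgt => h0.
  by rewrite /excess max_r// subr_le0.
move=> y Qy.
have Nr : 0 <= 2 * N%:R * r by rewrite !mulr_ge0// ltW.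
have := level_incr p1 k0 r0 Qy sob Ih Ihu Heq (erefl E).
move=> /(integral_le_of_pnorm p0) Hp.
apply: le_trans (Hp _) _; first by rewrite mulr_ge0// powR_ge0.
by rewrite lee_fin powRM ?powR_ge0// -powRrM mulVf ?gt_eqF// powRr1.
Qed.

End Level.

(** * De Giorgi's iteration *)

Section DeGiorgi.
Context d (T : measurableType d) (R : realType) (mu : {measure set T -> \bar R}).
Variables (N : nat) (p q : R) (a b : T -> R).
Hypotheses (p1 : 1 <= p) (pN : p <= N%:R) (q1 : 1 <= q) (qN : q <= N%:R).
Hypotheses (ma : meas a) (mb : meas b) (a0 : forall x, 0 <= a x) (b0 : forall x, 0 <= b x).
Hypotheses (Ia : integ mu (fun x => a x `^ p)) (Ib : integ mu (fun x => b x `^ q)).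

Definition upper_set (s : R) : set T := [set x | s < Num.max (a x) (b x)].

Definition energy_above (s : R) : R := \int[mu]_x ((a x `^ p + b x `^ q) * \1_(upper_set s) x).

Definition pos_part (s z : R) : R := Num.max (z - s) 0.

Definition excess_energy (s : R) : R :=
  \int[mu]_x (pos_part s (a x) `^ p + pos_part s (b x) `^ q).

Let p0 : 0 < p. Proof. exact: lt_le_trans p1. Qed.
Let q0 : 0 < q. Proof. exact: lt_le_trans q1. Qed.

Lemma measurable_upper_set s : measurable (upper_set s).
Proof.
rewrite -[X in measurable X]setTI.
have := measurable_fun_ltr (measurable_cst s) (measurable_maxr ma mb).
by move=> /(_ measurableT [set true]); apply.
Qed.

Lemma pos_part_ge0 s z : 0 <= pos_part s z. Proof. by rewrite le_max lexx orbT. Qed.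

Let mpow (e : R) (f : T -> R) : meas f -> meas (fun x => f x `^ e).
Proof. by move=> hf; exact: (measurableT_comp (measurable_powR e) hf). Qed.

Let mpp s (f : T -> R) : meas f -> meas (fun x => pos_part s (f x)).
Proof. by move=> hf; apply: measurable_maxr;
  [exact: (measB hf (measurable_cst s))|exact: measurable_cst]. Qed.

Let U x := a x `^ p + b x `^ q.
Let U0 x : 0 <= U x. Proof. by rewrite addr_ge0 ?powR_ge0. Qed.
Let IU : integ mu U. Proof. exact: integD. Qed.
Let m1 s : meas (\1_(upper_set s) : T -> R).
Proof. by apply: measurable_indic; exact: measurable_upper_set. Qed.

Let IUA s : integ mu (fun x => U x * \1_(upper_set s) x).
Proof.
apply: (integ_dom (measM (integ_meas IU) (m1 s)) _ IU) => x.
by rewrite normrM ler_piMr// indicE; case: (_ \in _); rewrite ?normr1 ?normr0.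
Qed.

Lemma pos_part_le s z (e : R) : 0 <= s -> 0 <= z -> 0 <= e -> pos_part s z `^ e <= z `^ e.
Proof.
move=> s0 z0 e0; rewrite ge0_ler_powR ?nnegrE ?pos_part_ge0//.
by rewrite ge_max z0 andbT gerBl.
Qed.

Lemma integ_pos_part s : 0 <= s -> integ mu (fun x => pos_part s (a x) `^ p + pos_part s (b x) `^ q).
Proof.
move=> s0; apply: integD.
  apply: (integ_dom (mpow p (mpp s ma)) _ Ia) => x.
  by rewrite !ger0_norm ?powR_ge0// pos_part_le// ltW.
apply: (integ_dom (mpow q (mpp s mb)) _ Ib) => x.
by rewrite !ger0_norm ?powR_ge0// pos_part_le// ltW.
Qed.

Lemma one_le_U s x : 1 <= s -> upper_set s x -> 1 <= U x.
Proof.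
move=> s1; rewrite /upper_set /= lt_max => /orP[] h.
  have : 1 `^ p <= a x `^ p by rewrite ge0_ler_powR ?nnegrE ?(ltW p0)// (le_trans s1 (ltW h)).
  by rewrite powR1 => h1; rewrite ler_wpDr ?powR_ge0.
have : 1 `^ q <= b x `^ q by rewrite ge0_ler_powR ?nnegrE ?(ltW q0)// (le_trans s1 (ltW h)).
by rewrite powR1 => h1; rewrite ler_wpDl ?powR_ge0.
Qed.

(** Chebyshev's inequality: the density is at least 1 on the set. *)
Lemma measure_upper_le s : 1 <= s -> (mu (upper_set s) <= (energy_above s)%:E)%E.
Proof.
move=> s1; have UA0 x : 0 <= U x * \1_(upper_set s) x by rewrite mulr_ge0.
rewrite /energy_above -(EFin_Rint (IUA s) UA0).
have mA := measurable_upper_set s.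
have <- : (\int[mu]_x (\1_(upper_set s) x : R)%:E = mu (upper_set s))%E.
  by rewrite (integral_indic mu measurableT mA) setIT.
apply: (@ge0_le_eint _ _ _ mu (fun x => (\1_(upper_set s) x : R)%:E)
  (fun x => (U x * \1_(upper_set s) x)%:E)) => [x|||x].
- by rewrite lee_fin.
- exact/measurable_EFinP/m1.
- exact/measurable_EFinP/(integ_meas (IUA s)).
rewrite lee_fin indicE; have [|_] := boolP (x \in _); last by rewrite mulr0.
by rewrite inE mulr1 => /(one_le_U s1).
Qed.

(** The sum of the contributions of [powR_split] for both components. *)
Definition growth_const : R := 2 ^+ N + 2 * 4 ^+ N.

(** Either z - s >= 2, and then z <= 2 (z - s), or z <= 4. Replacing the
    exponent by N makes the constants common to both components. *)
Lemma powR_split (z s e : R) : 0 <= z -> 0 <= s <= 2 -> 0 < e -> e <= N%:R ->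
  z `^ e <= 2 ^+ N * pos_part s z `^ e + 4 ^+ N.
Proof.
move=> z0 /andP[s0 s2] e0 eN.
have h : z <= 2 * Num.max (pos_part s z) 2.
  have h1 : z - s <= pos_part s z by rewrite le_max lexx.
  have h2 : pos_part s z <= Num.max (pos_part s z) 2 by rewrite le_max lexx.
  have h3 : 2 <= Num.max (pos_part s z) 2 by rewrite le_max lexx orbT.
  lra.
have P0 := pos_part_ge0 s z.
have h2 : 2 `^ e <= 2 ^+ N :> R by rewrite -powR_mulrn// ler_powR// ler1n.
have h4 : 2 `^ e * 2 `^ e <= 4 ^+ N :> R.
  rewrite -powRM// -natrM -powR_mulrn// ler_powR// ler1n//.
have M0 : 0 <= Num.max (pos_part s z) 2 by rewrite le_max P0.
apply: (@le_trans _ _ ((2 * Num.max (pos_part s z) 2) `^ e)).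
  by rewrite ge0_ler_powR ?nnegrE ?mulr_ge0 ?(ltW e0).
rewrite powRM//; have [le2|le2] := leP (pos_part s z) 2.
  apply: (le_trans h4); rewrite lerDr mulr_ge0 ?powR_ge0// exprn_ge0//.
rewrite ler_wpDr ?exprn_ge0// ler_wpM2r ?powR_ge0//.
Qed.

(** On [upper_set t] one of a, b exceeds s by at least t - s, so that
    (t - s)^N is at most D = (a - s)_+^p + (b - s)_+^q there. The constants
    left by [powR_split] are therefore at most (t - s)^-N D. *)
Lemma energy_step s t : 1 <= s -> s < t -> t <= 2 ->
  energy_above t <= growth_const * ((t - s) ^- N) * excess_energy s.
Proof.
move=> s1 st t2.
have s0 : 0 <= s by lra.
have d0 : 0 < t - s by lra.
have d1 : t - s <= 1 by lra.
have dN : 0 < (t - s) ^+ N by rewrite exprn_gt0.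
have C0 : 0 <= growth_const by rewrite addr_ge0 ?mulr_ge0 ?exprn_ge0.
have IP := integ_pos_part s0.
rewrite /energy_above /excess_energy -(RintegralZl _ measurableT IP).
apply: le_Rintegral => //; [exact: IUA|exact: integZ|].
move=> x _; rewrite indicE.
set P := pos_part s (a x) `^ p; set Q := pos_part s (b x) `^ q.
have P0 : 0 <= P by exact: powR_ge0.
have Q0 : 0 <= Q by exact: powR_ge0.
have [|_] := boolP (x \in _); last first.
  by rewrite mulr0 !mulr_ge0 ?addr_ge0 ?invr_ge0 ?(ltW dN).
rewrite inE mulr1 => Ax.
have hP : a x `^ p <= 2 ^+ N * P + 4 ^+ N by apply: powR_split => //; apply/andP; split; lra.
have hQ : b x `^ q <= 2 ^+ N * Q + 4 ^+ N by apply: powR_split => //; apply/andP; split; lra.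
have big (z e : R) : t < z -> 0 < e -> e <= N%:R -> (t - s) ^+ N <= pos_part s z `^ e.
  move=> tz e0 eN.
  have h1 : t - s <= pos_part s z by rewrite le_max; apply/orP; left; lra.
  apply: (@le_trans _ _ ((t - s) `^ e)).
    by rewrite -powR_mulrn ?(ltW d0)//; apply: ger_powR => //; rewrite d0.
  by rewrite ge0_ler_powR ?nnegrE ?pos_part_ge0 ?(ltW e0) ?(ltW d0).
have PQ : (t - s) ^+ N <= P + Q.
  move: Ax; rewrite /upper_set /= lt_max => /orP[] h.
    by rewrite ler_wpDr// big.
  by rewrite ler_wpDl// big.
have S1 : 1 <= (t - s) ^- N * (P + Q) by rewrite ler_pdivlMl// mulr1.
have S2 : P + Q <= (t - s) ^- N * (P + Q).
  by rewrite ler_pdivlMl// ler_piMl ?addr_ge0// exprn_ile1// ltW.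
rewrite /growth_const -mulrA.
have e2 : 0 <= 2 ^+ N :> R by rewrite exprn_ge0.
have e4 : 0 <= 4 ^+ N :> R by rewrite exprn_ge0.
move: ((t - s) ^- N * (P + Q)) S1 S2 => Y S1 S2.
nra.
Qed.

(** The invariant is E (s_n) <= c0/4 r_n^N for s_n = 2 - 2^-n and
    r_n = r0 2^(-N n). By [measure_upper_le] it makes the superlevel set small
    enough for the hypothesis to hold at scale r_n. In [energy_step] the
    factor (s_(n+1) - s_n)^-N is 2^N 2^(N n); the second power is compensated
    by the factor r_n of the hypothesis, and the first one by the choice of
    r0, which also pays for the ratio 2^(-N^2) of successive r_n^N. *)
Lemma de_giorgi_iteration (L c0 r0 : R) : 0 <= L -> 0 < c0 -> 0 < r0 <= 1 -> (0 < N)%N ->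
  (forall s r, 1 <= s <= 2 -> 0 < r <= 1 ->
    (2%:E * mu (upper_set s) < (c0 * r ^+ N)%:E)%E ->
    excess_energy s <= L * r * energy_above s) ->
  growth_const * L * 2 ^+ N * r0 <= (2^-1) ^+ (N * N) ->
  energy_above 1 <= c0 / 4 * r0 ^+ N ->
  mu (upper_set 2) = 0%E.
Proof.
move=> L0 c00 /andP[r00 r01] N0 H Hr H1.
pose s_ n : R := 2 - (2^-1) ^+ n.
pose r_ n : R := r0 * ((2^-1) ^+ N) ^+ n.
have i0 : 0 <= 2^-1 :> R by lra.
have i1 : 2^-1 <= 1 :> R by lra.
have h0 n : 0 < (2^-1 : R) ^+ n by rewrite exprn_gt0.
have h1 n : (2^-1 : R) ^+ n <= 1 by rewrite exprn_ile1.
have s1 n : 1 <= s_ n by rewrite /s_; have := h1 n; lra.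
have s2 n : s_ n <= 2 by rewrite /s_; have := h0 n; lra.
have rn0 n : 0 < r_ n by rewrite mulr_gt0// !exprn_gt0.
have rn1 n : r_ n <= 1 by rewrite mulr_ile1 ?(ltW r00) ?exprn_ge0 ?exprn_ile1 ?exprn_ge0.
have E0 s : 0 <= energy_above s.
  by apply: Rintegral_ge0 => x _; apply: mulr_ge0 => //; exact: U0.
have C0 : 0 <= growth_const by rewrite addr_ge0 ?mulr_ge0 ?exprn_ge0.
have key n : energy_above (s_ n) <= c0 / 4 * r_ n ^+ N.
  elim: n => [|n IH]; first by rewrite /s_ /r_ !expr0 mulr1 -[2]/(1 + 1) addrK.
  have st : s_ n < s_ n.+1 by rewrite /s_ exprS; have := h0 n; lra.
  have dE : s_ n.+1 - s_ n = (2^-1) ^+ n.+1 by rewrite /s_ exprS; lra.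
  have sm : (2%:E * mu (upper_set (s_ n)) < (c0 * r_ n ^+ N)%:E)%E.
    apply: (@le_lt_trans _ _ (2%:E * (energy_above (s_ n))%:E)%E).
      by rewrite lee_pmul2l ?measure_upper_le.
    rewrite -EFinM lte_fin.
    have : 0 < c0 * r_ n ^+ N by rewrite mulr_gt0 ?exprn_gt0.
    by move: IH; rewrite mulrAC; lra.
  have He := H (s_ n) (r_ n) ltac:(by rewrite s1 s2) ltac:(by rewrite rn0 rn1) sm.
  apply: le_trans (energy_step (s1 n) st (s2 n.+1)) _.
  have D0 : 0 <= growth_const * (s_ n.+1 - s_ n) ^- N.
    by rewrite mulr_ge0// invr_ge0 exprn_ge0// dE ltW.
  apply: le_trans (ler_wpM2l D0 He) _.
  have Lr : 0 <= L * r_ n by rewrite mulr_ge0// ltW.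
  apply: le_trans (ler_wpM2l D0 (ler_wpM2l Lr IH)) _.
  have -> : r_ n.+1 ^+ N = r_ n ^+ N * (2^-1) ^+ (N * N).
    by rewrite /r_ exprSr mulrA [LHS]exprMn; congr (_ * _); rewrite -exprM.
  rewrite [leRHS]mulrA [leRHS]mulrC.
  have -> : growth_const * (s_ n.+1 - s_ n) ^- N * (L * r_ n * (c0 / 4 * r_ n ^+ N)) =
     (growth_const * L * 2 ^+ N * r0) * (c0 / 4 * r_ n ^+ N).
    rewrite dE /r_ -exprM.
    have -> : ((2^-1) ^+ n.+1) ^- N = 2 ^+ N * 2 ^+ (N * n) :> R.
      by rewrite -!exprVn invrK -exprM mulSn exprD mulnC.
    have e1 : 2 ^+ (N * n) * (2^-1) ^+ (N * n) = 1 :> R by rewrite -exprMn mulfV ?expr1n.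
    transitivity (growth_const * L * 2 ^+ N * r0 * (c0 / 4 * (r0 * 2^-1 ^+ (N * n)) ^+ N) *
      (2 ^+ (N * n) * (2^-1) ^+ (N * n))); last by rewrite e1 mulr1.
    by ring.
  by apply: ler_wpM2r => //; rewrite mulr_ge0 ?exprn_ge0 ?divr_ge0 ?(ltW c00) ?(ltW (rn0 n)).
have b2 n : (mu (upper_set 2) <= (c0 * (2^-1) ^+ n)%:E)%E.
  have sub : upper_set 2 `<=` upper_set (s_ n).
    by move=> x; rewrite /upper_set /=; apply: le_lt_trans.
  apply: le_trans (le_measure mu _ _ sub) _; rewrite ?inE; [exact: measurable_upper_set..|].
  apply: le_trans (measure_upper_le (s1 n)) _; rewrite lee_fin.
  apply: le_trans (key n) _.
  have rN : r_ n ^+ N <= (2^-1) ^+ n.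
    apply: (@le_trans _ _ (r_ n)); first by rewrite -[leRHS]expr1 ler_wiXn2l ?(ltW (rn0 n)).
    rewrite /r_ -exprM; apply: (@le_trans _ _ ((2^-1) ^+ (N * n))).
      by rewrite ler_piMl ?exprn_ge0.
    by apply: ler_wiXn2l => //; rewrite leq_pmull.
  apply: (@le_trans _ _ (c0 / 4 * (2^-1) ^+ n)); first by rewrite ler_wpM2l ?divr_ge0 ?(ltW c00).
  by rewrite ler_wpM2r ?(ltW (h0 n))// ler_pdivrMr// ler_peMr ?(ltW c00)// ler1n.
apply/eqP; rewrite eq_le measure_ge0 andbT.
apply/lee_addgt0Pr => e e0; rewrite add0e.
have [n hn] : exists n, c0 * (2^-1) ^+ n <= e.
  exists (Num.truncn (c0 / e)).+1.
  rewrite exprVn ler_pdivrMr ?exprn_gt0// mulrC -ler_pdivrMr//.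
  apply: (@le_trans _ _ ((Num.truncn (c0 / e)).+1%:R)); first exact/ltW/truncnS_gt.
  by rewrite -natrX ler_nat ltnW// ltn_expl.
by apply: le_trans (b2 n) _; rewrite lee_fin.
Qed.

End DeGiorgi.

(** * Estimates above a level for the absolute value *)

Section AlmostEverywhere.
Context d (T : measurableType d) (R : realType) (mu : {measure set T -> \bar R}).
Implicit Types f g : T -> R.

Lemma ae_mono (P Q : T -> Prop) : (forall x, P x -> Q x) ->
  (\forall x \ae mu, P x) -> \forall x \ae mu, Q x.
Proof. by move=> PQ; apply: filterS. Qed.

Lemma ae_conj (P Q : T -> Prop) : (\forall x \ae mu, P x) ->
  (\forall x \ae mu, Q x) -> \forall x \ae mu, P x /\ Q x.
Proof. by move=> h1 h2; apply: filterS2 h1 h2. Qed.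

Lemma ae_dom f g : meas f -> integ mu g ->
  (\forall x \ae mu, `|f x| <= g x) -> integ mu f.
Proof.
move=> hf Ig fg; apply/integP; split => //.
have [mg ig] := (integP mu g).1 Ig.
apply: le_lt_trans ig; apply: ae_ge0_le_integral => //.
- exact/measurable_EFinP/meas_norm.
- exact/measurable_EFinP/meas_norm.
by apply: filterS fg => x h _; rewrite lee_fin; apply: le_trans h (ler_norm _).
Qed.

Lemma ae_le_Rint f g : integ mu f -> integ mu g -> (forall x, 0 <= f x) -> (forall x, 0 <= g x) ->
  (\forall x \ae mu, f x <= g x) -> \int[mu]_x f x <= \int[mu]_x g x.
Proof.
move=> If Ig f0 g0 fg; rewrite -lee_fin -!EFin_Rint//.
have mesf := integ_meas If; have mg := integ_meas Ig.
apply: (ae_ge0_le_integral measurableT) => [x _||x _||].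
- by rewrite lee_fin.
- exact/measurable_EFinP.
- by rewrite lee_fin.
- exact/measurable_EFinP.
by apply: filterS fg => x h _; rewrite lee_fin.
Qed.

End AlmostEverywhere.

Section Negation.
Context (R : realType) (N : nat) (Omega : set 'rV[R]_N) (oO : open Omega).
Implicit Types (u h phi : 'rV[R]_N -> R) (p : R).
Local Notation mu := (leb R N).
Local Notation meas := (@meas _ (lebT R N) R).

Lemma oppf_cst0 phi : (fun x => - phi x) = cst 0 - phi.
Proof. by apply/funext => x; rewrite [RHS](_ : _ = 0 - phi x)// sub0r. Qed.

Lemma test_functionN phi : test_function Omega phi ->
  test_function Omega (fun x => - phi x).
Proof.
move=> [sphi cK KO]; rewrite /test_function.
rewrite (_ : [set x | - phi x != 0] = [set x | phi x != 0]); last first.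
  by apply/seteqP; split => x /=; rewrite oppr_eq0.
split => // k; rewrite oppf_cst0; apply: CkB; last exact: sphi.
exact: Ck_cst.
Qed.

Lemma partialN i phi : (forall x, derivable phi x (delta_mx 0 i)) ->
  partial i (fun x => - phi x) = (fun x => - partial i phi x).
Proof.
by move=> dphi; apply/funext => x; exact: (deriveN (dphi x)).
Qed.

Lemma sobolev0N p u Gu : 1 < p -> sobolev0 Omega p u Gu ->
  sobolev0 Omega p (fun x => - u x) (fun x => - Gu x).
Proof.
move=> p1 /sobolev0_W0ext [hu hg fu fg H].
have rN (f : 'rV[R]_N -> R) : (fun x => - f x) \_ Omega = (\- (f \_ Omega))%R.
  apply: restrictP => x Ox; first by rewrite /= restrict_in.
  by rewrite /= restrict_out// oppr0.
have E2 i : (fun x => (- Gu x) 0 i) \_ Omega = (\- ((fun x => Gu x 0 i) \_ Omega))%R.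
  by rewrite -rN; congr (_ \_ _); apply/funext => x; rewrite mxE.
apply: W0ext_sobolev0 => //; rewrite rN.
rewrite (_ : (fun i => _) = (fun i => (\- ((fun x => Gu x 0 i) \_ Omega))%R)); last exact/funext.
split; [exact: measN|by move=> i; exact: measN|by rewrite pnormN|by move=> i; rewrite pnormN|].
move=> e e0; have [phi [tphi n1 n2]] := H e e0.
exists (fun x => - phi x); split; first exact: test_functionN.
  rewrite (_ : (_ \- _)%R = (\- (u \_ Omega \- phi))%R) ?pnormN//.
  by apply/funext => x /=; rewrite opprK opprB addrC.
move=> i; have [/(_ 1%N)[_ /(_ i)[dphi _]] _ _] := tphi.
rewrite partialN// (_ : (_ \- _)%R = (\- ((fun x => Gu x 0%R i) \_ Omega \- partial i phi))%R) ?pnormN//.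
by apply/funext => x /=; rewrite opprK opprB addrC.
Qed.

(** The p-Laplacian is odd. *)
Lemma tests_againstN p Gu h : 1 < p -> tests_against Omega p Gu h ->
  tests_against Omega p (fun x => - Gu x) (fun x => - h x).
Proof.
move=> p1 H phi Gphi sphi.
have := H _ _ (sobolev0N p1 sphi); rewrite /weak_eq /plaplacian_form.
have E1 : (fun x => h x * - phi x) = (fun x => - h x * phi x).
  by apply/funext => x; rewrite mulrN mulNr.
have dN (a b : 'rV[R]_N) : dot a (- b) = dot (- a) b.
  by apply: eq_bigr => i _; rewrite !mxE mulrN mulNr.
have eN (a : 'rV[R]_N) : enorm (- a) = enorm a.
  by rewrite /enorm -dN /dot; congr Num.sqrt; apply: eq_bigr => i _; rewrite !mxE opprK.
have -> : (fun x => (h x * - phi x)%:E) = (fun x => (- h x * phi x)%:E).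
  by apply/funext => x; rewrite mulrN mulNr.
rewrite E1.
by have -> : (fun x => enorm (Gu x) `^ (p - 2) * dot (Gu x) (- Gphi x)) =
  (fun x => enorm (- Gu x) `^ (p - 2) * dot (- Gu x) (Gphi x))
  by apply/funext => x; rewrite dN eN.
Qed.

End Negation.

Section AbsLevel.
Context (R : realType) (N : nat) (Omega : set 'rV[R]_N) (oO : open Omega).
Implicit Types (u h phi : 'rV[R]_N -> R) (p : R).
Local Notation mu := (leb R N).
Local Notation T := (lebT R N).
Local Notation meas := (@meas _ (lebT R N) R).
Hypothesis fO : (mu Omega < +oo)%E.

(** (|u| - k)_+ is the excess of u or that of -u, and -u solves the equation
    with right-hand side -h. The energy is bounded by means of a density U and
    a set A that both equations of a system can share. *)
Lemma abs_level p u Gu h (U : T -> R) (A : set T) K k r : 1 < p -> 0 <= k -> 0 < r -> 0 <= K ->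
  sobolev0 Omega p u Gu -> integ mu (h \_ Omega) -> tests_against Omega p Gu h ->
  integ mu U -> (forall x, 0 <= U x) ->
  (\forall x \ae mu, `|(h \_ Omega) x * (u \_ Omega) x| <= K * U x) ->
  measurable A -> (forall x, k < `|(u \_ Omega) x| -> A x) ->
  (2%:E * mu A < mu (cube r))%E ->
  \int[mu]_x (pos_part k `|(u \_ Omega) x| `^ p) <=
    4 * (2 * N%:R * r) `^ p * (K * \int[mu]_x (U x * \1_A x)).
Proof.
move=> p1 k0 r0 K0 sob Ih Heq IU U0 aeK mA kA hA.
have p0 : 0 < p by exact: lt_trans p1.
have sobN := sobolev0N p1 sob.
have HeqN := tests_againstN p1 Heq.
have [hu _ fu _ _] := sobolev0_W0ext sob.
have rN (f : 'rV[R]_N -> R) : (fun x => - f x) \_ Omega = (\- (f \_ Omega))%R.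
  apply: restrictP => x Ox; first by rewrite /= restrict_in.
  by rewrite /= restrict_out// oppr0.
set uh := u \_ Omega in hu fu aeK kA *; set hh := h \_ Omega in Ih aeK.
have mh := integ_meas Ih.
have Ihu : integ mu (fun x => hh x * uh x).
  by apply: (ae_dom (measM mh hu) (integZ K IU)).
have IhN : integ mu ((fun x => - h x) \_ Omega).
  by rewrite rN; apply: (integ_dom (measN mh) _ Ih) => x; rewrite /= normrN.
have IhuN : integ mu (fun x => ((fun x => - h x) \_ Omega) x * ((fun x => - u x) \_ Omega) x).
  by rewrite !rN; under eq_fun do rewrite mulrNN.
have m1A : meas (\1_A) by apply: measurable_indic.
have IUA : integ mu (fun x => U x * \1_A x).
  apply: (integ_dom (measM (integ_meas IU) m1A) _ IU) => x.
  by rewrite normrM ler_piMr// indicE; case: (_ \in _); rewrite ?normr1 ?normr0.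
have UA0 x : 0 <= U x * \1_A x by rewrite mulr_ge0.
set B := \int[mu]_x (U x * \1_A x).
have bound (z : T -> R) : meas z -> (forall x, `|z x| = `|uh x|) ->
    \int[mu]_x (`|hh x * uh x| * \1_[set x | k < z x] x) <= K * B.
  move=> mz zu; rewrite -(RintegralZl K measurableT IUA).
  have mzA := measurable_superlevel k mz.
  have m1z : meas (\1_[set x | k < z x]) by apply: measurable_indic.
  apply: ae_le_Rint.
  - apply: (integ_dom (measM (meas_norm (measM mh hu)) m1z) _ Ihu) => x.
    by rewrite normrM normr_id ler_piMr// indicE; case: (_ \in _); rewrite ?normr1 ?normr0.
  - exact: integZ.
  - by move=> x; rewrite mulr_ge0.
  - by move=> x; rewrite mulr_ge0.
  apply: (ae_mono _ aeK) => x hx; rewrite mulrA; apply: ler_pM => //.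
  rewrite !indicE; have [|_] := boolP (x \in [set x | k < z x]); last by [].
  rewrite inE /= => kz; rewrite mem_set//; apply: kA.
  by rewrite -zu; apply: lt_le_trans kz (ler_norm _).
have sub (z : T -> R) : (forall x, `|z x| = `|uh x|) -> [set x | k < z x] `<=` A.
  by move=> zu x /= kz; apply: kA; rewrite -zu; apply: lt_le_trans kz (ler_norm _).
have small (z : T -> R) : meas z -> (forall x, `|z x| = `|uh x|) ->
    (2%:E * mu [set x | (k < z x)%R] < mu (cube r))%E.
  move=> mz zu; apply: le_lt_trans hA; rewrite lee_pmul2l//.
  by apply: le_measure; rewrite ?inE//; [exact: measurable_superlevel|exact: sub].
have mN := measN hu.
have zN x : `|(\- uh)%R x| = `|uh x| by rewrite /= normrN.
have L1 := level_estimate oO fO p1 k0 r0 sob Ih Ihu Heq (small _ hu (fun x => erefl)).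
have smallN : (2%:E * mu [set x | (k < ((fun x => - u x) \_ Omega) x)%R] < mu (cube r))%E.
  by rewrite rN; exact: small.
have L2 := level_estimate oO fO p1 k0 r0 sobN IhN IhuN HeqN smallN.
move: L1 L2; rewrite !rN -/uh -/hh.
have -> : (fun x => `|(\- hh)%R x * (\- uh)%R x| * \1_[set x0 | k < (\- uh)%R x0] x) =
   (fun x => `|hh x * uh x| * \1_[set x0 | k < (\- uh)%R x0] x).
  by apply/funext => x; rewrite /= mulrNN.
have b1 := bound _ hu (fun x => erefl).
have b2 := bound _ mN zN.
move: b1 b2; set E1 := \int[mu]_x _; set E2 := \int[mu]_x _ => b1 b2 L1 L2.
have rp : 0 <= (2 * N%:R * r) `^ p by exact: powR_ge0.
have mx1 := meas_excess k hu; have mx2 := meas_excess k mN.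
have fin (z : T -> R) c : meas z -> (\int[mu]_x (`|excess k z x| `^ p)%:E <= c%:E)%E ->
    integ mu (fun x => excess k z x `^ p) /\ \int[mu]_x (excess k z x `^ p) <= c.
  move=> mz hz; have mx := meas_excess k mz.
  have e x : `|excess k z x| `^ p = excess k z x `^ p by rewrite ger0_norm// excess_ge0.
  have h' : (\int[mu]_x (excess k z x `^ p)%:E <= c%:E)%E.
    by move: hz; under eq_integral do rewrite e.
  have I : integ mu (fun x => excess k z x `^ p).
    apply/integP; split; first by have := meas_powR p mx; under eq_fun do rewrite e.
    under eq_integral do rewrite ger0_norm ?powR_ge0//.
    by apply: le_lt_trans h' _; rewrite ltry.
  by split => //; rewrite -lee_fin -EFin_Rint// => x; exact: powR_ge0.
have [I1 J1] := fin _ _ hu L1.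
have [I2 J2] := fin _ _ mN L2.
apply: (@le_trans _ _ (\int[mu]_x (excess k uh x `^ p + excess k (\- uh)%R x `^ p))).
  have pp x : pos_part k `|uh x| `^ p <= excess k uh x `^ p + excess k (\- uh)%R x `^ p.
    rewrite /pos_part /excess /=; have [u0|u0] := leP 0 (uh x).
      by rewrite ger0_norm// lerDl powR_ge0.
    by rewrite ltr0_norm// lerDr powR_ge0.
  have mpp : meas (fun x => pos_part k `|uh x| `^ p).
    apply: (measurableT_comp (measurable_powR p)); apply: measurable_maxr.
      exact: (measB (meas_norm hu) (measurable_cst k)).
    exact: measurable_cst.
  have I12 := integD I1 I2.
  apply: le_Rintegral => //.
  apply: (integ_dom mpp _ I12) => x.
  have q1 : 0 <= pos_part k `|uh x| `^ p by exact: powR_ge0.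
  by rewrite (ger0_norm q1) (ger0_norm (le_trans q1 (pp x))); exact: pp.
rewrite (RintegralD measurableT I1 I2).
apply: le_trans (lerD J1 J2) _.
have h1 : (2 * N%:R * r) `^ p * E1 <= (2 * N%:R * r) `^ p * (K * B) by rewrite ler_wpM2l.
have h2 : (2 * N%:R * r) `^ p * E2 <= (2 * N%:R * r) `^ p * (K * B) by rewrite ler_wpM2l.
set C := (2 * N%:R * r) `^ p in h1 h2 *.
rewrite [leRHS](_ : _ = 2 * (C * (K * B)) + 2 * (C * (K * B))); last by ring.
by apply: lerD; rewrite ler_pM2l.
Qed.

End AbsLevel.

(** * The coupled system *)

Section CoupledSystem.
Context (R : realType) (N : nat) (Omega : set 'rV[R]_N) (oO : open Omega).
Implicit Types (u v h : 'rV[R]_N -> R) (p : R).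
Local Notation mu := (leb R N).
Local Notation T := (lebT R N).
Local Notation meas := (@meas _ (lebT R N) R).
Hypothesis fO : (mu Omega < +oo)%E.

(** With Z = x^p + y^q one has x^a <= Z^(a/p) and y^b <= Z^(b/q), and the
    exponents add up to 1. *)
Lemma young_max (x y a b p q : R) : 0 <= x -> 0 <= y -> 0 < a -> 0 < b -> 0 < p -> 0 < q ->
  a / p + b / q = 1 -> x `^ a * y `^ b <= x `^ p + y `^ q.
Proof.
move=> x0 y0 a0 b0 p0 q0 ab.
have xa : x `^ a = (x `^ p) `^ (a / p) by rewrite -powRrM mulrC divfK// gt_eqF.
have yb : y `^ b = (y `^ q) `^ (b / q) by rewrite -powRrM mulrC divfK// gt_eqF.
have X0 := powR_ge0 x p; have Y0 := powR_ge0 y q.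
rewrite xa yb.
have ap0 : 0 <= a / p by rewrite divr_ge0 ?ltW.
have bq0 : 0 <= b / q by rewrite divr_ge0 ?ltW.
apply: (@le_trans _ _ ((x `^ p + y `^ q) `^ (a / p) * (x `^ p + y `^ q) `^ (b / q))).
  apply: ler_pM; rewrite ?powR_ge0//; apply: ge0_ler_powR;
    by rewrite ?nnegrE ?addr_ge0// ?lerDl ?lerDr.
have [->|n0] := eqVneq (x `^ p + y `^ q) 0.
  by rewrite powR0 ?mul0r// gt_eqF// divr_gt0.
by rewrite -powRD ?ab ?powRr1 ?addr_ge0// n0 implybT.
Qed.

Lemma LpOn_oo_bound u M : meas (u \_ Omega) ->
  (\forall x \ae mu, `|(u \_ Omega) x| <= M) -> LpOn Omega +oo%E u.
Proof.
move=> mu_ H; rewrite /LpOn inE; apply/andP; rewrite !inE; split => //=.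
rewrite /finite_norm unlock; case: ifPn => // _.
apply: (@le_lt_trans _ _ M%:E); last by rewrite ltry.
by apply/ess_supP; apply: (ae_mono _ H) => x hx; rewrite /= lee_fin.
Qed.

Lemma LpOn_oo_ae k : (0 < mu setT)%E -> LpOn Omega +oo%E k ->
  exists2 M : R, 0 <= M & \forall x \ae mu, `|(k \_ Omega) x| <= M.
Proof.
move=> T0; rewrite /LpOn inE => /andP[_]; rewrite inE /= /finite_norm unlock T0.
move=> /ess_supr_bounded [M HM]; exists `|M| => //.
by apply: (ae_mono _ HM) => x hx; apply: le_trans hx (ler_norm _).
Qed.

(** On a set of finite measure, by |h| <= 1 + |h|^r. *)
Lemma LpOn_integ r h : 1 < r -> LpOn Omega r%:E h -> integ mu (h \_ Omega).
Proof.
move=> r1 /LpOnP[mh fh].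
have r0 : 0 < r by exact: lt_trans r1.
have I := (pnorm_lty mu r0 mh).1 fh.
have I1 : integ mu (\1_Omega) by apply: integ_indic => //; exact: measurable_Omega.
apply: (integ_dom mh _ (integD I1 I)) => x.
rewrite [leRHS]ger0_norm ?addr_ge0 ?powR_ge0//=.
have [Ox|Ox] := pselect (Omega x); last first.
  by rewrite restrict_out// normr0 addr_ge0 ?powR_ge0.
rewrite indicE mem_set//=.
have [l1|l1] := leP `|(h \_ Omega) x| 1; first by rewrite ler_wpDr ?powR_ge0.
rewrite ler_wpDl// -[leLHS]powRr1// ler_powR ?ltW//.
Qed.

(** The normalization a = |u| / M^(1/p), b = |v| / M^(1/q) divides both
    |u|^p and |v|^q by M. The estimates above a level are homogeneous for it,
    so their constants do not depend on M, whereas the energy above the level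
    1 tends to 0 as M grows: for a large M, [de_giorgi_iteration] applies. *)
Lemma coupled_bound p q u v Gu Gv hu hv (K : R) : (0 < N)%N ->
  1 < p < N%:R -> 1 < q < N%:R -> (0 < mu setT)%E -> 0 <= K ->
  sobolev0 Omega p u Gu -> sobolev0 Omega q v Gv ->
  integ mu (hu \_ Omega) -> integ mu (hv \_ Omega) ->
  tests_against Omega p Gu hu -> tests_against Omega q Gv hv ->
  (\forall x \ae mu, `|(hu \_ Omega) x * (u \_ Omega) x| <=
     K * (`|(u \_ Omega) x| `^ p + `|(v \_ Omega) x| `^ q)) ->
  (\forall x \ae mu, `|(hv \_ Omega) x * (v \_ Omega) x| <=
     K * (`|(u \_ Omega) x| `^ p + `|(v \_ Omega) x| `^ q)) ->
  exists M : R, \forall x \ae mu, `|(u \_ Omega) x| <= M /\ `|(v \_ Omega) x| <= M.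
Proof.
move=> N0 /andP[p1 pN] /andP[q1 qN] T0 K0 sobu sobv Ihu Ihv tu tv aeu aev.
have p0 : 0 < p by exact: lt_trans p1.
have q0 : 0 < q by exact: lt_trans q1.
have [mu_ _ fu _ _] := sobolev0_W0ext sobu.
have [mv_ _ fv _ _] := sobolev0_W0ext sobv.
set uh := u \_ Omega in mu_ fu aeu aev *; set vh := v \_ Omega in mv_ fv aeu aev *.
have Iu := (pnorm_lty mu p0 mu_).1 fu; have Iv := (pnorm_lty mu q0 mv_).1 fv.
pose U (x : T) := `|uh x| `^ p + `|vh x| `^ q.
have U0 x : 0 <= U x by rewrite addr_ge0 ?powR_ge0.
have IU : integ mu U := integD Iu Iv.
set S := \int[mu]_x U x; have S0 : 0 <= S by exact: Rintegral_ge0.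
have Q0 : (0 < mu (cube 1))%E.
  rewrite lt0e measure_ge0 andbT; apply/eqP => /(leb_cube0 N0) h.
  by move: T0; rewrite h ltxx.
have Qfin : (mu (cube 1) < +oo)%E by apply: le_lt_trans (leb_box_le _) _; rewrite ltry.
pose c0 := fine (mu (cube 1)).
have c00 : 0 < c0 by rewrite fine_gt0// Q0.
have c0E : mu (cube 1) = c0%:E by rewrite /c0 fineK// ge0_fin_numE.
(* Each of the two equations contributes 4 K (2 N r)^e with e = p or q, which
   is at most 4 K (2 N)^N r for r <= 1. *)
pose L : R := 8 * K * (2 * N%:R) ^+ N.
have L0 : 0 <= L by rewrite !mulr_ge0// exprn_ge0// mulr_ge0.
pose D := growth_const R N * L * 2 ^+ N.
have D0 : 0 <= D by rewrite !mulr_ge0 ?exprn_ge0// /growth_const addr_ge0 ?mulr_ge0 ?exprn_ge0.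
pose h2 : R := (2^-1) ^+ (N * N).
have h20 : 0 < h2 by rewrite exprn_gt0.
have h21 : h2 <= 1 by rewrite exprn_ile1 ?invr_ge0// invf_le1// ler1n.
(* Small enough for D r0 <= 2^(-N^2). *)
pose r0 := h2 / (D + 1).
have D10 : 0 < D + 1 by rewrite ltr_wpDl.
have r00 : 0 < r0 by rewrite divr_gt0.
have r01 : r0 <= 1 by rewrite ler_pdivrMr// mul1r (le_trans h21)// lerDr.
have Dr0 : D * r0 <= h2 by rewrite /r0 mulrCA ler_piMr ?(ltW h20)// ler_pdivrMr// mul1r lerDl.
pose E0 := c0 / 4 * r0 ^+ N.
have E00 : 0 < E0 by rewrite mulr_gt0 ?divr_gt0 ?exprn_gt0.
(* The energy above level 1 is at most S / M, hence at most E0. *)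
pose M := S / E0 + 1.
have M0 : 0 < M by rewrite ltr_wpDl// divr_ge0// ltW.
pose la := M `^ p^-1; pose ka := M `^ q^-1.
have la0 : 0 < la by exact: powR_gt0.
have ka0 : 0 < ka by exact: powR_gt0.
have laM : la `^ p = M by rewrite -powRrM mulVf ?gt_eqF// powRr1// ltW.
have kaM : ka `^ q = M by rewrite -powRrM mulVf ?gt_eqF// powRr1// ltW.
pose a (x : T) := la^-1 * `|uh x|; pose b (x : T) := ka^-1 * `|vh x|.
have a0 x : 0 <= a x by rewrite mulr_ge0// invr_ge0 ltW.
have b0 x : 0 <= b x by rewrite mulr_ge0// invr_ge0 ltW.
have ma : meas a := measZ _ (meas_norm mu_).
have mb : meas b := measZ _ (meas_norm mv_).
have sc (l e z : R) : 0 < l -> l `^ e = M -> 0 <= z -> (l^-1 * z) `^ e = M^-1 * z `^ e.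
  move=> l0 lM z0; rewrite powRM ?invr_ge0 ?(ltW l0)//; congr (_ * _).
  by rewrite -powR_inv1 ?(ltW l0)// powRAC lM powR_inv1 ?(ltW M0).
have aE x : a x `^ p = M^-1 * `|uh x| `^ p by exact: sc.
have bE x : b x `^ q = M^-1 * `|vh x| `^ q by exact: sc.
have Ia : integ mu (fun x => a x `^ p) by under eq_fun do rewrite aE; exact: integZ.
have Ib : integ mu (fun x => b x `^ q) by under eq_fun do rewrite bE; exact: integZ.
have ppsc (l e s z : R) : 0 < l -> l `^ e = M ->
  pos_part s (l^-1 * z) `^ e = M^-1 * pos_part (l * s) z `^ e.
  move=> l0 lM; rewrite -(sc l e) ?pos_part_ge0//; congr (_ `^ _).
  rewrite /pos_part maxr_pMr ?invr_ge0 ?(ltW l0)// mulr0; congr (Num.max _ _).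
  by rewrite mulrBr mulrA mulVf ?mul1r// gt_eqF.
pose A s := upper_set a b s.
have mA s : measurable (A s) by exact: measurable_upper_set.
have Ipp l e s (z : T -> R) : 0 < l -> 0 < e -> 0 <= s -> l `^ e = M ->
  meas z -> integ mu (fun x => `|z x| `^ e) ->
    integ mu (fun x => pos_part (l * s) `|z x| `^ e).
  move=> l0 e0 s0 lM mz Iz.
  have mp : meas (fun x => pos_part (l * s) `|z x| `^ e).
    apply: (measurableT_comp (measurable_powR e)); apply: measurable_maxr.
      exact: (measB (meas_norm mz) (measurable_cst (l * s))).
    exact: measurable_cst.
  apply: (integ_dom mp _ Iz) => x.
  have q1' : 0 <= pos_part (l * s) `|z x| `^ e by exact: powR_ge0.
  rewrite (ger0_norm q1') [leRHS]ger0_norm ?powR_ge0//.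
  by apply: pos_part_le; rewrite ?mulr_ge0// ltW.
have EA s : energy_above mu p q a b s = M^-1 * \int[mu]_x (U x * \1_(A s) x).
  have IUA : integ mu (fun x => U x * \1_(A s) x).
    have m1A : meas (\1_(A s)) by apply: measurable_indic.
    apply: (integ_dom (measM (integ_meas IU) m1A) _ IU) => x.
    by rewrite normrM ler_piMr// indicE; case: (_ \in _); rewrite ?normr1 ?normr0.
  rewrite -(RintegralZl _ measurableT IUA); apply: eq_Rintegral => x _.
  by rewrite aE bE -mulrDr mulrA.
have step s r : 1 <= s <= 2 -> 0 < r <= 1 ->
    (2%:E * mu (A s) < (c0 * r ^+ N)%:E)%E ->
    excess_energy mu p q a b s <= L * r * energy_above mu p q a b s.
  move=> /andP[s1 s2] /andP[r0' r1] hA.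
  have s0 : 0 <= s := le_trans ler01 s1.
  have hA' : (2%:E * mu (A s) < mu (cube r))%E.
    apply: (lt_le_trans hA); rewrite mulrC EFinM -c0E; exact: leb_cube_ge.
  have Au x : la * s < `|uh x| -> A s x.
    by move=> h; rewrite /A /upper_set /= lt_max /a ltr_pdivlMl// h.
  have Av x : ka * s < `|vh x| -> A s x.
    by move=> h; rewrite /A /upper_set /= lt_max /b orbC ltr_pdivlMl// h.
  have las : 0 <= la * s by rewrite mulr_ge0// ltW.
  have kas : 0 <= ka * s by rewrite mulr_ge0// ltW.
  have B1 := abs_level oO fO p1 las r0' K0 sobu Ihu tu IU U0 aeu (mA s) Au hA'.
  have B2 := abs_level oO fO q1 kas r0' K0 sobv Ihv tv IU U0 aev (mA s) Av hA'.
  rewrite EA; set B := \int[mu]_x (U x * \1_(A s) x) in B1 B2 *.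
  have BB0 : 0 <= B by apply: Rintegral_ge0 => x _; rewrite mulr_ge0.
  have IP1 := Ipp la p s uh la0 p0 s0 laM mu_ Iu.
  have IP2 := Ipp ka q s vh ka0 q0 s0 kaM mv_ Iv.
  have -> : excess_energy mu p q a b s =
     M^-1 * (\int[mu]_x (pos_part (la * s) `|uh x| `^ p) + \int[mu]_x (pos_part (ka * s) `|vh x| `^ q)).
    rewrite -(RintegralD measurableT IP1 IP2) -(RintegralZl _ measurableT (integD IP1 IP2)).
    apply: eq_Rintegral => x _.
    by rewrite /a /b (ppsc la p)// (ppsc ka q)// -mulrDr.
  rewrite [leRHS]mulrCA ler_pM2l ?invr_gt0//.
  have N1 : 1 <= N%:R :> R by rewrite ler1n.
  have cste e : 1 < e -> e < N%:R -> (2 * N%:R * r) `^ e <= (2 * N%:R) ^+ N * r.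
    move=> e1 eN; have e0 : 0 <= e := ltW (lt_trans ltr01 e1).
    rewrite powRM ?mulr_ge0 ?(ltW r0')//; apply: ler_pM; rewrite ?powR_ge0//.
      by rewrite -powR_mulrn ?mulr_ge0//; apply: ler_powR (ltW eN); rewrite -natrM ler1n muln_gt0.
    by apply: powR_le_self; [rewrite (ltW r0') r1|exact: ltW].
  have KB : 0 <= K * B by rewrite mulr_ge0.
  have C1 := ler_wpM2r KB (cste p p1 pN); have C2 := ler_wpM2r KB (cste q q1 qN).
  apply: le_trans (lerD B1 B2) _.
  rewrite -!mulrA in B1 B2 C1 C2 *.
  rewrite [leRHS](_ : _ = 4 * ((2 * N%:R) ^+ N * (r * (K * B))) +
    4 * ((2 * N%:R) ^+ N * (r * (K * B)))); last by rewrite /L; ring.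
  by apply: lerD; rewrite ler_pM2l.
have start : energy_above mu p q a b 1 <= c0 / 4 * r0 ^+ N.
  rewrite EA ler_pdivrMl// -/E0.
  apply: (@le_trans _ _ S).
    have m1A : meas (\1_(A 1)) by apply: measurable_indic.
    have le1 x : U x * \1_(A 1) x <= U x.
      by rewrite ler_piMr// indicE; case: (_ \in _).
    apply: le_Rintegral => //.
    apply: (integ_dom (measM (integ_meas IU) m1A) _ IU) => x.
    by rewrite normrM ler_piMr// indicE; case: (_ \in _); rewrite ?normr1 ?normr0.
  by rewrite /M mulrDl divfK ?mul1r ?lerDl ?(ltW E00)// gt_eqF.
have null := de_giorgi_iteration (ltW p1) (ltW pN) (ltW q1) (ltW qN) ma mb a0 b0 Ia Ib L0 c00
  (_ : 0 < r0 <= 1) N0 step Dr0 start.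
exists (Num.max (la * 2) (ka * 2)).
exists (A 2); split; [exact: mA|by apply: null; rewrite r00|].
move=> x /= /not_andP H; rewrite /A /upper_set /= lt_max /a /b !ltr_pdivlMl//.
by case: H => /negP; rewrite -ltNge gt_max => /andP[h1 h3]; rewrite ?h1 ?h3 ?orbT.
Qed.

End CoupledSystem.

(** * Boundedness of the solutions *)

Theorem theorem2 (R : realType) (N : nat) (Omega : set 'rV[R]_N)
  (p q C alpha beta : R) (f g : 'rV[R]_N -> R -> R -> R)
  (hN : (2 <= N)%N)
  (hOmega : smooth_bounded_domain Omega)
  (hp : 1 < p < N%:R) (hq : 1 < q < N%:R)
  (hC : 1 < C < Num.min (sobolev_exp N p / p) (sobolev_exp N q / q))
  (hf : caratheodory Omega f) (hg : caratheodory Omega g)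
  (h1 : superposition_Lp Omega p q C f g)
  (halpha : -1 < alpha) (hbeta : -1 < beta)
  (hab : (alpha + 1) / p + (beta + 1) / q = 1)
  (h2 : growth_bound Omega p q C alpha beta f g) :
  forall u v : 'rV[R]_N -> R, solution Omega p q f g u v ->
    LpOn Omega +oo%E u /\ LpOn Omega +oo%E v.
Proof.
move=> u v [Gu [Gv [su sv H]]].
have [oO _ _ bO _] := hOmega.
have N0 : (0 < N)%N by exact: ltnW.
have fO : (leb R N Omega < +oo)%E.
  have [n On] := bounded_big_box bO.
  have le_box : (leb R N Omega <= leb R N (big_box n))%E := le_leb_outer On.
  exact: le_lt_trans le_box (leb_big_box_lty R N n).
have /andP[p1 pN] := hp; have /andP[q1 qN] := hq; have /andP[C1 _] := hC.
have conj1 (e : R) : 1 < e -> 1 < conj_exp C e.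
  move=> e1; have Ce : 1 < C * e by rewrite mulr_egt1.
  by rewrite /conj_exp ltr_pdivlMr ?subr_gt0// mul1r gtrBl.
have [mu_ _ _ _ _] := sobolev0_W0ext su; have [mv_ _ _ _ _] := sobolev0_W0ext sv.
have [Lf Lg] := h1 u v (ex_intro _ Gu su) (ex_intro _ Gv sv).
have If := LpOn_integ oO fO (conj1 p p1) Lf.
have Ig := LpOn_integ oO fO (conj1 q q1) Lg.
(* The iteration compares superlevel sets with cubes, which must not be null. *)
have [T0|] := ltP 0%E (leb R N setT); last first.
  move=> T0; have T00 : leb R N setT = 0%E by apply/eqP; rewrite eq_le T0 measure_ge0.
  have ae0 (w : 'rV[R]_N -> R) : \forall x \ae leb R N, `|(w \_ Omega) x| <= 0.
    by exists setT; split.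
  by split; apply: LpOn_oo_bound (ae0 _).
have [k [k0 kL kae]] := h2.
have [K K0 HK] := LpOn_oo_ae T0 kL.
have a0 : 0 < alpha + 1 by rewrite -ltrBlDr sub0r.
have b0 : 0 < beta + 1 by rewrite -ltrBlDr sub0r.
have p0 : 0 < p := lt_trans ltr01 p1.
have q0 : 0 < q := lt_trans ltr01 q1.
have growth : \forall x \ae leb R N, Omega x ->
    Num.max `|u x * f x (u x) (v x)| `|v x * g x (u x) (v x)| <= K * (`|u x| `^ p + `|v x| `^ q).
  apply: (ae_mono _ (ae_conj kae HK)) => x [kx Kx] Ox.
  apply: le_trans (kx Ox (u x) (v x)) _.
  rewrite restrict_in// in Kx.
  apply: ler_pM; first exact/ltW/k0.
  - by rewrite le_min mulr_ge0 ?addr_ge0 ?powR_ge0.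
  - exact: le_trans (ler_norm _) Kx.
  - by rewrite ge_min young_max.
have tf : tests_against Omega p Gu (fun x => f x (u x) (v x)).
  by move=> phi Gphi sphi; have [] := H _ _ _ _ sphi sv.
have tg : tests_against Omega q Gv (fun x => g x (u x) (v x)).
  by move=> psi Gpsi spsi; have [] := H _ _ _ _ su spsi.
have bound (w c : 'rV[R]_N -> R) x : (Omega x -> `|w x * c x| <= K * (`|u x| `^ p + `|v x| `^ q)) ->
    `|(c \_ Omega) x * (w \_ Omega) x| <= K * (`|(u \_ Omega) x| `^ p + `|(v \_ Omega) x| `^ q).
  have [Ox|Ox] := pselect (Omega x); first by rewrite !restrict_in// mulrC; apply.
  by move=> _; rewrite !restrict_out// mulr0 normr0 mulr_ge0// addr_ge0 ?powR_ge0.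
have [||M HM] := coupled_bound oO fO N0 hp hq T0 K0 su sv If Ig tf tg.
- apply: (ae_mono _ growth) => x gx; apply: bound => Ox.
  by apply: le_trans (gx Ox); rewrite le_max lexx.
- apply: (ae_mono _ growth) => x gx; apply: bound => Ox.
  by apply: le_trans (gx Ox); rewrite le_max lexx orbT.
by split; [apply: (@LpOn_oo_bound _ _ _ _ M) => //|apply: (@LpOn_oo_bound _ _ _ _ M) => //];
  apply: (ae_mono _ HM) => x [].
Qed.
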